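(* Let $M$ be a smooth manifold of dimension $r+m+q$. Let $\alpha,\beta>1$ and let $\mathcal V\le\mathcal E\le TM$ be two involutive real tangent subbundles such that $\mathcal V\in\mathcal C^\alpha$, $\mathcal E\in\mathcal C^\beta$, $\operatorname{rank}\mathcal V=r$ and $\operatorname{rank}\mathcal E=r+m$. Then for any $p\in M$ there is a $\mathcal C^{\min(\alpha,\beta)}$-coordinate system $F=(F',F'',F'''):U\subseteq M\to\mathbb R^r_t\times\mathbb R^m_x\times\mathbb R^q_s$ on a neighborhood $U$ of $p$ such that $\mathcal V|_U$ is spanned by $F^*\frac{\partial}{\partial t^1},\dots,F^*\frac{\partial}{\partial t^r}$ and $\mathcal E|_U$ is spanned by $F^*\frac{\partial}{\partial t^1},\dots,F^*\frac{\partial}{\partial t^r},F^*\frac{\partial}{\partial x^1},\dots,F^*\frac{\partial}{\partial x^m}$. Moreover $F'\in\mathcal C^\infty$, $F''\in\mathcal C^\alpha$, $F'''\in\mathcal C^\beta$, $F^*\frac{\partial}{\partial t^1},\dots,F^*\frac{\partial}{\partial t^r}\in\mathcal C^\alpha$ and $F^*\frac{\partial}{\partial x^1},\dots,F^*\frac{\partial}{\partial x^m}\in\mathcal C^{\min(\alpha-1,\beta)}$.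
   Context: Hölder-Zygmund classes: for a convex open $\Omega\subseteq\mathbb R^n$ and $0<\alpha<1$, $\mathcal C^\alpha(\Omega)$ is the space of bounded continuous $f$ with $\sup_{x\ne y}|x-y|^{-\alpha}|f(x)-f(y)|<\infty$; $\mathcal C^1(\Omega)$ is the space of bounded continuous $f$ with $\sup_{x\neq y}|x-y|^{-1}\left|\frac{f(x)+f(y)}2-f(\frac{x+y}2)\right|<\infty$; for $\alpha>1$, $f\in\mathcal C^\alpha$ iff $f,\partial_1f,\dots,\partial_nf\in\mathcal C^{\alpha-1}$; $\mathcal C^\infty=\bigcap_{\beta>0}\mathcal C^\beta$. On manifolds these regularities are understood locally in smooth coordinates. A real tangent subbundle $\mathcal V\le TM$ of rank $k$ is $\mathcal C^\alpha$ (written $\mathcal V\in\mathcal C^\alpha$) if near every point it has a basis of $k$ $\mathcal C^\alpha$ real vector fields. It is involutive if $[X,Y]$ is a $C^0$ section of it whenever $X,Y$ are $C^1$ sections of it. $\mathcal V\le\mathcal E$ means $\mathcal V$ is a subbundle of $\mathcal E$. $(t,x,s)$ are the standard coordinates of $\mathbb R^r\times\mathbb R^m\times\mathbb R^q$. *)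

(* Defs.v *)
From HB Require Import structures.
From mathcomp Require Import all_boot all_order all_algebra.
From mathcomp Require Import all_classical all_reals all_analysis.
Set Implicit Arguments.
Unset Strict Implicit.
Unset Printing Implicit Defensive.
Import Order.TTheory GRing.Theory Num.Theory.
Import numFieldNormedType.Exports.
Local Open Scope classical_set_scope.
Local Open Scope ring_scope.

(* Regularity classes on open sets of R^n.  A class is a predicate
   [cls O f] on a set O and a real function f, which depends only on the
   restriction of f to O when O is open. *)
Section RegularityClasses.
Context {R : realType} {n : nat}.
Implicit Types (O : set 'rV[R]_n) (f : 'rV[R]_n -> R).

Definition regularity_class := set 'rV[R]_n -> ('rV[R]_n -> R) -> Prop.

Definition basis_vec (i : 'I_n) : 'rV[R]_n := delta_mx 0 i.

Definition bounded_continuous : regularity_class := fun O f =>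
  [bounded f x | x in O] /\ {within O, continuous f}.

(* `|x - y| is the sup norm of the library; any other norm, in particular the
   Euclidean one, gives the same classes. *)
Definition hoelder (alpha : R) : regularity_class := fun O f =>
  bounded_continuous O f /\
  exists K : R, forall x y, O x -> O y -> x != y ->
    `|x - y| `^ (- alpha) * `|f x - f y| <= K.

Definition zygmund : regularity_class := fun O f =>
  bounded_continuous O f /\
  exists K : R, forall x y, O x -> O y -> x != y ->
    `|x - y|^-1 * `|(f x + f y) / 2 - f (2^-1 *: (x + y))| <= K.

(* The space C^alpha(O) for alpha > 0 and O a convex open set. *)
Inductive hoelder_zygmund (O : set 'rV[R]_n) : R -> ('rV[R]_n -> R) -> Prop :=
| HZ_hoelder alpha f : 0 < alpha < 1 -> hoelder alpha O f ->
    hoelder_zygmund O alpha f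
| HZ_zygmund f : zygmund O f -> hoelder_zygmund O 1 f
| HZ_step alpha f : 1 < alpha -> hoelder_zygmund O (alpha - 1) f ->
    (forall i x, O x -> derivable f x (basis_vec i)) ->
    (forall i, hoelder_zygmund O (alpha - 1) ('D_(basis_vec i) f)) ->
    hoelder_zygmund O alpha f.

Definition HZ (alpha : R) : regularity_class := fun O f =>
  hoelder_zygmund O alpha f.

Definition HZ_infty : regularity_class := fun O f =>
  forall beta : R, 0 < beta -> HZ beta O f.

(* The classical C^0 and C^1, not to be confused with [HZ 1]. *)
Definition class_C0 : regularity_class := fun O f => {within O, continuous f}.

Definition class_C1 : regularity_class := fun O f =>
  [/\ class_C0 O f,
      forall i x, O x -> derivable f x (basis_vec i) &
      forall i, class_C0 O ('D_(basis_vec i) f)].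

Definition locally_class (cls : regularity_class) (A : set 'rV[R]_n) k
    (g : 'rV[R]_n -> 'rV[R]_k) : Prop :=
  forall x, A x -> exists O : set 'rV[R]_n,
    [/\ open O, convex_set O, O x, O `<=` A &
        forall j : 'I_k, cls O (fun y => g y 0 j)].

End RegularityClasses.
Arguments regularity_class : clear implicits.

(* A homeomorphism from the open set [chart_dom] of M onto an open set of R^n.
   Both maps are total functions, with arbitrary values outside of the domain,
   resp. the range. *)
Record chart (R : realType) (n : nat) (M : topologicalType) := Chart {
  chart_dom : set M ;
  chart_map :> M -> 'rV[R]_n ;
  chart_inv : 'rV[R]_n -> M ;
  chart_dom_open : open chart_dom ;
  chart_range_open : open (chart_map @` chart_dom) ;
  chart_mapK : {in chart_dom, cancel chart_map chart_inv} ;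
  chart_map_continuous : {within chart_dom, continuous chart_map} ;
  chart_inv_continuous :
    {within chart_map @` chart_dom, continuous chart_inv} }.

Definition transition_class (R : realType) (n : nat) (M : topologicalType)
    (cls : regularity_class R n) (c d : chart R n M) : Prop :=
  locally_class cls (c @` (chart_dom c `&` chart_dom d)) (d \o chart_inv c).

Record smoothManifold (R : realType) (n : nat) := SmoothManifold {
  manifold_space :> topologicalType ;
  atlas : set (chart R n manifold_space) ;
  manifold_hausdorff : hausdorff_space manifold_space ;
  manifold_second_countable : @second_countable manifold_space ;
  atlas_cover : forall p, exists2 c, atlas c & chart_dom c p ;
  atlas_smooth : forall c d, atlas c -> atlas d ->
    transition_class HZ_infty c d }.

Section Manifolds.
Context {R : realType} {n : nat} {M : smoothManifold R n}.
Implicit Types (U : set M) (c : chart R n M) (p : M).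

Definition chart_at p : chart R n M := sval (cid2 (atlas_cover p)).

(* Regularity on the open set U of a map, read in the smooth coordinates. *)
Definition map_class (cls : regularity_class R n) U k (g : M -> 'rV[R]_k) :=
  forall c, atlas c ->
    locally_class cls (c @` (chart_dom c `&` U)) (g \o chart_inv c).

(* A cls-coordinate system: a cls-diffeomorphism, with respect to the smooth
   structure of M, from an open set of M onto an open set of R^n. *)
Definition coordinate_system (cls : regularity_class R n) (F : chart R n M) :=
  forall c, atlas c -> transition_class cls c F /\ transition_class cls F c.

(* The tangent space T_pM is identified with R^n by means of the preferred
   chart [chart_at p].  In particular a vector field on M is a function from M
   to 'rV[R]_n whose value at p is given by its components in [chart_at p]. *)
Definition vector_field := M -> 'rV[R]_n.

(* The components in the chart c of the tangent vector v at p. *)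
Definition tangent_coord c p (v : 'rV[R]_n) : 'rV[R]_n :=
  'd (c \o chart_inv (chart_at p)) (chart_at p p) v.

Definition field_in_chart (X : vector_field) c : 'rV[R]_n -> 'rV[R]_n :=
  fun y => let p := chart_inv c y in tangent_coord c p (X p).

Definition field_class (cls : regularity_class R n) U (X : vector_field) :=
  forall c, atlas c ->
    locally_class cls (c @` (chart_dom c `&` U)) (field_in_chart X c).

(* [X, Y] = sum_(i, j) (X^i d_i Y^j - Y^i d_i X^j) d_j, computed at p in the
   coordinates [chart_at p]. *)
Definition lie_bracket (X Y : vector_field) : vector_field := fun p =>
  let c := chart_at p in
  \sum_(i < n) (X p 0 i *: 'D_(basis_vec i) (field_in_chart Y c) (c p)
              - Y p 0 i *: 'D_(basis_vec i) (field_in_chart X c) (c p)).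

(* F^* (d/dy^i), the image of the i-th standard coordinate vector field of R^n
   under the differential of the inverse of F. *)
Definition pullback_partial (F : chart R n M) (i : 'I_n) : vector_field :=
  fun p => 'd (chart_at p \o chart_inv F) (F p) (basis_vec i).

End Manifolds.
Arguments vector_field {R n} M.

Record tangentSubbundle (R : realType) (n : nat) (M : smoothManifold R n)
    (k : nat) := TangentSubbundle {
  fiber :> M -> {vspace 'rV[R]_n} ;
  fiber_rank : forall p, \dim (fiber p) = k }.

Section Subbundles.
Context {R : realType} {n : nat} {M : smoothManifold R n}.

Definition subbundle_class (cls : regularity_class R n) k
    (V : tangentSubbundle M k) : Prop :=
  forall p : M, exists U : set M, exists X : 'I_k -> vector_field M,
    [/\ open U, U p, forall i, field_class cls U (X i) &
        forall x, U x -> basis_of (V x) [seq X i x | i : 'I_k]].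

Definition section_class (cls : regularity_class R n) (U : set M) k
    (V : tangentSubbundle M k) (X : vector_field M) : Prop :=
  field_class cls U X /\ forall x, U x -> X x \in V x.

Definition involutive_subbundle k (V : tangentSubbundle M k) : Prop :=
  forall (U : set M) (X Y : vector_field M), open U ->
    section_class class_C1 U V X -> section_class class_C1 U V Y ->
    section_class class_C0 U V (lie_bracket X Y).

Definition subbundle_le k l (V : tangentSubbundle M k)
    (E : tangentSubbundle M l) : Prop := forall p, (V p <= E p)%VS.

End Subbundles.

(* The standard coordinates (t, x, s) of R^r x R^m x R^q = R^(r + m + q). *)
Section StandardCoordinates.
Context {R : realType} {r m q : nat}.

Definition t_index (j : 'I_r) : 'I_(r + m + q) := lshift q (lshift m j).
Definition x_index (j : 'I_m) : 'I_(r + m + q) := lshift q (rshift r j).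

Definition t_part (v : 'rV[R]_(r + m + q)) : 'rV[R]_r := lsubmx (lsubmx v).
Definition x_part (v : 'rV[R]_(r + m + q)) : 'rV[R]_m := rsubmx (lsubmx v).
Definition s_part (v : 'rV[R]_(r + m + q)) : 'rV[R]_q := rsubmx v.

End StandardCoordinates.

(* Main.v *)
(* An involutive subbundle of class C^gamma has, in coordinates where its fiber at
   the origin is spanned by some of the coordinate directions, a row-reduced frame
   Z of class C^gamma.  Involutivity then forces the Z_j to commute, as their
   brackets have no component along these directions, and the map
   Phi(z) = (time 1 flow of sum_j z_j Z_j from the projection of z) is of class
   C^gamma, without loss of regularity: it solves
   Phi(z) = z_0 + int_0^1 sum_j z_j Z_j(Phi(s z)) ds, where s scales only the
   coordinates z_j, and this is a contraction preserving a ball of C^gamma.  So its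
   inverse H is of class C^gamma and maps Z_j to a constant coordinate field.

   Doing this for V and for E in the same linearly adapted coordinates w gives H_V
   and H_E, and the required coordinates are F = (w_t, x-part of H_V, s-part of
   H_E).  The frame of V is mapped by F to the fields d/dt, hence these have the
   regularity alpha of the frame.  The fields d/dx are obtained from the frame of E
   by inverting the matrix of its derivatives of the x-part of H_V, which has
   regularity min(alpha - 1, beta). *)
Require Import Defs.
From HB Require Import structures.
From mathcomp Require Import all_boot all_order all_algebra.
From mathcomp Require Import all_classical all_reals all_analysis.
From mathcomp Require Import ring lra.
Set Implicit Arguments.
Unset Strict Implicit.
Unset Printing Implicit Defensive.
Import Order.TTheory GRing.Theory Num.Theory.
Import numFieldNormedType.Exports.
Local Open Scope classical_set_scope.
Local Open Scope ring_scope.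

(** * Calculus in several variables *)

(** Explicit bounds are carried everywhere because the superposition [psi |-> X (id + psi)] is in
    general not Lipschitz on a class C^gamma when [X] itself is only C^gamma: comparing two images
    in that norm costs one more derivative of [X]. The fixed points are therefore contracted in the
    sup norm alone, and their regularity comes from an invariant ball of the class, closed under
    pointwise limits. Integrals are treated likewise, as limits of Riemann sums with the same bound,
    so no flow theorem or variational equation enters. The three blocks of F fit together for
    separate reasons. The coordinates w are affine in a smooth chart, which makes w_t of class
    C^infty, and the t-components of the frame of V are constant by reduction. The x-part of H_V is
    annihilated by this frame because its images are the t-directions. The s-part of H_E is
    annihilated by it because V lies in E. *)

Section RowVectors.
Context {R : realType} {n : nat}.
Implicit Types (x y v w : 'rV[R]_n) (O : set 'rV[R]_n) (f : 'rV[R]_n -> R).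

Lemma normr_coord x i : `|x 0 i| <= `|x|.
Proof.
by rewrite [leRHS]/Num.Def.normr/= mx_normrE; apply: (le_bigmax _ _ (0, i)).
Qed.

Lemma normr_rV_le x (c : R) : 0 <= c -> (forall i, `|x 0 i| <= c) -> `|x| <= c.
Proof.
move=> c0 H; rewrite [leLHS]/Num.Def.normr/= mx_normrE.
by apply: bigmax_le => // -[i j] _ /=; rewrite ord1.
Qed.

Definition between (a b c : R) := (a <= c <= b) || (b <= c <= a).

(** Mean values are taken along paths that change one coordinate at a time, so a domain must contain
    the whole coordinate box spanned by two of its points, not only their segment. Balls of the sup
    norm do. *)
Definition boxy O := forall x y w, O x -> O y ->
  (forall i, between (x 0 i) (y 0 i) (w 0 i)) -> O w.

(** Diameter at most 1 gives [d <= d ^ e] for distances [d] and exponents [e < 1], so a Lipschitz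
    bound is a Hoelder bound with the same constant. *)
Record good_domain O : Prop := GoodDomain {
  gd_open : open O ;
  gd_boxy : boxy O ;
  gd_diam : forall x y, O x -> O y -> `|x - y| <= 1 }.

Lemma ball_rVP (c x : 'rV[R]_n) (r : R) : ball c r x <-> `|c - x| < r.
Proof. by rewrite -ball_normE. Qed.

Lemma good_ball c (r : R) : r <= 2^-1 -> good_domain (ball c r).
Proof.
move=> r2; split.
- exact: ball_open.
- move=> x y w /ball_rVP xr /ball_rVP yr bw; apply/ball_rVP.
  apply: (@le_lt_trans _ _ (Num.max `|c - x| `|c - y|)); last first.
    by rewrite gt_max xr yr.
  apply: normr_rV_le => [|i]; first by rewrite le_max normr_ge0.
  have := bw i; have := normr_coord (c - x) i; have := normr_coord (c - y) i.
  rewrite !mxE /between => h1 h2 h3; rewrite le_max.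
  have : `|c 0 i - w 0 i| <= `|c 0 i - x 0 i| \/
         `|c 0 i - w 0 i| <= `|c 0 i - y 0 i|.
    have [le0|/ltW ge0] := leP 0 (c 0 i - w 0 i).
      rewrite (ger0_norm le0).
      by case/orP: h3 => /andP[h3 h4]; [left|right];
        (apply: le_trans (ler_norm _); lra).
    rewrite (ler0_norm ge0).
    by case/orP: h3 => /andP[h3 h4]; [right|left];
      (rewrite -normrN; apply: le_trans (ler_norm _); lra).
  by case=> h; apply/orP; [left; exact: le_trans h h2|right; exact: le_trans h h1].
- move=> x y /ball_rVP xr /ball_rVP yr.
  rewrite -(subrK c x) -addrA (le_trans (ler_normD _ _))// -(normrN (x - c)).
  by rewrite opprB; lra.
Qed.

Lemma is_derive_line f x v (s : R) : derivable f (s *: v + x) v ->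
  is_derive s 1 (fun h => f (h *: v + x)) ('D_v f (s *: v + x)).
Proof.
move=> df; have E : (fun h : R => h^-1 *: (f (h *: v + (s *: v + x)) - f (s *: v + x)))
   = (fun h => h^-1 *: (((fun h => f (h *: v + x)) \o shift s) (h *: (1 : R)) -
      (fun h => f (h *: v + x)) s)).
  by apply/funext => h /=; rewrite [_%:A]mulr1 scalerDl addrA.
by apply: DeriveDef; [rewrite /derivable -E|rewrite /derive -E].
Qed.

Lemma mvt_line (phi dphi : R -> R) (d : R) :
  (forall s, between 0 d s -> is_derive s 1 phi (dphi s)) ->
  exists2 c, between 0 d c & phi d - phi 0 = dphi c * d.
Proof.
move=> H.
have D s : between 0 d s -> derivable phi s 1 by move=> /H[].
have [d0|/ltW d0] := leP 0 d.
  have H' s : s \in `[0, d]%R -> between 0 d s.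
    by rewrite in_itv /between /= => ->.
  have [s /subset_itv_oo_cc /H'/H//| |c /H' c1 ->] := @MVT_segment _ phi dphi _ _ d0.
    by apply: derivable_within_continuous => s /H'/D.
  by exists c => //; rewrite subr0.
have H' s : s \in `[d, 0]%R -> between 0 d s.
  by rewrite in_itv /between /= => ->; rewrite orbT.
have [s /subset_itv_oo_cc /H'/H//| |c /H' c1 E] := @MVT_segment _ phi dphi _ _ d0.
  by apply: derivable_within_continuous => s /H'/D.
by exists c => //; rewrite -opprB E sub0r mulrN opprK.
Qed.

(** The bound on [|xi i - x|] is what lets a modulus of continuity of the partial derivatives at [x]
    be applied at the mean-value points. *)
Lemma mvt_rV O f x y : boxy O -> O x -> O y ->
  (forall i w, O w -> derivable f w (basis_vec i)) ->
  exists xi : 'I_n -> 'rV[R]_n,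
    (forall i, O (xi i) /\ `|xi i - x| <= `|y - x|) /\
    f y - f x = \sum_i (y 0 i - x 0 i) * 'D_(basis_vec i) f (xi i).
Proof.
move=> bO Ox Oy df.
(* [p j] has the first [j] coordinates of [y] and the others of [x]. The leg from [p j] to [p j.+1]
   varies coordinate [j] alone, and [f y - f x] telescopes over the legs. *)
pose p (j : nat) : 'rV[R]_n := \row_i (if (i < j)%N then y 0 i else x 0 i).
pose q (j : 'I_n) s := s *: basis_vec j + p j.
have q0 j : q j 0 = p j by rewrite /q scale0r add0r.
have q1 (j : 'I_n) : q j (y 0 j - x 0 j) = p j.+1.
  apply/rowP => i; rewrite !mxE eqxx /= ltnS.
  have [->|ij] := eqVneq i j; first by rewrite ltnn leqnn mulr1 subrK.
  have -> : (i <= j)%N = (i < j)%N by rewrite leq_eqVlt (negbTE ij : (i == j :> nat) = false).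
  by rewrite mulr0 add0r.
have qb (j : 'I_n) s : between 0 (y 0 j - x 0 j) s ->
    forall i, between (x 0 i) (y 0 i) (q j s 0 i).
  rewrite /between => bs i; rewrite !mxE eqxx /=.
  have [->|ij] := eqVneq i j; first by rewrite ltnn mulr1; lra.
  rewrite mulr0 add0r; case: ifP => _; first by rewrite !lexx /= andbT le_total.
  by rewrite !lexx /= andbT le_total.
have qO j s : between 0 (y 0 j - x 0 j) s -> O (q j s).
  by move=> /qb bs; exact: bO Ox Oy bs.
have M (j : 'I_n) : { c : R | between 0 (y 0 j - x 0 j) c /\ f (p j.+1) - f (p j) =
    (y 0 j - x 0 j) * 'D_(basis_vec j) f (q j c)}.
  apply: cid.
  have [s bs|c bc E] := @mvt_line (fun s => f (q j s))
     (fun s => 'D_(basis_vec j) f (q j s)) (y 0 j - x 0 j).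
    by apply: is_derive_line; exact/df/qO.
  by exists c; split=> //; rewrite mulrC -E q0 q1.
exists (fun j => q j (sval (M j))); split.
  move=> j; have [bc _] := svalP (M j); split; first exact: qO.
  apply: normr_rV_le => // i.
  have := normr_coord (y - x) i; have := qb _ _ bc i.
  rewrite /between !mxE => h; apply: le_trans.
  case/orP: h => h.
    by rewrite !ger0_norm; lra.
  by rewrite !ler0_norm; lra.
have -> : f y - f x = \sum_(j < n) (f (p j.+1) - f (p j)).
  rewrite -(big_mkord xpredT (fun k => f (p k.+1) - f (p k))).
  rewrite (telescope_sumr (fun k => f (p k))) //; congr (f _ - f _).
    by apply/rowP => i; rewrite !mxE ltn_ord.
  by apply/rowP => i; rewrite !mxE.
by apply: eq_bigr => j _; exact: (svalP (M j)).2.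
Qed.

Lemma sum_norm_le (F : 'I_n -> R) (c : R) : (forall i, `|F i| <= c) ->
  `|\sum_i F i| <= n%:R * c.
Proof.
move=> H; apply: (le_trans (ler_norm_sum _ _ _)).
apply: (@le_trans _ _ (\sum_(i < n) c)); first by apply: ler_sum => i _; exact: H.
rewrite sumr_const card_ord -[c *+ n]mulr_natl; exact: lexx.
Qed.

Lemma lipschitz_of_partials O f (K : R) x y : boxy O -> O x -> O y ->
  (forall i w, O w -> derivable f w (basis_vec i)) ->
  (forall i w, O w -> `|'D_(basis_vec i) f w| <= K) ->
  `|f x - f y| <= n%:R * K * `|x - y|.
Proof.
move=> bO Ox Oy df dK; have [xi [xiO ->]] := mvt_rV bO Oy Ox df.
rewrite -mulrA; apply: sum_norm_le => i; rewrite normrM mulrC.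
apply: ler_pM => //; first by apply: dK; have [] := xiO i.
by have := normr_coord (x - y) i; rewrite !mxE.
Qed.

Lemma taylor1 O f x y (c : R) : boxy O -> O x -> O y ->
  (forall i w, O w -> derivable f w (basis_vec i)) ->
  (forall i w, O w -> `|w - x| <= `|y - x| ->
     `|'D_(basis_vec i) f w - 'D_(basis_vec i) f x| <= c) ->
  `|f y - f x - \sum_i (y 0 i - x 0 i) * 'D_(basis_vec i) f x|
    <= n%:R * c * `|y - x|.
Proof.
move=> bO Ox Oy df dK; have [xi [xiO ->]] := mvt_rV bO Ox Oy df.
rewrite -sumrB -mulrA; apply: sum_norm_le => i; rewrite -mulrBr normrM mulrC.
have [h1 h2] := xiO i.
apply: ler_pM => //; first exact: dK.
by have := normr_coord (y - x) i; rewrite !mxE.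
Qed.

Lemma continuous_partials_diff O f x : open O -> boxy O -> O x ->
  (forall i w, O w -> derivable f w (basis_vec i)) ->
  (forall i, {for x, continuous ('D_(basis_vec i) f)}) ->
  differentiable f x /\
  (forall v, 'd f x v = \sum_i v 0 i * 'D_(basis_vec i) f x).
Proof.
move=> oO bO Ox df cdf.
pose d v : R := \sum_i v 0 i * 'D_(basis_vec i) f x.
have dlin : linear d.
  move=> a u v; rewrite /d scaler_sumr -big_split /=; apply: eq_bigr => i _.
  by rewrite !mxE mulrDl -mulrA.
pose dlM := GRing.isLinear.Build _ _ _ _ _ dlin.
pose dL : {linear 'rV[R]_n -> R} := HB.pack d dlM.
have dB v : `|d v| <= (\sum_i `|'D_(basis_vec i) f x|) * `|v|.
  apply: (le_trans (ler_norm_sum _ _ _)); rewrite mulr_suml.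
  apply: ler_sum => i _; rewrite normrM mulrC ler_wpM2l //; exact: normr_coord.
have dcont : continuous dL.
  apply: (@bounded_linear_continuous _ _ _ dL).
  apply/linear_boundedP; near=> r; move=> v; apply: (le_trans (dB v)).
  rewrite ler_wpM2r //; near: r; exact: nbhs_pinfty_ge.
have E : f \o shift x = cst (f x) + dL +o_ (0 : 'rV[R]_n) id.
  apply/eqaddoP => _/posnumP[eps].
  have xO : nbhs x O by exact: open_nbhs_nbhs.
  (* Each of the [n] partial derivatives may contribute this much; [n.+1] keeps the quotient
     positive in dimension 0. *)
  have eps0 : 0 < eps%:num / n.+1%:R :> R by rewrite divr_gt0.
  have H : \forall w \near x, forall i, `|'D_(basis_vec i) f x - 'D_(basis_vec i) f w| <= eps%:num / n.+1%:R.
    apply: (@filter_forall _ _ _ (nbhs x) (nbhs_filter x)) => i.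
    by have /cvgrPdist_le /(_ _ eps0) := cdf i.
  have [r /= r0 Hr] : exists2 r : R, 0 < r & ball x r `<=`
     [set w | O w /\ forall i, `|'D_(basis_vec i) f x - 'D_(basis_vec i) f w| <= eps%:num / n.+1%:R].
    by apply/nbhs_ballP; apply: filterI.
  near=> h.
  have hr : `|h| < r by near: h; rewrite near_simpl; change (\forall h \near (0 : 'rV[R]_n), `|h| < r); exact: nbhs0_lt.
  have Oh : O (h + x).
    by apply: (Hr (h + x) _).1; apply/ball_rVP; rewrite opprD addrCA subrr addr0 normrN.
  have := @taylor1 O f x (h + x) (eps%:num / n.+1%:R) bO Ox Oh df.
  rewrite /= -![(_ + _ : _ -> _) _]/(_ + _) -![(- _ : _ -> _) _]/(- _) /cst addrK.
  rewrite (eq_bigr (fun i => h 0 i * 'D_(basis_vec i) f x)); last first.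
    by move=> i _; rewrite !mxE addrK.
  rewrite opprD addrA => H1; apply: (le_trans (H1 _)).
    move=> i w _ wh; rewrite distrC; apply: (Hr _ _).2.
    by apply/ball_rVP; rewrite distrC (le_lt_trans wh).
  rewrite ler_wpM2r // mulrCA -[leRHS]mulr1 ler_wpM2l // ler_pdivrMr ?mul1r //.
  by rewrite ler_nat.
have D : 'd f x = dL :> (_ -> _) by exact: diff_unique.
split; last by move=> v; rewrite D.
by apply/diff_locallyP; rewrite D.
Unshelve. all: by end_near. Qed.

End RowVectors.

(** * Quantitative Hoelder-Zygmund bounds *)

(* A class is the number of derivatives together with a modulus for the last
   ones: Hoelder of exponent e, and for integer regularity also the Zygmund
   condition.  In the latter case e is an auxiliary exponent below 1; from
   e >= 2/3 it follows that e + e^2 >= 1, as composition requires. *)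
Record tower (R : realType) := Tower {
  tw_exp : R ;
  tw_zyg : bool ;
  tw_exp01 : 0 < tw_exp < 1 ;
  tw_zyg_exp : tw_zyg -> 2 / 3 <= tw_exp }.

Section HZBound.
Context {R : realType} {n : nat} (t : tower R).
Implicit Types (x y : 'rV[R]_n) (O : set 'rV[R]_n) (f g : 'rV[R]_n -> R).
Local Notation e := (tw_exp t).

Lemma tw_exp_gt0 : 0 < e. Proof. by have /andP[] := tw_exp01 t. Qed.
Lemma tw_exp_lt1 : e < 1. Proof. by have /andP[] := tw_exp01 t. Qed.

(** The Hoelder clause is kept in the Zygmund case as well: products, reciprocals and compositions
    produce terms that second differences alone do not control. *)
Definition hzb0 O (K : R) f :=
  [/\ forall x, O x -> `|f x| <= K,
      forall x y, O x -> O y -> `|f x - f y| <= K * `|x - y| `^ e &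
      tw_zyg t -> forall x y, O x -> O y ->
        `|f x + f y - 2 * f (2^-1 *: (x + y))| <= K * `|x - y|].

(* With an explicit bound, a ball of the class is stable under pointwise limits,
   which is what lets fixed points of contractions in the sup norm stay in the
   class. *)
Fixpoint hzb (k : nat) O (K : R) f : Prop :=
  if k is k'.+1 then
    [/\ forall x, O x -> `|f x| <= K,
        forall i x, O x -> derivable f x (basis_vec i) &
        forall i, hzb k' O K ('D_(basis_vec i) f)]
  else hzb0 O K f.

Lemma ler_powR_base (r a b : R) : 0 <= r -> 0 <= a -> a <= b -> a `^ r <= b `^ r.
Proof. by move=> r0 a0 ab; apply: ge0_ler_powR; rewrite ?nnegrE // (le_trans a0). Qed.

Lemma powR_le_self (d : R) : 0 <= d -> d <= 1 -> d <= d `^ e.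
Proof.
move=> d0 d1; have [->|dn0] := eqVneq d 0; first exact: powR_ge0.
apply: ger1_powR; last exact: ltW tw_exp_lt1.
by rewrite d1 andbT lt_neqAle eq_sym dn0.
Qed.

Lemma mid_norm x y : `|x - 2^-1 *: (x + y)| = 2^-1 * `|x - y|.
Proof.
have -> : x - 2^-1 *: (x + y) = 2^-1 *: (x - y).
  by apply/rowP => i; rewrite !mxE; lra.
by rewrite normrZ ger0_norm.
Qed.

Lemma mid_boxy O x y : boxy O -> O x -> O y -> O (2^-1 *: (x + y)).
Proof.
move=> bO Ox Oy; apply: (bO x y) => // i; rewrite /between !mxE.
by have [h|h] := leP (x 0 i) (y 0 i); apply/orP; [left|right]; lra.
Qed.

Lemma hzb_bound k O K f x : hzb k O K f -> O x -> `|f x| <= K.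
Proof. by case: k => [|k] [H _ _]; exact: H. Qed.

Lemma hzb_ge0 k O K f x : hzb k O K f -> O x -> 0 <= K.
Proof. by move=> H Ox; exact: le_trans (normr_ge0 _) (hzb_bound H Ox). Qed.

Lemma hzb_le k O K K' f : K <= K' -> hzb k O K f -> hzb k O K' f.
Proof.
move=> KK'; elim: k f => [|k IH] f [H1 H2 H3]; split => //.
- by move=> x /H1/le_trans; exact.
- move=> x y Ox Oy; apply: le_trans (H2 _ _ Ox Oy) _.
  by rewrite ler_wpM2r // powR_ge0.
- move=> /H3 H x y Ox Oy; apply: le_trans (H _ _ Ox Oy) _.
  by rewrite ler_wpM2r.
- by move=> x /H1/le_trans; exact.
- by move=> i; exact: IH (H3 i).
Qed.

Lemma hzb_sub k O O' K f : O' `<=` O -> hzb k O K f -> hzb k O' K f.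
Proof.
move=> OO; elim: k f => [|k IH] f [H1 H2 H3]; split => //.
- by move=> x /OO/H1.
- by move=> x y /OO Ox /OO Oy; exact: H2.
- by move=> /H3 H x y /OO Ox /OO Oy; exact: H.
- by move=> x /OO/H1.
- by move=> i x /OO/H2.
- by move=> i; exact: IH (H3 i).
Qed.

Lemma near_eq_open O f g x : open O -> {in O, f =1 g} -> O x ->
  {near x, f =1 g}.
Proof.
move=> oO fg Ox; have : nbhs x O by exact: open_nbhs_nbhs.
by apply: filterS => y Oy; apply: fg; rewrite inE.
Qed.

Lemma hzb_ext k O K f g : open O -> boxy O -> {in O, f =1 g} -> hzb k O K f -> hzb k O K g.
Proof.
move=> oO bO; elim: k f g => [|k IH] f g fg.
  have fgE x : O x -> f x = g x by move=> Ox; apply: fg; rewrite inE.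
  case=> H1 H2 H3; split.
  - by move=> x Ox; rewrite -fgE //; apply: H1.
  - by move=> x y Ox Oy; rewrite -!fgE //; apply: H2.
  - by move=> /H3 H x y Ox Oy; rewrite -!fgE ?H//; exact: mid_boxy.
case=> H1 H2 H3; split.
- by move=> x Ox; rewrite -fg ?inE //; apply: H1.
- move=> i x Ox; apply: near_eq_derivable (H2 i x Ox); exact: near_eq_open Ox.
- move=> i; apply: IH (H3 i) => x; rewrite inE => Ox.
  by apply: near_eq_derive; apply: near_eq_open Ox.
Qed.

Lemma hzb_add k O K L f g : open O -> boxy O ->
  hzb k O K f -> hzb k O L g -> hzb k O (K + L) (f \+ g).
Proof.
move=> oO bO; elim: k f g => [|k IH] f g [F1 F2 F3] [G1 G2 G3]; split.
- by move=> x Ox; rewrite (le_trans (ler_normD _ _))//= lerD ?F1 ?G1.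
- move=> x y Ox Oy /=; rewrite opprD addrACA mulrDl.
  by rewrite (le_trans (ler_normD _ _))// lerD ?F2 ?G2.
- move=> tz x y Ox Oy /=; set m := _ *: _; rewrite (mulrDl K L).
  have -> : f x + g x + (f y + g y) - 2 * (f m + g m) =
    (f x + f y - 2 * f m) + (g x + g y - 2 * g m) by lra.
  by rewrite (le_trans (ler_normD _ _))// lerD ?F3 ?G3.
- by move=> x Ox; rewrite (le_trans (ler_normD _ _))//= lerD ?F1 ?G1.
- by move=> i x Ox; apply: derivableD; [exact: F2|exact: G2].
- move=> i; apply: (@hzb_ext _ _ _ ('D_(basis_vec i) f \+ 'D_(basis_vec i) g)) => //.
    by move=> x; rewrite inE => Ox /=; rewrite deriveD //; [exact: F2|exact: G2].
  exact: IH (F3 i) (G3 i).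
Qed.

Lemma hzb_scale k O K f (c : R) : open O -> boxy O ->
  hzb k O K f -> hzb k O (`|c| * K) (fun x => c * f x).
Proof.
move=> oO bO; elim: k f => [|k IH] f [F1 F2 F3]; split.
- by move=> x Ox; rewrite normrM ler_wpM2l // F1.
- by move=> x y Ox Oy; rewrite -mulrBr normrM -mulrA ler_wpM2l // F2.
- move=> tz x y Ox Oy; rewrite -mulrDr mulrCA -mulrBr normrM -mulrA ler_wpM2l //.
  exact: F3.
- by move=> x Ox; rewrite normrM ler_wpM2l // F1.
- by move=> i x Ox; apply: derivableZ; exact: F2.
- move=> i; apply: (@hzb_ext _ _ _ (fun x => c * 'D_(basis_vec i) f x)) => //.
    by move=> x; rewrite inE => Ox /=; rewrite [RHS]deriveZ //; exact: F2.
  exact: IH (F3 i).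
Qed.

Lemma hzb_cst k O K c : open O -> `|c| <= K -> hzb k O K (fun=> c : R).
Proof.
move=> oO cK; have K0 : 0 <= K by exact: le_trans cK.
elim: k c cK => [|k IH] c cK.
  split=> //; first by move=> x y _ _; rewrite subrr normr0 mulr_ge0 // powR_ge0.
  move=> _ x y _ _; rewrite (_ : c + c - 2 * c = 0) ?normr0 ?mulr_ge0 //; lra.
split=> // i.
suff -> : 'D_(basis_vec i) (fun=> c : R) = (fun=> 0 : R) :> ('rV[R]_n -> R).
  by apply: IH; rewrite normr0.
by apply/funext => x; exact: derive_cst.
Qed.

Lemma hzb_sum k O K m (f : 'I_m -> 'rV[R]_n -> R) : open O -> boxy O ->
  (forall i, hzb k O K (f i)) -> hzb k O (m%:R * K) (fun x => \sum_i f i x).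
Proof.
move=> oO bO; elim: m f => [|m IH] f H.
  apply: (@hzb_ext _ _ _ (fun=> 0)) => //; first by move=> x _; rewrite big_ord0.
  by apply: hzb_cst; rewrite // normr0 mul0r.
apply: (@hzb_ext _ _ _ (f ord0 \+ (fun x => \sum_i f (lift ord0 i) x))) => //.
  by move=> x _; rewrite /= big_ord_recl.
by rewrite -natr1 addrC mulrDl mul1r; apply: hzb_add => //; apply: IH => i; exact: H.
Qed.

Lemma derive_coord i j x : is_derive x (basis_vec i) (fun x : 'rV[R]_n => x 0 j : R) ((i == j)%:R).
Proof.
have D : derivable (fun x : 'rV[R]_n => x 0 j : R) x (basis_vec i).
  by apply: diff_derivable; exact: differentiable_coord.
apply: DeriveDef => //.
have Di : derivable (id : 'rV[R]_n -> 'rV[R]_n) x (basis_vec i) by exact: derivable_id.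
have := derive_mx Di; rewrite derive_id => /(congr1 (fun M : 'rV[R]_n => M 0 j)).
by rewrite !mxE eqxx eq_sym => <-.
Qed.

Lemma hzb_coord k O K i : good_domain O -> 1 <= K -> (forall x, O x -> `|x| <= K) ->
  hzb k O K (fun x : 'rV[R]_n => x 0 i).
Proof.
move=> gO K1 OK; have [oO bO dO] := gO.
have K0 : 0 <= K by exact: le_trans K1.
have C x y : `|x 0 i - y 0 i| <= `|x - y|.
  by have := normr_coord (x - y) i; rewrite !mxE.
case: k => [|k]; split.
- by move=> x Ox; apply: le_trans (normr_coord _ _) (OK _ Ox).
- move=> x y Ox Oy; apply: le_trans (C x y) _.
  apply: le_trans (powR_le_self (normr_ge0 _) (dO _ _ Ox Oy)) _.
  by rewrite ler_peMl ?powR_ge0.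
- move=> _ x y _ _; rewrite !mxE (_ : _ - _ = 0) ?normr0 ?mulr_ge0 //; lra.
- by move=> x Ox; apply: le_trans (normr_coord _ _) (OK _ Ox).
- by move=> j x _; have [] := derive_coord j i x.
- move=> j; apply: (@hzb_ext _ _ _ (fun=> (j == i)%:R)) => //.
    by move=> x _; have [_ ->] := derive_coord j i x.
  by apply: hzb_cst => //; case: (j == i); rewrite ?normr1 ?normr0.
Qed.

End HZBound.

Section HZBoundDown.
Context {R : realType} {n : nat} (t t' : tower R).
Implicit Types (x y : 'rV[R]_n) (O : set 'rV[R]_n) (f g : 'rV[R]_n -> R).

(** One derivative to spare makes [f] Lipschitz, and on a domain of diameter at most 1 this implies
    every modulus, including that of an unrelated tower [t']. The Lipschitz constant is [n * K]; the
    factor [n.+1] also covers the sup bound when [n] is 0. *)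
Lemma hzb_down_tower k O K f : good_domain O -> 0 <= K ->
  hzb t k.+1 O K f -> hzb t' k O (n.+1%:R * K) f.
Proof.
move=> [oO bO dO]; elim: k f => [|k IH] f K0 [F1 F2 F3].
  have nK : n%:R * K <= n.+1%:R * K by rewrite ler_wpM2r // ler_nat.
  have L x y : O x -> O y -> `|f x - f y| <= n%:R * K * `|x - y|.
    move=> Ox Oy; apply: (lipschitz_of_partials bO) => // i w Ow.
    by have [H _ _] := F3 i; exact: H.
  split.
  - by move=> x Ox; rewrite (le_trans (F1 _ Ox))// ler_peMl // ler1n.
  - move=> x y Ox Oy; apply: le_trans (L _ _ Ox Oy) _; apply: ler_pM => //.
      by rewrite mulr_ge0.
    by apply: powR_le_self => //; exact: dO.
  - move=> _ x y Ox Oy; set m := _ *: _.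
    have Om : O m by exact: mid_boxy.
    have -> : f x + f y - 2 * f m = (f x - f m) + (f y - f m) by lra.
    apply: le_trans (ler_normD _ _) _.
    apply: le_trans (lerD (L _ _ Ox Om) (L _ _ Oy Om)) _.
    rewrite {1}/m mid_norm /m [x + y]addrC mid_norm (distrC y).
    by rewrite (_ : _ + _ = n%:R * K * `|x - y|); [rewrite ler_wpM2r|lra].
split => //.
  by move=> x Ox; rewrite (le_trans (F1 _ Ox))// ler_peMl // ler1n.
by move=> i; apply: IH (F3 i).
Qed.

End HZBoundDown.

Section HZBoundDownGe.
Context {R : realType} {n : nat} (t : tower R).
Implicit Types (x y : 'rV[R]_n) (O : set 'rV[R]_n) (f g : 'rV[R]_n -> R).

Lemma hzb_down k O K f : good_domain O -> 0 <= K ->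
  hzb t k.+1 O K f -> hzb t k O (n.+1%:R * K) f.
Proof. exact: hzb_down_tower. Qed.

Lemma hzb_down_ge l k O K f : good_domain O -> 0 <= K ->
  hzb t (l + k) O K f -> hzb t k O (n.+1%:R ^+ l * K) f.
Proof.
move=> gO; elim: l K => [|l IH] K K0 H; first by rewrite mul1r.
rewrite exprSr -mulrA; apply: IH; first by rewrite mulr_ge0.
exact: hzb_down.
Qed.

End HZBoundDownGe.

(** * Products and reciprocals *)

Section HZBoundProducts.
Context {R : realType} {n : nat} (t : tower R).
Implicit Types (x y : 'rV[R]_n) (O : set 'rV[R]_n) (f g : 'rV[R]_n -> R).
Local Notation e := (tw_exp t).

Lemma powR_mul_le (d a b : R) : 0 <= d -> d <= 1 -> 0 < a -> 0 < b ->
  1 <= a + b -> d `^ a * d `^ b <= d.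
Proof.
move=> d0 d1 a0 b0 ab; have [->|dn0] := eqVneq d 0.
  by rewrite powR0 ?mul0r // gt_eqF.
rewrite -powRD; last by rewrite dn0 implybT.
by apply: ge1r_powR => //; rewrite d1 andbT lt_neqAle eq_sym dn0.
Qed.

Lemma mid_dist x y : `|x - 2^-1 *: (x + y)| <= `|x - y| /\
  `|y - 2^-1 *: (x + y)| <= `|x - y|.
Proof.
rewrite mid_norm [x + y]addrC mid_norm (distrC y).
by have := normr_ge0 (x - y); split; lra.
Qed.

(** Each increment to the midpoint is O(d^e), so the products are O(d^(2e)), which is O(d) because
    [e >= 2 / 3] gives [2 * e >= 1]. *)
Lemma zyg_cross O f g (K L : R) x y : good_domain O -> tw_zyg t ->
  O x -> O y -> 0 <= K -> 0 <= L ->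
  (forall x y, O x -> O y -> `|f x - f y| <= K * `|x - y| `^ e) ->
  (forall x y, O x -> O y -> `|g x - g y| <= L * `|x - y| `^ e) ->
  forall m, m = 2^-1 *: (x + y) ->
  `|(f x - f m) * (g x - g m) + (f y - f m) * (g y - g m)| <=
    2 * (K * L) * `|x - y|.
Proof.
move=> [oO bO dO] tz Ox Oy K0 L0 Hf Hg m mE.
have Om : O m by rewrite mE; exact: mid_boxy.
have e0 := tw_exp_gt0 t; have e23 := tw_zyg_exp tz.
have E w : O w -> `|w - m| <= `|x - y| ->
    `|(f w - f m) * (g w - g m)| <= K * L * `|x - y|.
  move=> Ow wm; rewrite normrM; apply: (@le_trans _ _ (K * `|w - m| `^ e * (L * `|w - m| `^ e))).
    by apply: ler_pM => //; [exact: Hf|exact: Hg].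
  rewrite mulrACA ler_wpM2l ?mulr_ge0 //; apply: le_trans wm.
  by apply: powR_mul_le => //; [exact: dO|lra].
have [mx my] := mid_dist x y; rewrite -mE in mx my.
apply: (le_trans (ler_normD _ _)); apply: (le_trans (lerD (E _ Ox mx) (E _ Oy my))).
lra.
Qed.

Lemma hzb0_prod O K L f g : good_domain O -> 0 <= K -> 0 <= L ->
  hzb0 t O K f -> hzb0 t O L g -> hzb0 t O (4 * (K * L)) (fun x => f x * g x).
Proof.
move=> gO K0 L0 [F1 F2 F3] [G1 G2 G3]; have KL0 : 0 <= K * L by exact: mulr_ge0.
split.
- move=> x Ox; rewrite normrM (@le_trans _ _ (K * L)) //; last lra.
  by apply: ler_pM => //; [exact: F1|exact: G1].
- move=> x y Ox Oy; have -> : f x * g x - f y * g y = f x * (g x - g y) + g y * (f x - f y) by ring.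
  have p0 := powR_ge0 `|x - y| e.
  apply: (le_trans (ler_normD _ _)); rewrite !normrM.
  apply: (@le_trans _ _ (K * (L * `|x - y| `^ e) + L * (K * `|x - y| `^ e))).
    apply: lerD; apply: ler_pM => //; [exact: F1|exact: G2|exact: G1|exact: F2].
  have := mulr_ge0 KL0 p0; lra.
- move=> tz x y Ox Oy; set m := _ *: _.
  have Om : O m by apply: mid_boxy => //; case: gO.
  (* Leibniz rule for second differences: two terms with a second difference of one factor, and the
     cross term of [zyg_cross]. *)
  have -> : f x * g x + f y * g y - 2 * (f m * g m) =
    g m * (f x + f y - 2 * f m) + f m * (g x + g y - 2 * g m) +
    ((f x - f m) * (g x - g m) + (f y - f m) * (g y - g m)) by ring.
  apply: (le_trans (ler_normD _ _)).
  apply: (le_trans (lerD (ler_normD _ _) (zyg_cross gO tz Ox Oy K0 L0 F2 G2 (erefl m)))).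
  rewrite !normrM.
  have h1 : `|g m| * `|f x + f y - 2 * f m| <= L * (K * `|x - y|).
    by apply: ler_pM => //; [exact: G1|exact: F3].
  have h2 : `|f m| * `|g x + g y - 2 * g m| <= K * (L * `|x - y|).
    by apply: ler_pM => //; [exact: F1|exact: G3].
  lra.
Qed.

(** [M] is chosen before [f] and [g]: the invariant balls of the fixed-point arguments need
    constants that hold for all functions with given bounds at once. *)
Lemma hzb_prod k O K L : good_domain O -> 0 <= K -> 0 <= L ->
  exists2 M, 0 <= M & forall f g, hzb t k O K f -> hzb t k O L g ->
    hzb t k O M (fun x => f x * g x).
Proof.
move=> gO; have [oO bO dO] := gO; elim: k K L => [|k IH] K L K0 L0.
  by exists (4 * (K * L)); rewrite ?mulr_ge0 // => f g; exact: hzb0_prod.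
have K'0 : 0 <= n.+1%:R * K by rewrite mulr_ge0.
have L'0 : 0 <= n.+1%:R * L by rewrite mulr_ge0.
have [M1 M10 H1] := IH _ _ K'0 L0; have [M2 M20 H2] := IH _ _ L'0 K0.
exists (K * L + (M1 + M2)); first by rewrite !addr_ge0 // mulr_ge0.
move=> f g Hf Hg; have Hf' := hzb_down gO K0 Hf; have Hg' := hzb_down gO L0 Hg.
case: Hf => F1 F2 F3; case: Hg => G1 G2 G3; split.
- move=> x Ox; rewrite normrM (@le_trans _ _ (K * L)) //; last by rewrite lerDl addr_ge0.
  by apply: ler_pM => //; [exact: F1|exact: G1].
- by move=> i x Ox; apply: derivableM; [exact: F2|exact: G2].
- move=> i; apply: (@hzb_ext _ _ _ _ _ _ ((fun x => f x * 'D_(basis_vec i) g x) \+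
      (fun x => g x * 'D_(basis_vec i) f x))) => //.
    move=> x; rewrite inE => Ox /=.
    by rewrite [RHS](@deriveM _ _ f g) //; [exact: F2|exact: G2].
  apply: (@hzb_le _ _ _ _ _ (M1 + M2)); first by rewrite lerDr mulr_ge0.
  by apply: hzb_add => //; [exact: H1 Hf' (G3 i)|exact: H2 Hg' (F3 i)].
Qed.

Lemma hzb_inv k O K c : good_domain O -> 0 <= K -> 0 < c ->
  exists2 M, 0 <= M & forall f, hzb t k O K f -> (forall x, O x -> c <= `|f x|) ->
    hzb t k O M (fun x => (f x)^-1).
Proof.
move=> gO K0 c0; have [oO bO dO] := gO; elim: k K K0 => [|k IH] K K0.
  have L0 : 0 <= c^-1 * (c^-1 * K) by rewrite !mulr_ge0 ?invr_ge0 // ltW.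
  exists (c^-1 + c^-1 * (c^-1 * K) + c^-1 * (c^-1 * K + 2 * (K * (c^-1 * (c^-1 * K))))).
    by rewrite !addr_ge0 ?invr_ge0 ?mulr_ge0 ?addr_ge0 ?mulr_ge0 ?invr_ge0 // ltW.
  move=> f [F1 F2 F3] fc.
  have fn0 x : O x -> f x != 0 by move=> /fc; rewrite -normr_gt0; exact: lt_le_trans.
  have G1 x : O x -> `|(f x)^-1| <= c^-1.
    by move=> Ox; rewrite normfV lef_pV2 ?posrE ?fc ?normr_gt0 // fn0.
  have G2 x y : O x -> O y -> `|(f x)^-1 - (f y)^-1| <= c^-1 * (c^-1 * K) * `|x - y| `^ e.
    move=> Ox Oy; have -> : (f x)^-1 - (f y)^-1 = (f x)^-1 * ((f y)^-1 * (f y - f x)).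
      by field; rewrite !fn0.
    rewrite !normrM -!mulrA; apply: ler_pM; rewrite ?mulr_ge0 ?G1 //.
    by apply: ler_pM; rewrite ?G1 // distrC F2.
  have c'0 : 0 <= c^-1 by rewrite invr_ge0 ltW.
  have cK0 : 0 <= c^-1 * K by rewrite mulr_ge0.
  have cKc0 : 0 <= K * (c^-1 * (c^-1 * K)) by rewrite !mulr_ge0.
  have big0 : 0 <= c^-1 * (c^-1 * K + 2 * (K * (c^-1 * (c^-1 * K)))).
    by rewrite mulr_ge0 // addr_ge0 // mulr_ge0.
  split.
  - by move=> x Ox; apply: (le_trans (G1 _ Ox)); rewrite -addrA lerDl addr_ge0.
  - move=> x y Ox Oy; apply: (le_trans (G2 _ _ Ox Oy)); rewrite ler_wpM2r ?powR_ge0 //.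
    by rewrite addrAC lerDr addr_ge0.
  - move=> tz x y Ox Oy; set m := _ *: _.
    have Om : O m by exact: mid_boxy.
    have Z := zyg_cross gO tz Ox Oy K0 L0 F2 G2 (erefl m).
    (* This follows from the Leibniz identity for [f] and its reciprocal, whose product has
       vanishing second difference. The cross term is bounded by [zyg_cross], with the Hoelder bound
       [G2] already known for the reciprocal. *)
    have -> : (f x)^-1 + (f y)^-1 - 2 * (f m)^-1 = - ((f m)^-1 *
      ((f m)^-1 * (f x + f y - 2 * f m) + ((f x - f m) * ((f x)^-1 - (f m)^-1) +
        (f y - f m) * ((f y)^-1 - (f m)^-1)))).
      by field; rewrite !fn0.
    rewrite normrN normrM.
    apply: (@le_trans _ _ (c^-1 * ((c^-1 * K + 2 * (K * (c^-1 * (c^-1 * K)))) * `|x - y|))).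
      apply: ler_pM => //; first exact: G1.
      apply: (le_trans (ler_normD _ _)); rewrite [leRHS]mulrDl; apply: lerD => //.
      rewrite normrM -mulrA; apply: ler_pM; rewrite ?G1 //; exact: F3.
    by rewrite mulrA ler_wpM2r // lerDr addr_ge0.
have K'0 : 0 <= n.+1%:R * K by rewrite mulr_ge0.
have [M1 M10 H1] := IH _ K'0; have [M2 M20 H2] := hzb_prod k gO M10 M10.
have [M3 M30 H3] := hzb_prod k gO M20 K0.
exists (c^-1 + M3); first by rewrite addr_ge0 // invr_ge0 ltW.
move=> f Hf fc; have Hf' := hzb_down gO K0 Hf; case: Hf => F1 F2 F3.
have fn0 x : O x -> f x != 0 by move=> /fc; rewrite -normr_gt0; exact: lt_le_trans.
split.
- move=> x Ox; apply: (@le_trans _ _ c^-1); last by rewrite lerDl.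
  by rewrite normfV lef_pV2 ?posrE ?fc ?normr_gt0 // fn0.
- by move=> i x Ox; apply: derivableV; [exact: fn0|exact: F2].
- move=> i; apply: (@hzb_ext _ _ _ _ _ _ (fun x => -1 * ((f x)^-1 * (f x)^-1 * 'D_(basis_vec i) f x))) => //.
    move=> x; rewrite inE => Ox /=.
    rewrite [RHS](@deriveV _ _ f) //; [|exact: fn0|exact: F2].
    by rewrite /GRing.scale /= mulN1r -mulNr -expr2 exprVn.
  apply: (@hzb_le _ _ _ _ _ (`|-1| * M3)).
    by rewrite normrN normr1 mul1r lerDr invr_ge0 ltW.
  apply: hzb_scale => //; exact: H3 (H2 _ _ (H1 _ Hf' fc) (H1 _ Hf' fc)) (F3 i).
Qed.

End HZBoundProducts.

(** * The chain rule in a single direction *)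

Section ChainRule.
Context {R : realType}.

(** Only the derivative of [g] in the direction [v] is assumed. Restricting to the line through [x]
    turns it into a function of one variable, for which derivable and differentiable agree, and the
    differential chain rule applies there. *)
Lemma is_derive_comp_diff (U V W : normedModType R) (f : V -> W) (g : U -> V) x v :
  differentiable f (g x) -> derivable g x v ->
  is_derive x v (fun z => f (g z)) ('d f (g x) ('D_v g x)).
Proof.
move=> df dg.
have dl : differentiable (fun h : R => g (h *: v + x)) 0.
  by apply/derivable1_diffP; apply: (derivable1P g x v).1.
have E0 : g (0 *: v + x) = g x by rewrite scale0r add0r.
have dc : differentiable (f \o (fun h : R => g (h *: v + x))) 0.
  by apply: differentiable_comp => //; rewrite E0.
have dfg : derivable (fun z => f (g z)) x v by apply: (derivable1P (fun z => f (g z)) x v).2; apply/derivable1_diffP.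
have line (Z : normedModType R) (k : U -> Z) : 'D_v k x = 'D_1 (fun h : R => k (h *: v + x)) 0.
  rewrite /derive; set g1 := fun h => h^-1 *: _; set g2 := fun h => h^-1 *: _.
  suff -> : g1 = g2 by [].
  by rewrite funeqE /g1 /g2 => h /=; rewrite addr0 scale0r add0r [_%:A]mulr1.
apply: DeriveDef => //; rewrite (line _ g) (line _ (fun z => f (g z))) !deriveE //.
by have := diff_comp dl; rewrite E0 => /(_ _ _ df) /(congr1 (fun k => k 1)).
Qed.

Lemma is_derive_comp_rV n (U : normedModType R) (f : 'rV[R]_n -> R) (g : U -> 'rV[R]_n) x v :
  differentiable f (g x) ->
  (forall w, 'd f (g x) w = \sum_j w 0 j * 'D_(basis_vec j) f (g x)) ->
  (forall j, derivable (fun z => g z 0 j) x v) ->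
  is_derive x v (fun z => f (g z))
    (\sum_j 'D_(basis_vec j) f (g x) * 'D_v (fun z => g z 0 j) x).
Proof.
move=> df dfE dg.
have Dg : derivable g x v by apply/derivable_mxP => i j; rewrite ord1.
have := is_derive_comp_diff df Dg; rewrite dfE derive_mx // => H.
by apply: (is_derive_eq H); apply: eq_bigr => j _; rewrite mxE mulrC.
Qed.

End ChainRule.

(** * Continuity, Taylor estimate and composition *)

Section HZBoundComposition.
Context {R : realType} (t : tower R).
Local Notation e := (tw_exp t).

Lemma hzb_continuous n k O K (f : 'rV[R]_n -> R) x : good_domain O -> 0 <= K ->
  O x -> hzb t k O K f -> {for x, continuous f}.
Proof.
move=> gO K0 Ox H; have [oO bO dO] := gO.
have K'0 : 0 <= n.+1%:R ^+ k * K by rewrite mulr_ge0.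
have := @hzb_down_ge _ _ t k 0 O K f gO K0; rewrite addn0 => /(_ H) [_ F _].
apply/(@cvgrPdist_le _ _ _ (nbhs x)) => eps eps0.
set M := n.+1%:R ^+ k * K + 1.
have M0 : 0 < M by rewrite /M ltr_wpDl.
have d0 : 0 < (eps / M) `^ e^-1 by rewrite powR_gt0 // divr_gt0.
near=> y.
have Oy : O y by near: y; exact: open_nbhs_nbhs.
apply: (le_trans (F _ _ Ox Oy)).
have h : `|x - y| <= (eps / M) `^ e^-1.
  near: y; apply/nbhs_ballP; exists ((eps / M) `^ e^-1) => // z.
  by rewrite -ball_normE; exact: ltW.
have := @ge0_ler_powR _ e (ltW (tw_exp_gt0 t)) _ _ _ _ h.
rewrite !nnegrE => /(_ (normr_ge0 _) (powR_ge0 _ _)).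
rewrite -powRrM mulVf ?gt_eqF ?tw_exp_gt0 // powRr1; last by rewrite divr_ge0 // ltW.
rewrite ler_pdivlMr // => h'; apply: le_trans h'; rewrite mulrC ler_wpM2l ?powR_ge0 //.
by rewrite /M lerDl.
Unshelve. all: by end_near. Qed.

Lemma hzb_differentiable n k O K (f : 'rV[R]_n -> R) x : good_domain O -> 0 <= K ->
  O x -> hzb t k.+1 O K f -> differentiable f x /\
  (forall v, 'd f x v = \sum_i v 0 i * 'D_(basis_vec i) f x).
Proof.
move=> gO K0 Ox [_ F2 F3]; have [oO bO dO] := gO.
apply: (continuous_partials_diff oO bO Ox F2) => i.
exact: hzb_continuous (F3 i).
Qed.

Lemma hzb_lipschitz n k O K (f : 'rV[R]_n -> R) x y : good_domain O ->
  hzb t k.+1 O K f -> O x -> O y -> `|f x - f y| <= n%:R * K * `|x - y|.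
Proof.
move=> [oO bO dO] [F1 F2 F3] Ox Oy; apply: (lipschitz_of_partials bO) => // i w Ow.
exact: (hzb_bound (F3 i) Ow).
Qed.

Lemma hzb_taylor n O K (f : 'rV[R]_n -> R) x y : good_domain O -> 0 <= K ->
  hzb t 1 O K f -> O x -> O y ->
  `|f y - f x - \sum_i (y 0 i - x 0 i) * 'D_(basis_vec i) f x|
    <= n%:R * K * (`|y - x| * `|y - x| `^ e).
Proof.
move=> [oO bO dO] K0 [F1 F2 F3] Ox Oy.
rewrite [`|y - x| * _]mulrC !mulrA -[_ * K * _]mulrA; apply: (taylor1 bO) => // i w Ow wy.
have [_ H _] := F3 i; apply: (le_trans (H _ _ Ow Ox)); apply: ler_wpM2l => //.
by apply: ler_powR_base => //; exact: ltW (tw_exp_gt0 t).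
Qed.

(* Compared with the midpoint of the images, the image of the midpoint is off
   by O(d^(1 + e)), whose [e]-th power is O(d) as e + e^2 >= 1. *)
Lemma hzb0_comp p n O1 O2 (K L : R) : good_domain O1 -> good_domain O2 ->
  0 <= K -> 0 <= L ->
  exists2 M, 0 <= M & forall (f : 'rV[R]_n -> R) (g : 'rV[R]_p -> 'rV[R]_n),
    hzb0 t O2 K f -> (forall j, hzb t 1 O1 L (fun x => g x 0 j)) ->
    (forall x, O1 x -> O2 (g x)) -> hzb0 t O1 M (fun x => f (g x)).
Proof.
move=> gO1 gO2 K0 L0; have [oO1 bO1 dO1] := gO1; have [oO2 bO2 dO2] := gO2.
pose C := p%:R * L + 1; have C0 : 0 < C by rewrite /C ltr_wpDl // mulr_ge0.
have e0 := tw_exp_gt0 t; have e1 := tw_exp_lt1 t.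
have Ce0 : 0 <= C `^ e by exact: powR_ge0.
exists (K + K * C `^ e + K * C + 2 * (K * C `^ e)).
  by rewrite !addr_ge0 // ?mulr_ge0 // ltW.
move=> f g [F1 F2 F3] G gO.
have gL x y : O1 x -> O1 y -> `|g x - g y| <= C * `|x - y|.
  move=> Ox Oy; apply: normr_rV_le => [|j]; first by rewrite mulr_ge0 // ltW.
  rewrite !mxE; apply: (le_trans (hzb_lipschitz gO1 (G j) Ox Oy)).
  by rewrite ler_wpM2r // /C lerDl.
have pow x y (d : R) : O1 x -> O1 y -> 0 <= d -> `|g x - g y| <= C * d ->
    K * `|g x - g y| `^ e <= K * C `^ e * d `^ e.
  move=> Ox Oy d0 h; rewrite -mulrA ler_wpM2l // -powRM ?(ltW C0) //.
  by apply: ge0_ler_powR; rewrite ?nnegrE ?mulr_ge0 // ltW.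
have Kp0 : 0 <= K * C `^ e by rewrite mulr_ge0.
have KC0 : 0 <= K * C by rewrite mulr_ge0 // ltW.
split.
- move=> x Ox; apply: (le_trans (F1 _ (gO _ Ox))).
  by rewrite -!addrA lerDl !addr_ge0 // mulr_ge0.
- move=> x y Ox Oy; apply: (le_trans (F2 _ _ (gO _ Ox) (gO _ Oy))).
  apply: (le_trans (pow _ _ _ Ox Oy (normr_ge0 _) (gL _ _ Ox Oy))).
  by rewrite ler_wpM2r ?powR_ge0 //; lra.
- move=> tz x y Ox Oy; set m := _ *: _.
  have e23 := tw_zyg_exp tz.
  have Om : O1 m by exact: mid_boxy.
  pose q := 2^-1 *: (g x + g y).
  have Oq : O2 q by apply: mid_boxy => //; exact: gO.
  set d := `|x - y|; have d0 : 0 <= d by exact: normr_ge0.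
  have d1 : d <= 1 by exact: dO1.
  have H1 : `|f (g x) + f (g y) - 2 * f q| <= K * (C * d).
    apply: (le_trans (F3 tz _ _ (gO _ Ox) (gO _ Oy))).
    by rewrite ler_wpM2l // gL.
  have dd0 : 0 <= d * d `^ e by rewrite mulr_ge0 // powR_ge0.
  have qm : `|q - g m| <= C * (d * d `^ e).
    apply: normr_rV_le => [|j]; first by rewrite mulr_ge0 // ltW.
    have T w : O1 w -> `|w - m| <= d -> `|g w 0 j - g m 0 j -
        \sum_i (w 0 i - m 0 i) * 'D_(basis_vec i) (fun x => g x 0 j) m| <= p%:R * L * (d * d `^ e).
      move=> Ow wd; apply: (le_trans (hzb_taylor gO1 L0 (G j) Om Ow)).
      apply: ler_wpM2l; first by rewrite mulr_ge0.
      apply: ler_pM; [exact: normr_ge0|exact: powR_ge0|exact: wd|].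
      by apply: ge0_ler_powR; rewrite ?nnegrE // ltW.
    have [mx my] := mid_dist x y.
    (* The increments from the midpoint are opposite, so the first-order Taylor terms cancel in the
       mean of [g x] and [g y]; only the two remainders are left in [q - g m]. *)
    have S : \sum_i (y 0 i - m 0 i) * 'D_(basis_vec i) (fun x => g x 0 j) m =
      - \sum_i (x 0 i - m 0 i) * 'D_(basis_vec i) (fun x => g x 0 j) m.
      by rewrite -sumrN; apply: eq_bigr => i _; rewrite -mulNr !mxE; congr (_ * _); lra.
    have := T _ Ox mx; have := T _ Oy my; rewrite S opprK => Ty Tx.
    set s := \sum_i _ in Tx Ty.
    have -> : (q - g m) 0 j = 2^-1 * ((g y 0 j - g m 0 j + s) + (g x 0 j - g m 0 j - s)).
      by rewrite !mxE; lra.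
    rewrite normrM ger0_norm //; have := ler_normD (g y 0 j - g m 0 j + s) (g x 0 j - g m 0 j - s).
    move=> h; have -> : C * (d * d `^ e) = p%:R * L * (d * d `^ e) + d * d `^ e by rewrite /C; lra.
    lra.
  have H2 : `|f q - f (g m)| <= K * C `^ e * d.
    apply: (le_trans (F2 _ _ Oq (gO _ Om))); rewrite -mulrA ler_wpM2l //.
    apply: (@le_trans _ _ ((C * (d * d `^ e)) `^ e)).
      by apply: ge0_ler_powR; rewrite ?nnegrE ?mulr_ge0 ?powR_ge0 // ltW.
    rewrite powRM ?(ltW C0) // ler_wpM2l // powRM ?powR_ge0 // -powRrM.
    by apply: powR_mul_le => //; rewrite ?mulr_gt0 //; nra.
  have -> : f (g x) + f (g y) - 2 * f (g m) =
    (f (g x) + f (g y) - 2 * f q) + 2 * (f q - f (g m)) by lra.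
  apply: (le_trans (ler_normD _ _)); rewrite normrM (ger0_norm (_ : 0 <= 2)) //.
  have Kd : 0 <= K * d by rewrite mulr_ge0.
  have Kd' : 0 <= K * C `^ e * d by rewrite mulr_ge0.
  lra.
Qed.

(** Even at order 0 the inner map needs one derivative, to compare images of midpoints with
    midpoints of images; hence [maxn k 1]. From order 1 on this costs nothing, and composition stays
    in the class. *)
Lemma hzb_comp p n k O1 O2 (K L : R) : good_domain O1 -> good_domain O2 ->
  0 <= K -> 0 <= L ->
  exists2 M, 0 <= M & forall (f : 'rV[R]_n -> R) (g : 'rV[R]_p -> 'rV[R]_n),
    hzb t k O2 K f -> (forall j, hzb t (maxn k 1) O1 L (fun x => g x 0 j)) ->
    (forall x, O1 x -> O2 (g x)) -> hzb t k O1 M (fun x => f (g x)).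
Proof.
move=> gO1 gO2; have [oO1 bO1 dO1] := gO1; elim: k K L => [|k IH] K L K0 L0.
  exact: hzb0_comp.
have L'0 : 0 <= p.+1%:R * L by rewrite mulr_ge0.
have LL0 : 0 <= L + p.+1%:R * L by rewrite addr_ge0.
have [M1 M10 H1] := IH _ _ K0 LL0.
have [M2 M20 H2] := hzb_prod (n := p) t k gO1 M10 L0.
exists (K + n%:R * M2); first by rewrite addr_ge0 // mulr_ge0.
move=> f g Hf Hg gO.
have Hg1 j : hzb t (maxn k 1) O1 (L + p.+1%:R * L) (fun x => g x 0 j).
  have := Hg j; case: k {IH H1 H2 Hf Hg} => [|k]; first by apply: hzb_le; rewrite lerDl.
  have E m : maxn m.+1 1 = m.+1 by rewrite (maxn_idPl _).
  rewrite !E => h.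
  apply: hzb_le (hzb_down gO1 L0 h); by rewrite lerDr.
have Hg' j : hzb t k.+1 O1 L (fun x => g x 0 j) by have := Hg j; rewrite (maxn_idPl _).
have D i x : O1 x -> is_derive x (basis_vec i) (fun z => f (g z))
    (\sum_j 'D_(basis_vec j) f (g x) * 'D_(basis_vec i) (fun z => g z 0 j) x).
  move=> Ox; have [df dfE] := hzb_differentiable gO2 K0 (gO _ Ox) Hf.
  apply: is_derive_comp_rV => // j; have [_ H _] := Hg' j; exact: H.
case: Hf => F1 F2 F3; split.
- by move=> x Ox; rewrite (le_trans (F1 _ (gO _ Ox))) // lerDl mulr_ge0.
- by move=> i x /(D i) [].
- move=> i; apply: (@hzb_ext _ _ _ _ _ _ (fun x =>
    \sum_j 'D_(basis_vec j) f (g x) * 'D_(basis_vec i) (fun z => g z 0 j) x)) => //.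
    by move=> x; rewrite inE => /(D i) [_ ->].
  apply: (@hzb_le _ _ _ _ _ (n%:R * M2)); first by rewrite lerDr.
  apply: hzb_sum => // j; have [_ _ H] := Hg' j.
  exact: H2 (H1 _ g (F3 j) Hg1 gO) (H i).
Qed.

End HZBoundComposition.

(** * Limits of real sequences *)

Section Limits.
Context {R : realType}.

Lemma cvgn_of_cauchy (u : nat -> R) :
  (forall eps : R, 0 < eps -> exists N, forall p, (N <= p)%N -> `|u N - u p| <= eps) ->
  cvgn u.
Proof.
move=> H; apply/cauchy_cvgP; apply: cauchy_exP => eps eps0.
have [N HN] := H _ (divr_gt0 eps0 (ltr0Sn R 1)).
exists (u N); suff : \forall p \near \oo, ball (u N) eps (u p) by [].
near=> p; rewrite -ball_normE /=.
apply: (@le_lt_trans _ _ (eps / 2)); last lra.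
apply: HN; near: p; exact: nbhs_infty_ge.
Unshelve. all: by end_near. Qed.

Lemma cvgn_norm_le (u : nat -> R) l (c : R) : u @ \oo --> l ->
  (\forall N \near \oo, `|u N| <= c) -> `|l| <= c.
Proof.
move=> ul uc; apply: (ler_cvg_to (cvg_norm ul) (cvg_cst c)); exact: uc.
Qed.

Lemma cvgn_dist (u : nat -> R) l (eps : R) : u @ \oo --> l -> 0 < eps ->
  exists N, forall p, (N <= p)%N -> `|l - u p| <= eps.
Proof.
move=> /cvgrPdist_le H eps0; have [N _ HN] := H _ eps0.
by exists N => p Np; exact: HN.
Qed.

Lemma powR_small (e C eps : R) : 0 < e -> 0 <= C -> 0 < eps ->
  exists2 d : R, 0 < d & forall h, 0 <= h -> h <= d -> C * h `^ e <= eps.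
Proof.
move=> e0 C0 eps0; have C1 : 0 < C + 1 by rewrite ltr_wpDl.
exists ((eps / (C + 1)) `^ e^-1); first by rewrite powR_gt0 // divr_gt0.
move=> h h0 hd; have := @ge0_ler_powR _ e (ltW e0) _ _ _ _ hd.
rewrite !nnegrE => /(_ h0 (powR_ge0 _ _)).
rewrite -powRrM mulVf ?gt_eqF // powRr1; last by rewrite divr_ge0 // ltW.
rewrite ler_pdivlMr // => h'; apply: le_trans h'; rewrite mulrC ler_wpM2l ?powR_ge0 //.
by rewrite lerDl.
Qed.

End Limits.

(** * Pointwise limits under a uniform bound *)

Section HZBoundLimits.
Context {R : realType} {n : nat} (t : tower R).
Implicit Types (x y : 'rV[R]_n) (O : set 'rV[R]_n) (f g : 'rV[R]_n -> R).
Local Notation e := (tw_exp t).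

Lemma open_shift O x v : open O -> O x -> exists2 r : R, 0 < r &
  forall h : R, `|h| <= r -> O (h *: v + x).
Proof.
move=> oO Ox; have /nbhs_ballP[r /= r0 Hr] : nbhs x O by exact: open_nbhs_nbhs.
have v1 : 0 < `|v| + 1 by rewrite ltr_wpDl.
exists (r / 2 / (`|v| + 1)); first by rewrite !divr_gt0.
move=> h hr; apply: Hr; apply/ball_rVP.
rewrite opprD addrCA subrr addr0 normrN normrZ.
apply: (@le_lt_trans _ _ (r / 2)); last lra.
apply: (@le_trans _ _ (r / 2 / (`|v| + 1) * (`|v| + 1))).
  by apply: ler_pM => //; rewrite lerDl.
by rewrite divfK // gt_eqF.
Qed.

Lemma derive_of_quot f x i (l C r : R) : 0 <= C -> 0 < r ->
  (forall h : R, `|h| <= r -> `|f (h *: basis_vec i + x) - f x - h * l| <= C * `|h| `^ e * `|h|) ->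
  is_derive x (basis_vec i) f l.
Proof.
move=> C0 r0 H.
suff Q : (fun h : R => h^-1 *: ((f \o shift x) (h *: basis_vec i) - f x)) @ 0^' --> l.
  by apply: DeriveDef; [apply/cvg_ex; exists l|exact: cvg_lim Q].
apply/cvgrPdist_le => eps eps0.
have [d d0 Hd] := powR_small (tw_exp_gt0 t) C0 eps0.
near=> h.
have hr : `|h| <= r by near: h; exact: dnbhs0_le.
have hd : `|h| <= d by near: h; exact: dnbhs0_le.
have hn0 : h != 0 by near: h; exact: nbhs_dnbhs_neq.
have := H _ hr; rewrite /= => H1.
rewrite distrC (_ : _ - l = h^-1 * (f (h *: basis_vec i + x) - f x - h * l)); last first.
  by rewrite [RHS]mulrBr mulKf.
rewrite normrM normfV ler_pdivrMl ?normr_gt0 // [leRHS]mulrC.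
apply: (le_trans H1); rewrite ler_wpM2r //; exact: Hd.
Unshelve. all: by end_near. Qed.

(** The error depends on [f] only through [K], so it is uniform along a sequence of functions with a
    common bound. *)
Lemma hzb_quot k O K f x i (h : R) : good_domain O -> 0 <= K ->
  hzb t k.+1 O K f -> O x -> O (h *: basis_vec i + x) ->
  `|f (h *: basis_vec i + x) - f x - h * 'D_(basis_vec i) f x| <=
     n.+1%:R ^+ k * K * `|h| `^ e * `|h|.
Proof.
move=> gO K0 [F1 F2 F3] Ox Oh; have [oO bO dO] := gO.
have K'0 : 0 <= n.+1%:R ^+ k * K by rewrite mulr_ge0.
have Hd j : hzb t 0 O (n.+1%:R ^+ k * K) ('D_(basis_vec j) f).
  by apply: hzb_down_ge => //; rewrite addn0; exact: F3.
have bs s : between 0 h s -> O (s *: basis_vec i + x) /\ `|s| <= `|h|.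
  move=> bs; split.
    apply: (bO _ _ _ Ox Oh) => j; move: bs; rewrite /between !mxE eqxx /=.
    by case: (j == i); rewrite ?mulr1 ?mulr0 ?add0r ?lexx //; lra.
  by case/orP: bs => /andP[h1 h2]; [rewrite !ger0_norm //|rewrite !ler0_norm //]; lra.
have [s bs'|c bc E] := @mvt_line R (fun s => f (s *: basis_vec i + x))
    (fun s => 'D_(basis_vec i) f (s *: basis_vec i + x)) h.
  by apply: is_derive_line; apply: F2; have [] := bs _ bs'.
move: E; rewrite scale0r add0r => ->; rewrite [h * _]mulrC -mulrBl normrM ler_wpM2r //.
have [Oc ch] := bs _ bc; have [_ G _] := Hd i; apply: (le_trans (G _ _ Oc Ox)).
rewrite addrK normrZ ler_wpM2l //.
apply: ge0_ler_powR; rewrite ?nnegrE ?mulr_ge0 //; first exact: ltW (tw_exp_gt0 t).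
apply: (@le_trans _ _ (`|c| * 1)); last by rewrite mulr1.
rewrite ler_wpM2l //; apply: normr_rV_le => // j; rewrite mxE eqxx /=.
by case: (j == i); rewrite ?normr1 ?normr0.
Qed.

(** Pointwise convergence suffices: by [hzb_quot] a difference quotient with one fixed small step
    approximates the derivatives of all [F N] equally well, and for that step the quotients
    converge. So the derivatives form a Cauchy sequence, and the same estimate in the limit
    identifies their limit. *)
Lemma hzb_lim_derive k O K (F : nat -> 'rV[R]_n -> R) f x i :
  good_domain O -> 0 <= K ->
  (forall N, hzb t k.+1 O K (F N)) ->
  (forall y, O y -> F N y @[N --> \oo] --> f y) -> O x ->
  derivable f x (basis_vec i) /\
  ('D_(basis_vec i) (F N) x @[N --> \oo] --> 'D_(basis_vec i) f x).
Proof.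
move=> gO K0 HF Ff Ox; have [oO bO dO] := gO.
pose C := n.+1%:R ^+ k * K; have C0 : 0 <= C by rewrite mulr_ge0.
have [r r0 Or] := open_shift (basis_vec i) oO Ox.
pose a N := 'D_(basis_vec i) (F N) x.
have Q N (h : R) : `|h| <= r -> `|F N (h *: basis_vec i + x) - F N x - h * a N| <= C * `|h| `^ e * `|h|.
  by move=> hr; exact: (hzb_quot gO K0 (HF N) Ox (Or _ hr)).
have ca : cvgn a.
  apply: cvgn_of_cauchy => eps eps0.
  have eps4 : 0 < eps / 8 by lra.
  have [d d0 Hd] := powR_small (tw_exp_gt0 t) C0 eps4.
  (* The step [h] is fixed before the index. Four errors in function values and two quotient errors,
     each at most [eps / 8 * h], stay below [eps * h]. *)
  pose h := Num.min r d; have h0 : 0 < h by rewrite lt_min r0 d0.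
  have hr : `|h| <= r by rewrite (ger0_norm (ltW h0)) ge_min lexx.
  have hd : h <= d by rewrite ge_min lexx orbT.
  have he : 0 < eps / 8 * h by rewrite mulr_gt0.
  have [N1 HN1] := cvgn_dist (Ff _ Ox) he.
  have [N2 HN2] := cvgn_dist (Ff _ (Or _ hr)) he.
  exists (maxn N1 N2) => p; rewrite geq_max => /andP[p1 p2].
  have q1 : (N1 <= maxn N1 N2)%N by exact: leq_maxl.
  have q2 : (N2 <= maxn N1 N2)%N by exact: leq_maxr.
  move: (HN1 _ p1) (HN2 _ p2) (HN1 _ q1) (HN2 _ q2) (Q p _ hr) (Q (maxn N1 N2) _ hr).
  set N := maxn N1 N2; rewrite (ger0_norm (ltW h0)).
  have Ch : C * h `^ e * h <= eps / 8 * h by rewrite ler_wpM2r ?(ltW h0) // Hd // ltW.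
  rewrite !ler_norml => /andP[A1 A2] /andP[B1 B2] /andP[C1 C2] /andP[D1 D2] /andP[E1 E2] /andP[G1 G2].
  apply/andP; split; rewrite -(ler_pM2l h0) mulrBr; lra.
have al : a @ \oo --> limn a by exact: ca.
have D : is_derive x (basis_vec i) f (limn a).
  apply: (derive_of_quot C0 r0) => h hr.
  have L : F N (h *: basis_vec i + x) - F N x - h * a N @[N --> \oo] -->
     f (h *: basis_vec i + x) - f x - h * limn a.
    apply: cvgB; last by apply: cvgMr; exact: al.
    by apply: cvgB; apply: Ff => //; exact: Or.
  apply: (cvgn_norm_le L); near=> N; exact: Q.
by case: D => D ->; exact: conj D al.
Unshelve. all: by end_near. Qed.

Lemma hzb_lim k O K (F : nat -> 'rV[R]_n -> R) f :
  good_domain O -> 0 <= K ->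
  (forall N, hzb t k O K (F N)) ->
  (forall y, O y -> F N y @[N --> \oo] --> f y) -> hzb t k O K f.
Proof.
move=> gO K0; have [oO bO dO] := gO; elim: k F f => [|k IH] F f HF Ff.
  split.
  - move=> x Ox; apply: (cvgn_norm_le (Ff _ Ox)); near=> N; exact: hzb_bound (HF N) Ox.
  - move=> x y Ox Oy; apply: (cvgn_norm_le (cvgB (Ff _ Ox) (Ff _ Oy))).
    by near=> N; have [_ H _] := HF N; exact: H.
  - move=> tz x y Ox Oy; have Om := mid_boxy bO Ox Oy.
    apply: (cvgn_norm_le (cvgB (cvgD (Ff _ Ox) (Ff _ Oy)) (cvgMr (a := 2) (Ff _ Om)))).
    by near=> N; have [_ _ H] := HF N; exact: H.
split.
- move=> x Ox; apply: (cvgn_norm_le (Ff _ Ox)); near=> N; exact: hzb_bound (HF N) Ox.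
- by move=> i x Ox; have [] := hzb_lim_derive i gO K0 HF Ff Ox.
- move=> i; apply: (IH (fun N => 'D_(basis_vec i) (F N))).
    by move=> N; have [_ _ H] := HF N; exact: H.
  by move=> x Ox; have [_] := hzb_lim_derive i gO K0 HF Ff Ox.
Unshelve. all: by end_near. Qed.

End HZBoundLimits.

(** * Fixed points of sup-norm contractions *)

Section FixedPoint.
Context {R : realType} {n p : nat} (t : tower R).

Lemma geometric_cvgn (u : nat -> R) (C : R) : 0 <= C ->
  (forall N, `|u N.+1 - u N| <= C * 2^-1 ^+ N) ->
  exists2 l, u @ \oo --> l & forall N, `|l - u N| <= 2 * C * 2^-1 ^+ N.
Proof.
move=> C0 H.
have B N q : `|u (q + N)%N - u N| <= 2 * C * (2^-1 ^+ N - 2^-1 ^+ (q + N)).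
  elim: q => [|q IH]; first by rewrite add0n !subrr normr0 mulr0.
  have -> : u (q.+1 + N)%N - u N = (u (q + N).+1 - u (q + N)%N) + (u (q + N)%N - u N).
    by rewrite addSn; lra.
  apply: (le_trans (ler_normD _ _)); apply: (le_trans (lerD (H _) IH)).
  by rewrite addSn exprS; lra.
have h0 N : 0 <= (2^-1 : R) ^+ N by rewrite exprn_ge0.
have B' N q : (N <= q)%N -> `|u q - u N| <= 2 * C * 2^-1 ^+ N.
  move=> /subnK <-; apply: (le_trans (B _ _)).
  by rewrite ler_wpM2l ?mulr_ge0 // gerBl.
have cu : cvgn u.
  apply: cvgn_of_cauchy => eps eps0.
  have : (2 * C * 2^-1 ^+ N @[N --> \oo] --> (2 * C) * 0)%classic.
    by apply: cvgMr; apply: cvg_expr; rewrite ger0_norm; lra.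
  rewrite mulr0 => /cvgn_dist /(_ eps0)[N HN]; exists N => q Nq.
  rewrite distrC; apply: (le_trans (B' _ _ Nq)).
  have := HN N (leqnn _); rewrite sub0r normrN ger0_norm ?mulr_ge0 //.
exists (limn u) => // N.
have L : u q - u N @[q --> \oo] --> limn u - u N by apply: cvgB => //; exact: cvg_cst.
apply: (cvgn_norm_le L); near=> q; apply: B'; near: q; exact: nbhs_infty_ge.
Unshelve. all: by end_near. Qed.

(** Contraction is required in the sup norm only, while the invariant set [A] is a ball of the
    class. The iterates of 0 converge geometrically at each point, [hzb_lim] keeps the limit in [A],
    and the contraction property then applies to the limit as well. *)
Lemma hzb_fixpoint k (O : set 'rV[R]_n) (eta : R)
    (T : ('rV[R]_n -> 'rV[R]_p) -> ('rV[R]_n -> 'rV[R]_p)) :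
  let A (psi : 'rV[R]_n -> 'rV[R]_p) := forall j, hzb t k O eta (fun x => psi x 0 j) in
  good_domain O -> 0 <= eta ->
  (forall psi, A psi -> A (T psi)) ->
  (forall psi1 psi2 d, A psi1 -> A psi2 -> 0 <= d ->
     (forall x, O x -> `|psi1 x - psi2 x| <= d) ->
     forall x, O x -> `|T psi1 x - T psi2 x| <= d / 2) ->
  exists2 psi, A psi & forall x, O x -> T psi x = psi x.
Proof.
move=> A gO eta0 AT CT; have [oO bO dO] := gO.
pose psi N := iter N T (fun=> 0).
have Apsi N : A (psi N).
  elim: N => [|N IH]; last exact: AT.
  move=> j; apply: (@hzb_ext _ _ _ _ _ _ (fun=> 0)) => //; first by move=> x _; rewrite mxE.
  by apply: hzb_cst; rewrite ?normr0.
have st N x : O x -> `|psi N.+1 x - psi N x| <= eta * 2^-1 ^+ N.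
  elim: N x => [|N IH] x Ox.
    rewrite subr0 mulr1; apply: normr_rV_le => // j; exact: (hzb_bound (Apsi 1%N j)).
  rewrite exprSr mulrA; apply: CT IH _ Ox => //.
  by rewrite mulr_ge0 // exprn_ge0.
have stc x j : O x -> exists2 l, psi N x 0 j @[N --> \oo] --> l &
    forall N, `|l - psi N x 0 j| <= 2 * eta * 2^-1 ^+ N.
  move=> Ox; apply: geometric_cvgn => // N; apply: le_trans (st N _ Ox).
  by have := normr_coord (psi N.+1 x - psi N x) j; rewrite !mxE.
pose phi x := \row_j limn (fun N => psi N x 0 j).
have phiP x j : O x -> psi N x 0 j @[N --> \oo] --> phi x 0 j.
  by move=> /(stc x j)[l Hl _]; rewrite mxE (cvg_lim _ Hl).
have phi_dist N x : O x -> `|phi x - psi N x| <= 2 * eta * 2^-1 ^+ N.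
  move=> Ox; apply: normr_rV_le => [|j]; first by rewrite !mulr_ge0 // exprn_ge0.
  by rewrite !mxE; have [l Hl Hd] := stc x j Ox; rewrite (cvg_lim _ Hl).
have Aphi : A phi.
  move=> j; apply: (@hzb_lim _ _ t k O eta (fun N x => psi N x 0 j)) => // [N|x Ox].
    exact: Apsi.
  exact: phiP.
exists phi => // x Ox; apply/eqP; rewrite -subr_eq0 -normr_le0.
have H N : `|T phi x - phi x| <= 3 * eta * 2^-1 ^+ N.
  have -> : T phi x - phi x = (T phi x - psi N.+1 x) - (phi x - psi N.+1 x).
    by rewrite opprB addrA subrK.
  apply: (le_trans (ler_normB _ _)).
  have h0 : 0 <= 2 * eta * 2^-1 ^+ N by rewrite !mulr_ge0 // exprn_ge0.
  have := CT _ _ _ Aphi (Apsi N) h0 (phi_dist N) _ Ox.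
  have := phi_dist N.+1 _ Ox; rewrite exprS /psi iterS -/(psi N); lra.
have L : (3 * eta * 2^-1 ^+ N @[N --> \oo] --> 3 * eta * 0)%classic.
  by apply: cvgMr; apply: cvg_expr; rewrite ger0_norm; lra.
rewrite mulr0 in L.
by apply: (ler_cvg_to (cvg_cst `|T phi x - phi x|) L); near=> N; exact: H.
Unshelve. all: by end_near. Qed.

End FixedPoint.

(** * The local inverse theorem *)

Section PartialScaling.
Context {R : realType} {n : nat} (t : tower R).
Implicit Types (x y z : 'rV[R]_n) (O : set 'rV[R]_n) (f g : 'rV[R]_n -> R).
Local Notation e := (tw_exp t).

(** The coordinates in [T] serve as times and are dilated, the others parametrize initial points and
    stay fixed. At [s = 0] this is the projection to the initial slice; for [predT] it is an
    ordinary dilation. *)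
Definition pscale (T : pred 'I_n) (s : R) z : 'rV[R]_n :=
  \row_i (if T i then s * z 0 i else z 0 i).

Lemma pscale_norm T (s : R) z : 0 <= s <= 1 -> `|pscale T s z| <= `|z|.
Proof.
move=> /andP[s0 s1]; apply: normr_rV_le => // i; rewrite mxE.
case: ifP => _; last exact: normr_coord.
rewrite normrM ger0_norm // (le_trans _ (normr_coord z i)) //.
by rewrite ler_piMl.
Qed.

Lemma pscaleB T s x y : pscale T s x - pscale T s y = pscale T s (x - y).
Proof. by apply/rowP => i; rewrite !mxE; case: ifP => // _; rewrite mulrBr. Qed.

Lemma pscale1 T z : pscale T 1 z = z.
Proof. by apply/rowP => i; rewrite mxE mul1r if_same. Qed.

Lemma pscale_0 T s : pscale T s 0 = 0.
Proof. by apply/rowP => i; rewrite !mxE mulr0 if_same. Qed.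

Lemma pscaleT s z : pscale predT s z = s *: z.
Proof. by apply/rowP => i; rewrite !mxE. Qed.

Lemma ball0P (r : R) x : ball 0 r x <-> `|x| < r.
Proof. by rewrite ball_rVP sub0r normrN. Qed.

Lemma pscale_ball T (s r : R) z : 0 <= s <= 1 -> ball 0 r z -> ball 0 r (pscale T s z).
Proof. by move=> s01 /ball0P h; apply/ball0P; exact: le_lt_trans (pscale_norm _ _ s01) h. Qed.

Lemma derivable_pscale_coord T s z i j :
  is_derive z (basis_vec i) (fun z => pscale T s z 0 j)
    ((if T i then s else 1) * (i == j)%:R).
Proof.
have [Dc Ec] := derive_coord i j z.
have -> : (fun z => pscale T s z 0 j) = (fun z => (if T j then s else 1) * (z 0 j)).
  by apply/funext => w; rewrite mxE; case: ifP => // _; rewrite mul1r.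
apply: DeriveDef; first exact: derivableZ.
rewrite [LHS]deriveZ // Ec; have [->//|] := eqVneq i j.
by rewrite !mulr0 [_ *: _]mulr0.
Qed.

Lemma derive_pscale k O K f T (s : R) x i : good_domain O -> 0 <= K ->
  hzb t k.+1 O K f -> O (pscale T s x) ->
  is_derive x (basis_vec i) (fun z => f (pscale T s z))
     ((if T i then s else 1) * 'D_(basis_vec i) f (pscale T s x)).
Proof.
move=> gO K0 Hf Ox.
have [df dfE] := hzb_differentiable gO K0 Ox Hf.
have D j := derivable_pscale_coord T s x i j.
have := is_derive_comp_rV df dfE (fun j => @ex_derive _ _ _ _ _ _ _ (D j)).
move=> H; apply: (is_derive_eq H).
rewrite (bigD1 i) //= big1 => [|j ji].
  by have [_ ->] := D i; rewrite eqxx mulr1 addr0 mulrC.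
by have [_ ->] := D j; rewrite eq_sym (negbTE ji) !mulr0.
Qed.

(** A partial contraction shrinks distances, and each derivative brings a factor at most 1. The
    constant [K] is therefore unchanged, and averages over [s] keep it too. *)
Lemma hzb_pscale k O K f T (s : R) : good_domain O -> 0 <= K -> 0 <= s <= 1 ->
  (forall x, O x -> O (pscale T s x)) ->
  hzb t k O K f -> hzb t k O K (fun x => f (pscale T s x)).
Proof.
move=> gO K0 s01 OS; have [oO bO dO] := gO; elim: k f => [|k IH] f.
  case=> F1 F2 F3; split.
  - by move=> x /OS/F1.
  - move=> x y Ox Oy; apply: (le_trans (F2 _ _ (OS _ Ox) (OS _ Oy))).
    apply: ler_wpM2l => //; apply: ler_powR_base => //.
      exact: ltW (tw_exp_gt0 t).
    by rewrite pscaleB pscale_norm.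
  - move=> tz x y Ox Oy.
    have -> : pscale T s (2^-1 *: (x + y)) = 2^-1 *: (pscale T s x + pscale T s y).
      by apply/rowP => i; rewrite !mxE; case: ifP => // _; lra.
    apply: (le_trans (F3 tz _ _ (OS _ Ox) (OS _ Oy))).
    by rewrite ler_wpM2l // pscaleB pscale_norm.
move=> Hf; have D x i (Ox : O x) := derive_pscale i gO K0 Hf (OS _ Ox).
case: Hf => F1 F2 F3; split.
- by move=> x /OS/F1.
- by move=> i x Ox; have [] := D x i Ox.
- move=> i; apply: (@hzb_ext _ _ _ _ _ _ (fun x => (if T i then s else 1) *
      'D_(basis_vec i) f (pscale T s x))) => //.
    by move=> x; rewrite inE => Ox; have [_ ->] := D x i Ox.
  apply: (@hzb_le _ _ _ _ _ (`|if T i then s else 1| * K)).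
    rewrite ler_piMl //; case: ifP => _; last by rewrite normr1.
    by case/andP: s01 => s0 s1; rewrite ger0_norm.
  by apply: hzb_scale => //; exact: IH (F3 i).
Qed.

(** Zooming in gains a power of [s] in every clause: [s ^ e] in the Hoelder one, [s] in the Zygmund
    one and in each derivative. The sup bound has no factor of its own and is recovered from
    [f 0 = 0]. *)
Lemma hzb_rescale_small k O K (eta : R) : good_domain O -> O 0 ->
  (forall (s : R) x, 0 <= s <= 1 -> O x -> O (s *: x)) -> 0 <= K -> 0 < eta ->
  exists2 s0 : R, 0 < s0 <= 1 & forall s f, 0 < s <= s0 -> hzb t k O K f -> f 0 = 0 ->
    hzb t k O eta (fun x => f (s *: x)).
Proof.
move=> gO O0 OS K0 eta0; have [oO bO dO] := gO.
have e0 := tw_exp_gt0 t; have e1 := tw_exp_lt1 t.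
have O1 x : O x -> `|x| <= 1 by move=> /dO /(_ O0); rewrite subr0.
case: k => [|k].
  have [d d0 Hd] := powR_small e0 K0 eta0.
  exists (Num.min d 1); first by rewrite lt_min d0 ltr01 ge_min lexx orbT.
  move=> s f /andP[s0]; rewrite le_min => /andP[sd s1] [F1 F2 F3] f0.
  have s01 : 0 <= s <= 1 by rewrite ltW.
  have sE := Hd _ (ltW s0) sd.
  have H x y : O x -> O y -> `|f (s *: x) - f (s *: y)| <= eta * `|x - y| `^ e.
    move=> Ox Oy; apply: (le_trans (F2 _ _ (OS _ _ s01 Ox) (OS _ _ s01 Oy))).
    rewrite -scalerBr normrZ (ger0_norm (ltW s0)) powRM // ?(ltW s0) // mulrA.
    by rewrite ler_wpM2r // powR_ge0.
  split=> //.
  - move=> x Ox; have := H _ _ Ox O0; rewrite scaler0 f0 !subr0 => h; apply: (le_trans h).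
    rewrite ler_piMr ?(ltW eta0) //.
    have <- : 1 `^ e = 1 :> R by rewrite powR1.
    by apply: ge0_ler_powR; rewrite ?nnegrE ?O1 // ltW.
  - move=> tz x y Ox Oy.
    have -> : s *: (2^-1 *: (x + y)) = 2^-1 *: (s *: x + s *: y).
      by rewrite scalerA mulrC -scalerA scalerDr.
    apply: (le_trans (F3 tz _ _ (OS _ _ s01 Ox) (OS _ _ s01 Oy))).
    rewrite -scalerBr normrZ (ger0_norm (ltW s0)) mulrA ler_wpM2r //.
    by apply: le_trans sE; rewrite ler_wpM2l //; apply: (powR_le_self t) => //; exact: ltW.
have nK : 0 < n.+1%:R * K + 1 by rewrite ltr_wpDl // mulr_ge0.
exists (Num.min (eta / (n.+1%:R * K + 1)) 1).
  by rewrite lt_min divr_gt0 // ltr01 ge_min lexx orbT.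
move=> s f /andP[s0]; rewrite le_min => /andP[sd s1] Hf f0.
have s01 : 0 <= s <= 1 by rewrite ltW.
have sK : s * (n.+1%:R * K) <= eta.
  move: sd; rewrite ler_pdivlMr // => sd; apply: le_trans sd; rewrite ler_wpM2l ?(ltW s0) //.
  by rewrite lerDl.
have sK' : s * K <= eta.
  apply: le_trans sK; rewrite ler_wpM2l ?(ltW s0) // ler_peMl //.
  by rewrite ler1n.
have OS' x : O x -> O (pscale predT s x) by rewrite pscaleT; exact: OS.
have D x i (Ox : O x) := derive_pscale i gO K0 Hf (OS' _ Ox).
have E : (fun z => f (pscale predT s z)) = (fun x => f (s *: x)).
  by apply/funext => x; rewrite pscaleT.
rewrite -E; split.
- move=> x Ox; rewrite pscaleT; have := hzb_lipschitz gO Hf (OS _ _ s01 Ox) (OS _ _ s01 O0).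
  rewrite scaler0 f0 !subr0 => h; apply: (le_trans h).
  rewrite normrZ (ger0_norm (ltW s0)); apply: le_trans sK.
  rewrite mulrCA ler_wpM2l ?(ltW s0) //.
  apply: (@le_trans _ _ (n%:R * K * 1)); first by rewrite ler_wpM2l ?mulr_ge0 ?O1.
  by rewrite mulr1 ler_wpM2r // ler_nat.
- by move=> i x Ox; have [] := D x i Ox.
- move=> i; apply: (@hzb_ext _ _ _ _ _ _ (fun x => s * 'D_(basis_vec i) f (pscale predT s x))) => //.
    by move=> x; rewrite inE => Ox; have [_ ->] := D x i Ox.
  apply: (@hzb_le _ _ _ _ _ (`|s| * K)); first by rewrite (ger0_norm (ltW s0)).
  case: Hf => _ _ F3; apply: hzb_scale => //; exact: (hzb_pscale gO K0 s01 OS' (F3 i)).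
Qed.

End PartialScaling.

(** Composition is linear in the outer function, so the bound is proportional to [d]. Since [M] does
    not depend on [d], the smallness [d] can be chosen after [M]. *)
Lemma hzb_comp_scaled (R : realType) (t : tower R) p m k (O1 : set 'rV[R]_p) (O2 : set 'rV[R]_m) (L : R) :
  good_domain O1 -> good_domain O2 -> 0 <= L ->
  exists2 M, 0 <= M & forall (d : R) (f : 'rV[R]_m -> R) (g : 'rV[R]_p -> 'rV[R]_m),
    0 < d -> hzb t k.+1 O2 d f -> (forall j, hzb t k.+1 O1 L (fun x => g x 0 j)) ->
    (forall x, O1 x -> O2 (g x)) -> hzb t k.+1 O1 (d * M) (fun x => f (g x)).
Proof.
move=> gO1 gO2 L0; have [M M0 HM] := hzb_comp t k.+1 gO1 gO2 ler01 L0.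
have [op1 bx1 _] := gO1; have [op2 bx2 _] := gO2.
exists M => // d f g d0 Hf Hg gO.
have Hf' : hzb t k.+1 O2 1 (fun x => d^-1 * f x).
  rewrite -(mulVf (lt0r_neq0 d0)) -[X in X * d]ger0_norm ?invr_ge0 ?(ltW d0) //.
  exact: hzb_scale.
have := hzb_scale d op1 bx1 (HM _ g Hf' Hg gO); rewrite (ger0_norm (ltW d0)).
by apply: hzb_ext => // x _; rewrite mulVKf // lt0r_neq0.
Qed.

Section LocalInverse.
Context {R : realType} {n : nat} (t : tower R).
Implicit Types (x y z : 'rV[R]_n) (O : set 'rV[R]_n).

Lemma scale_ball0 (r s : R) x : 0 <= s <= 1 -> ball 0 r x -> ball 0 r (s *: x).
Proof. by rewrite -pscaleT; exact: pscale_ball. Qed.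

Lemma subset_ball0 (r s : R) : r <= s -> ball (0 : 'rV[R]_n) r `<=` ball 0 s.
Proof. by move=> rs x /ball0P h; apply/ball0P; exact: lt_le_trans rs. Qed.

(* [id + g] is inverted on half the ball by the fixed point of
   [psi |-> - g \o (id + psi)]. *)
Lemma near_id_inverse k (s : R) : 0 < s -> s <= 2^-1 ->
  exists2 d, 0 < d & forall g : 'rV[R]_n -> 'rV[R]_n,
    (forall j, hzb t k.+1 (ball 0 s) d (fun x => g x 0 j)) ->
    [/\ forall x y, ball 0 s x -> ball 0 s y -> x + g x = y + g y -> x = y &
      exists G : 'rV[R]_n -> 'rV[R]_n,
      (forall j, hzb t k.+1 (ball 0 (s / 2)) (s / 4 + 1) (fun x => G x 0 j)) /\
      (forall z, ball 0 (s / 2) z -> ball 0 s (G z) /\ G z + g (G z) = z)].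
Proof.
move=> s0 s2; set O := ball 0 s; set O1 := ball 0 (s / 2).
have gO : good_domain O by exact: good_ball.
have gO1 : good_domain O1 by apply: good_ball; lra.
have [oO bO dO] := gO; have [oO1 bO1 dO1] := gO1.
have OO1 : O1 `<=` O by apply: subset_ball0; lra.
have L0 : 0 <= s / 4 + 1 by lra.
have [M M0 HM] := hzb_comp_scaled t k gO1 gO L0.
(* The first entry makes the ball of radius [s / 4] of the class invariant; the second makes [g]
   Lipschitz with constant 1/2, which gives both the contraction and injectivity. *)
pose d := Num.min (s / 4 / (M + 1)) (2^-1 / n.+1%:R).
have M1 : 0 < M + 1 by rewrite ltr_wpDl.
have d0 : 0 < d by rewrite lt_min !divr_gt0.
have dM : d * M <= s / 4.
  apply: (@le_trans _ _ (s / 4 / (M + 1) * (M + 1))).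
    by apply: ler_pM; rewrite ?(ltW d0) ?lerDl // /d ge_min lexx.
  by rewrite divfK ?lt0r_neq0.
have dn : n%:R * d <= 2^-1.
  apply: (@le_trans _ _ (n.+1%:R * (2^-1 / n.+1%:R))).
    by apply: ler_pM; rewrite ?(ltW d0) ?ler_nat // /d ge_min lexx orbT.
  by rewrite mulrC divfK.
exists d => // g Hg.
have gL x y : O x -> O y -> `|g x - g y| <= `|x - y| / 2.
  move=> Ox Oy; apply: normr_rV_le => [|j]; first by rewrite divr_ge0.
  rewrite !mxE; apply: (le_trans (hzb_lipschitz gO (Hg j) Ox Oy)).
  by rewrite mulrC ler_wpM2l.
split.
  move=> x y Ox Oy E; apply/eqP; rewrite -subr_eq0 -normr_le0.
  have Eg : x - y = g y - g x.
    by apply/rowP => i; have := congr1 (fun v : 'rV[R]_n => v 0 i) E; rewrite !mxE; lra.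
  have := gL _ _ Oy Ox; rewrite -Eg (distrC y); lra.
pose T (psi : 'rV[R]_n -> 'rV[R]_n) z := - g (z + psi z).
pose A (psi : 'rV[R]_n -> 'rV[R]_n) := forall j, hzb t k.+1 O1 (s / 4) (fun x => psi x 0 j).
have Aid psi : A psi -> forall j, hzb t k.+1 O1 (s / 4 + 1) (fun x => (x + psi x) 0 j).
  move=> Ap j; rewrite addrC.
  apply: (@hzb_ext _ _ _ _ _ _ ((fun x : 'rV[R]_n => x 0 j) \+ (fun x => psi x 0 j))) => //.
    by move=> x _; rewrite /= !mxE.
  apply: hzb_add => //.
  apply: hzb_coord => // x /ball0P h; lra.
have psiO psi x : A psi -> O1 x -> O (x + psi x).
  move=> Ap Ox; apply/ball0P; move/ball0P : (Ox) => xs.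
  have : `|psi x| <= s / 4.
    by apply: normr_rV_le => [|j]; [lra|exact: (hzb_bound (Ap j) Ox)].
  have := ler_normD x (psi x); lra.
have s4 : 0 <= s / 4 by lra.
have AT psi : A psi -> A (T psi).
  move=> Ap j.
  have := HM d _ (fun x => x + psi x) d0 (Hg j) (Aid _ Ap) (fun x => psiO psi x Ap).
  move=> /(hzb_scale (-1) oO1 bO1); rewrite normrN normr1 mul1r => H.
  apply: hzb_le dM _; apply: hzb_ext H => // x _.
  by rewrite mxE mulN1r.
have CT psi1 psi2 c : A psi1 -> A psi2 -> 0 <= c ->
     (forall x, O1 x -> `|psi1 x - psi2 x| <= c) ->
     forall x, O1 x -> `|T psi1 x - T psi2 x| <= c / 2.
  move=> A1 A2 c0 H x Ox; rewrite -opprD normrN.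
  apply: (le_trans (gL _ _ (psiO _ _ A1 Ox) (psiO _ _ A2 Ox))).
  rewrite opprD addrACA subrr add0r.
  by have := H x Ox; lra.
have [psi Ap Tp] := hzb_fixpoint (T := T) gO1 s4 AT CT.
exists (fun z => z + psi z); split; first exact: Aid.
move=> z Oz; split; first exact: psiO.
by rewrite -[X in z + X + _]Tp // /T subrK.
Qed.

Lemma hzb_linear_coord (O : set 'rV[R]_n) k (c : R) i : good_domain O ->
  (forall x, O x -> `|x| <= 1) -> hzb t k O `|c| (fun x => c * x 0 i).
Proof.
move=> gO H; have [oO bO _] := gO; rewrite -[X in hzb _ _ _ X _]mulr1.
by apply: hzb_scale => //; exact: hzb_coord.
Qed.

(** With [h = f - id], the blow-up [g x = s1^-1 * h (s1 *: x)] has partial derivatives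
    ['D h (s1 *: x)]. These vanish at 0, so [hzb_rescale_small] makes them small in the class, and
    [near_id_inverse] inverts the rescaled map. *)
Theorem local_inverse k (r K : R) (f : 'rV[R]_n -> 'rV[R]_n) : 0 < r ->
  r <= 2^-1 -> 0 <= K ->
  (forall j, hzb t k.+1 (ball 0 r) K (fun x => f x 0 j)) -> f 0 = 0 ->
  (forall i j, 'D_(basis_vec i) (fun x => f x 0 j) 0 = (i == j)%:R) ->
  exists r1 r2 L (G : 'rV[R]_n -> 'rV[R]_n),
  [/\ 0 < r1 <= r, 0 < r2 <= 2^-1,
      forall x y, ball 0 r1 x -> ball 0 r1 y -> f x = f y -> x = y,
      forall j, hzb t k.+1 (ball 0 r2) L (fun x => G x 0 j) &
      forall z, ball 0 r2 z -> ball 0 r1 (G z) /\ f (G z) = z].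
Proof.
move=> r0 r2 K0 Hf f0 Df; pose O := ball (0 : 'rV[R]_n) r.
have gO : good_domain O by exact: good_ball.
have [oO bO dO] := gO.
have O0 : O 0 by apply/ball0P; rewrite normr0.
have O1 x : O x -> `|x| <= 1 by move=> /ball0P; lra.
have OS (s : R) x : 0 <= s <= 1 -> O x -> O (s *: x) by exact: scale_ball0.
have [d d0 Hd] := near_id_inverse k r0 r2.
pose h j x : R := f x 0 j - x 0 j.
have K10 : 0 <= K + 1 by rewrite addr_ge0.
have Hh j : hzb t k.+1 O (K + 1) (h j).
  apply: (@hzb_ext _ _ _ _ _ _ ((fun x => f x 0 j) \+ (fun x => -1 * x 0 j))) => //.
    by move=> x _; rewrite /= mulN1r.
  apply: hzb_add => //.
  by have := @hzb_linear_coord O k.+1 (-1) j gO O1; rewrite normrN normr1.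
have h0 j : h j 0 = 0 by rewrite /h f0 subrr.
have Dh i j : 'D_(basis_vec i) (h j) 0 = 0.
  have [Dc Ec] := derive_coord i j (0 : 'rV[R]_n).
  have [_ H _] := Hf j; rewrite [LHS](deriveB (H i _ O0) Dc).
  by rewrite Df Ec subrr.
(* The derivatives of [g] are held below [d / n.+1] so that integrating the [n] partial derivatives
   from 0 bounds [g] itself by [d]. *)
have d'0 : 0 < d / n.+1%:R by rewrite divr_gt0.
have [s1 s1P Hs] := hzb_rescale_small t k gO O0 OS K10 d'0.
have s1_gt0 : 0 < s1 by case/andP: s1P.
have s01 : 0 <= s1 <= 1 by case/andP: s1P => *; rewrite ltW.
pose g x : 'rV[R]_n := \row_j (s1^-1 * h j (s1 *: x)).
have Dg i j x : O x -> is_derive x (basis_vec i) (fun x => g x 0 j)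
    ('D_(basis_vec i) (h j) (s1 *: x)).
  move=> Ox.
  have OSx : O (pscale predT s1 x) by rewrite pscaleT; exact: OS.
  have := derive_pscale i gO K10 (Hh j) OSx; rewrite /= pscaleT.
  have -> : (fun z => h j (pscale predT s1 z)) = (fun z => h j (s1 *: z)).
    by apply/funext => z; rewrite pscaleT.
  have -> : (fun x => g x 0 j) = (fun x => s1^-1 * h j (s1 *: x)).
    by apply/funext => z; rewrite mxE.
  move=> [D1 E1]; apply: DeriveDef; first exact: derivableZ.
  by rewrite [LHS]deriveZ // E1 [LHS]mulKf // lt0r_neq0.
have nd : n%:R * (d / n.+1%:R) <= d.
  by rewrite mulrCA ler_piMr ?(ltW d0) // ler_pdivrMr // mul1r ler_nat.
have nd' : d / n.+1%:R <= d by rewrite ler_piMr ?(ltW d0) // invf_le1 // ler1n.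
have HDg i j : hzb t k O (d / n.+1%:R) ('D_(basis_vec i) (fun x => g x 0 j)).
  apply: (@hzb_ext _ _ _ _ _ _ (fun x => 'D_(basis_vec i) (h j) (s1 *: x))) => //.
    by move=> x; rewrite inE => /(Dg i j)[_ ->].
  have s1s : 0 < s1 <= s1 by rewrite s1_gt0 lexx.
  by have [_ _ H] := Hh j; exact: (Hs s1 ('D_(basis_vec i) (h j)) s1s (H i) (Dh i j)).
have Hg j : hzb t k.+1 O d (fun x => g x 0 j).
  have dg i x : O x -> derivable (fun x => g x 0 j) x (basis_vec i) by move=> /(Dg i j)[].
  split => //.
  - move=> x Ox.
    have B : `|g x 0 j - g 0 0 j| <= n%:R * (d / n.+1%:R) * `|x - 0|.
      apply: (lipschitz_of_partials (f := fun x => g x 0 j) bO Ox O0 dg) => i w Ow.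
      exact: (hzb_bound (HDg i j) Ow).
    have g00 : g 0 0 j = 0 by rewrite mxE scaler0 h0 mulr0.
    move: B; rewrite g00 !subr0 => B; apply: (le_trans B).
    apply: (@le_trans _ _ (d * 1)); last by rewrite mulr1.
    by apply: ler_pM; [rewrite mulr_ge0 // ltW|exact: normr_ge0|exact: nd|exact: O1].
  - by move=> i; exact: hzb_le nd' (HDg i j).
have [inj [G [HG GP]]] := Hd g Hg.
have fE x : f (s1 *: x) = s1 *: (x + g x).
  apply/rowP => j; rewrite !mxE /h mxE mulrDr mulrA divff ?lt0r_neq0 // mul1r.
  by rewrite addrC subrK.
have sK x : s1 *: (s1^-1 *: x) = x by rewrite scalerA divff ?scale1r // lt0r_neq0.
have sc (c : R) x : ball 0 (s1 * c) x -> ball 0 c (s1^-1 *: x).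
  move=> /ball0P xs; apply/ball0P; rewrite normrZ ger0_norm ?invr_ge0 ?(ltW s1_gt0) //.
  by rewrite ltr_pdivrMl.
have s1r : s1 * r <= r by case/andP: s1P => *; rewrite ler_piMl // ltW.
have b2 : s1 * (r / 2) <= 2^-1 by rewrite mulrA; lra.
have gO2 : good_domain (ball (0 : 'rV[R]_n) (s1 * (r / 2))) by exact: good_ball.
have [oO2 bO2 _] := gO2.
have gO3 : good_domain (ball (0 : 'rV[R]_n) (r / 2)) by apply: good_ball; lra.
have L0 : 0 <= r / 4 + 1 by lra.
have [M M0 HM] := hzb_comp t k.+1 gO2 gO3 L0 (normr_ge0 s1^-1).
exists (s1 * r), (s1 * (r / 2)), (`|s1| * M), (fun z => s1 *: G (s1^-1 *: z)); split.
- by rewrite mulr_gt0.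
- by rewrite mulr_gt0 // divr_gt0.
- move=> x y /sc xs /sc ys; rewrite -(sK x) -(sK y) !fE => /(scalerI (lt0r_neq0 s1_gt0)).
  by move=> /(inj _ _ xs ys) ->.
- move=> j; apply: (@hzb_ext _ _ _ _ _ _ (fun x => s1 * (fun z => G z 0 j) (s1^-1 *: x))) => //.
    by move=> x _; rewrite mxE.
  apply: hzb_scale => //.
  apply: (HM (fun z => G z 0 j) (fun x => s1^-1 *: x) (HG j)); last by move=> x; exact: sc.
  move=> i; rewrite (maxn_idPl (ltn0Sn k)).
  apply: (@hzb_ext _ _ _ _ _ _ (fun x => s1^-1 * x 0 i)) => //.
    by move=> x _; rewrite mxE.
  apply: hzb_linear_coord => // x /ball0P; lra.
- move=> z /sc /GP [Gz E]; split; last by rewrite fE E sK.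
  move/ball0P : Gz => Gz; apply/ball0P; rewrite normrZ ger0_norm ?(ltW s1_gt0) //.
  by rewrite ltr_pM2l.
Qed.

End LocalInverse.

(** * Commuting vector fields *)

Section UnitIntegral.
Context {R : realType}.
Implicit Types (phi psi F : R -> R) (s : R).

Definition antiderivative phi F := forall s, 0 <= s <= 1 -> is_derive s 1 F (phi s).

(* Meaningful only when phi has an antiderivative on [0, 1]. *)
Definition intg phi : R :=
  let F := xget (fun=> 0) [set F | antiderivative phi F] in F 1 - F 0.

Definition hoelder01 (e C : R) phi := forall s u, 0 <= s <= 1 -> 0 <= u <= 1 ->
  `|phi s - phi u| <= C * `|s - u| `^ e.

Lemma mvt_unit F phi (a b : R) : 0 <= a <= 1 -> 0 <= b <= 1 -> antiderivative phi F ->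
  exists2 c, between a b c & F b - F a = phi c * (b - a).
Proof.
move=> a01 b01 H.
have bs s : between 0 (b - a) s -> 0 <= s + a <= 1 by rewrite /between; lra.
have [s /bs sb|c bc] := @mvt_line R (fun s => F (s + a)) (fun s => phi (s + a)) (b - a).
  have Hs := H _ sb.
  have -> : (fun s : R => F (s + a)) = F \o shift a by [].
  rewrite -[phi _]mulr1; apply: is_derive1_comp => //; exact: is_derive_shift.
rewrite subrK add0r => ->; exists (c + a) => //; move: bc; rewrite /between; lra.
Qed.

Lemma intgP phi F : antiderivative phi F -> intg phi = F 1 - F 0.
Proof.
move=> HF; rewrite /intg; set G := xget _ _.
have HG : antiderivative phi G by apply: (xgetPex (fun=> 0) (P := [set F | antiderivative phi F])); exists F.
have D : antiderivative (fun=> 0) (G \- F).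
  move=> s s01; have [Gd Ge] := HG _ s01; have [Fd Fe] := HF _ s01.
  by apply: DeriveDef; [exact: derivableB|rewrite [LHS]deriveB // Ge Fe subrr].
have i0 : 0 <= (0 : R) <= 1 by rewrite lexx ler01.
have i1 : 0 <= (1 : R) <= 1 by rewrite lexx ler01.
have [c _] := mvt_unit i0 i1 D; rewrite mul0r /=; lra.
Qed.

(** Extends an integrand continuously beyond the unit interval, since an antiderivative must have
    two-sided derivatives at 0 and 1. *)
Definition clamp s : R := Num.max 0 (Num.min 1 s).

Lemma clamp01 s : 0 <= clamp s <= 1.
Proof. by rewrite /clamp le_max lexx /= ge_max ler01 ge_min lexx. Qed.

Lemma clamp_id s : 0 <= s <= 1 -> clamp s = s.
Proof.
by move=> /andP[s0 s1]; rewrite /clamp; rewrite (min_idPr s1) (max_idPr s0).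
Qed.

Lemma clamp_dist s u : `|clamp s - clamp u| <= `|s - u|.
Proof.
rewrite /clamp; have [h1|h1] := leP 1 s; have [h2|h2] := leP 1 u;
 have [h3|h3] := leP 0 s; have [h4|h4] := leP 0 u;
 rewrite ?(max_idPr ler01) ?subrr ?normr0 //;
 rewrite ler_norml; apply/andP; split; have := ler_norm (s - u); have := ler_norm (- (s - u));
 rewrite normrN => *; rewrite ?maxEle; repeat case: ifP; lra.
Qed.

Lemma intg_ex e C phi : 0 < e -> 0 <= C -> hoelder01 e C phi -> exists F, antiderivative phi F.
Proof.
move=> e0 C0 H; pose f s := phi (clamp s).
have fc : continuous f.
  move=> s; apply/cvgrPdist_le => eps eps0.
  have [d d0 Hd] := powR_small e0 C0 eps0.
  near=> u.
  have su : `|s - u| <= d.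
    by near: u; apply/nbhs_ballP; exists d => //= u; exact: ltW.
  apply: (le_trans (H _ _ (clamp01 s) (clamp01 u))); apply: Hd => //.
  exact: le_trans (clamp_dist _ _) su.
(* [[-1, 2]] contains the unit interval in its interior, as the fundamental theorem of calculus is
   applied at interior points. *)
have fi : lebesgue_measure.-integrable `[-1, 2] (EFin \o f).
  apply: continuous_compact_integrable; first exact: segment_compact.
  exact: continuous_subspaceT.
exists (fun x => \int[lebesgue_measure]_(t in [set` `[(-1)%R, x]]) f t)%R => s s01.
have [|||Fd Fe] := @continuous_FTC1_closed R f (-1) s 2 _ fi.
- lra.
- lra.
- exact: fc.
by apply: DeriveDef => //; rewrite -derive1E Fe /f clamp_id.
Unshelve. all: by end_near. Qed.

Lemma intg_lin m (c : 'I_m -> R) (phi : 'I_m -> R -> R) e (C : 'I_m -> R) : 0 < e ->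
  (forall i, 0 <= C i) -> (forall i, hoelder01 e (C i) (phi i)) ->
  intg (fun s => \sum_i c i * phi i s) = \sum_i c i * intg (phi i).
Proof.
move=> e0 C0 H.
have F i : {F | antiderivative (phi i) F} by apply: cid; exact: intg_ex (C0 i) (H i).
have D : antiderivative (fun s => \sum_i c i * phi i s) (fun s => \sum_i c i * sval (F i) s).
  move=> s s01.
  have -> : (fun s => \sum_i c i * sval (F i) s) = \sum_i (fun s => c i * sval (F i) s).
    by apply/funext => u; rewrite fct_sumE.
  by apply: is_derive_sum => i; apply: is_deriveZ; exact: (svalP (F i)).
rewrite (intgP D) -sumrB; apply: eq_bigr => i _; rewrite -mulrBr.
by rewrite (intgP (svalP (F i))).
Qed.

Lemma intg_le e C phi (B : R) : 0 < e -> 0 <= C -> hoelder01 e C phi ->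
  (forall s, 0 <= s <= 1 -> `|phi s| <= B) -> `|intg phi| <= B.
Proof.
move=> e0 C0 H HB; have [F HF] := intg_ex e0 C0 H; rewrite (intgP HF).
have i0 : 0 <= (0 : R) <= 1 by rewrite lexx ler01.
have i1 : 0 <= (1 : R) <= 1 by rewrite lexx ler01.
have [c bc ->] := mvt_unit i0 i1 HF; rewrite subr0 mulr1; apply: HB.
by move: bc; rewrite /between; lra.
Qed.

(** Left Riemann sums. For [phi s = G (S s z)] they are averages of dilated copies of [G], to which
    the bounds of the class apply term by term. *)
Definition riemann phi N : R := N.+1%:R^-1 * \sum_(k < N.+1) phi (k%:R / N.+1%:R).

Lemma riemann_node N (k : nat) : (k <= N)%N -> 0 <= (k%:R / N%:R : R) <= 1.
Proof.
move=> kN; rewrite divr_ge0 //=; case: N kN => [|N] kN; first by rewrite invr0 mulr0.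
by rewrite ler_pdivrMr // mul1r ler_nat.
Qed.

(** On each cell the increment of an antiderivative is a value of [phi] times the length of the
    cell; the Hoelder modulus compares that value with the one at the left node. *)
Lemma riemann_cvg e C phi : 0 < e -> 0 <= C -> hoelder01 e C phi ->
  riemann phi N @[N --> \oo] --> intg phi.
Proof.
move=> e0 C0 H; have [F HF] := intg_ex e0 C0 H; rewrite (intgP HF).
have B N : `|F 1 - F 0 - riemann phi N| <= C * (N.+1%:R^-1) `^ e.
  pose a (k : nat) : R := k%:R / N.+1%:R.
  have N0 : (0 : R) < N.+1%:R by [].
  have -> : F 1 - F 0 = \sum_(k < N.+1) (F (a k.+1) - F (a k)).
    rewrite -(big_mkord xpredT (fun k => F (a k.+1) - F (a k))).
    by rewrite (telescope_sumr (fun k => F (a k))) // /a mul0r divff ?lt0r_neq0.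
  rewrite /riemann mulr_sumr -sumrB.
  have T (k : 'I_N.+1) : `|F (a k.+1) - F (a k) - N.+1%:R^-1 * phi (a k)| <=
      N.+1%:R^-1 * (C * (N.+1%:R^-1) `^ e).
    have a0 : 0 <= a k <= 1 by apply: riemann_node; exact: ltnW.
    have a1 : 0 <= a k.+1 <= 1 by apply: riemann_node.
    have aE : a k.+1 - a k = N.+1%:R^-1 by rewrite /a -mulrBl -natr1 addrAC subrr add0r mul1r.
    have Ni : 0 < N.+1%:R^-1 :> R by rewrite invr_gt0.
    have [c bc ->] := mvt_unit a0 a1 HF; rewrite aE [N.+1%:R^-1 * phi _]mulrC -mulrBl normrM.
    rewrite mulrC (ger0_norm (ltW Ni)) ler_wpM2l ?(ltW Ni) //.
    have c01 : 0 <= c <= 1 by move: bc; rewrite /between; lra.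
    apply: (le_trans (H _ _ c01 a0)); apply: ler_wpM2l => //; apply: ler_powR_base => //.
      exact: ltW.
    by move: bc aE Ni; rewrite /between ler_norml; move: (a k) (a k.+1) (_^-1) => u v w; lra.
  apply: (le_trans (sum_norm_le T)); rewrite mulrA mulfV ?mul1r // lt0r_neq0.
apply/cvgrPdist_le => eps eps0; have [d d0 Hd] := powR_small e0 C0 eps0.
have := @cvg_harmonic R; move=> /cvgr0_norm_le H1.
near=> N; apply: (le_trans (B N)); apply: Hd; first by rewrite invr_ge0.
have : `|harmonic N| <= d by near: N; exact: H1 d0.
by rewrite /harmonic /= ger0_norm // invr_ge0.
Unshelve. all: by end_near. Qed.

End UnitIntegral.

Section UnitIntegralSub.
Context {R : realType}.

Lemma hoelder01_sub (e C1 C2 : R) (phi psi : R -> R) : hoelder01 e C1 phi -> hoelder01 e C2 psi ->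
  hoelder01 e (C1 + C2) (fun s => phi s - psi s).
Proof.
move=> H1 H2 s u s01 u01; rewrite [leRHS]mulrDl.
have -> : phi s - psi s - (phi u - psi u) = (phi s - phi u) + (psi u - psi s) by ring.
apply: (le_trans (ler_normD _ _)); rewrite (distrC (psi u)).
by apply: lerD; [exact: H1|exact: H2].
Qed.

Lemma intg_sub (e C : R) (phi psi : R -> R) : 0 < e -> 0 <= C ->
  hoelder01 e C phi -> hoelder01 e C psi ->
  intg (fun s => phi s - psi s) = intg phi - intg psi.
Proof.
move=> e0 C0 H1 H2.
have [F HF] := intg_ex e0 C0 H1; have [G HG] := intg_ex e0 C0 H2.
rewrite (intgP HF) (intgP HG) (@intgP _ _ (F \- G)) /=; first by lra.
move=> s s01; have [Fd Fe] := HF _ s01; have [Gd Ge] := HG _ s01.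
by apply: DeriveDef; [exact: derivableB|rewrite [LHS]deriveB // Ge Fe].
Qed.

Lemma hoelder01_lin (e : R) m (c C : 'I_m -> R) (phi : 'I_m -> R -> R) :
  (forall i, hoelder01 e (C i) (phi i)) ->
  hoelder01 e (\sum_i `|c i| * C i) (fun s => \sum_i c i * phi i s).
Proof.
move=> H s u s01 u01; rewrite -sumrB mulr_suml.
apply: (le_trans (ler_norm_sum _ _ _)); apply: ler_sum => i _.
by rewrite -mulrBr normrM -mulrA; apply: ler_wpM2l => //; exact: H.
Qed.

End UnitIntegralSub.

(** * Integrals along partial dilations *)

Section RadialIntegral.
Context {R : realType} {n : nat} (t : tower R) (T : pred 'I_n).
Variable O : set 'rV[R]_n.
Hypotheses (gO : good_domain O) (O_le1 : forall x, O x -> `|x| <= 1)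
  (OS : forall s x, 0 <= s <= 1 -> O x -> O (pscale T s x)).
Implicit Types (x y z : 'rV[R]_n) (G : 'rV[R]_n -> R).
Local Notation e := (tw_exp t).
Local Notation S := (pscale T).

Definition rint G z : R := intg (fun s => G (S s z)).

Lemma pscale_dist (s u : R) z : `|S s z - S u z| <= `|s - u| * `|z|.
Proof.
apply: normr_rV_le => [|i]; first by rewrite mulr_ge0.
rewrite !mxE; case: ifP => _; last by rewrite subrr normr0 mulr_ge0.
rewrite -mulrBl normrM; apply: ler_wpM2l => //; exact: normr_coord.
Qed.

Lemma hoelder01_path k K G z : 0 <= K -> hzb t k O K G -> O z ->
  hoelder01 e (n.+1%:R ^+ k * K) (fun s => G (S s z)).
Proof.
move=> K0 HG Oz s u s01 u01; have [_ H _] : hzb t 0 O (n.+1%:R ^+ k * K) G.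
  by apply: hzb_down_ge => //; rewrite addn0.
apply: (le_trans (H _ _ (OS s01 Oz) (OS u01 Oz))).
apply: ler_wpM2l; first by rewrite mulr_ge0.
apply: ler_powR_base => //; first exact: ltW (tw_exp_gt0 t).
apply: (le_trans (pscale_dist _ _ _)); rewrite -[leRHS]mulr1; apply: ler_wpM2l => //.
exact: O_le1.
Qed.

Lemma hoelder01_mul (phi : R -> R) (C B : R) : 0 <= B -> hoelder01 e C phi ->
  (forall s, 0 <= s <= 1 -> `|phi s| <= B) ->
  hoelder01 e (C + B) (fun s => s * phi s).
Proof.
move=> B0 H HB s u s01 u01.
have -> : s * phi s - u * phi u = s * (phi s - phi u) + (s - u) * phi u by ring.
apply: (le_trans (ler_normD _ _)); rewrite !normrM [leRHS]mulrDl.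
have su : `|s - u| <= `|s - u| `^ e by apply: powR_le_self => //; rewrite ler_norml; lra.
apply: lerD.
  have s1 : `|s| <= 1 by rewrite ger0_norm; lra.
  rewrite -[leRHS]mul1r; apply: ler_pM => //; exact: H.
by rewrite mulrC; apply: ler_pM => //; exact: HB.
Qed.

Definition sfactor (i : 'I_n) (s : R) := if T i then s else 1.

Lemma hoelder01_sfactor k K G z i : 0 <= K -> hzb t k O K G -> O z ->
  hoelder01 e (n.+1%:R ^+ k * K + K) (fun s => sfactor i s * G (S s z)).
Proof.
move=> K0 HG Oz; have H := hoelder01_path K0 HG Oz; rewrite /sfactor; case: (T i).
  apply: (hoelder01_mul K0 H) => s s01; exact: (hzb_bound HG (OS s01 Oz)).
move=> s u s01 u01; rewrite !mul1r; apply: (le_trans (H _ _ s01 u01)).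
by apply: ler_wpM2r; rewrite ?powR_ge0 // lerDl.
Qed.

Lemma rint_cvg k K G z : 0 <= K -> hzb t k O K G -> O z ->
  riemann (fun s => G (S s z)) N @[N --> \oo] --> rint G z.
Proof.
move=> K0 HG Oz; apply: riemann_cvg (hoelder01_path K0 HG Oz).
  exact: tw_exp_gt0.
by rewrite mulr_ge0.
Qed.

Lemma hzb_riemann k K G N : 0 <= K -> hzb t k O K G ->
  hzb t k O K (fun z => riemann (fun s => G (S s z)) N).
Proof.
move=> K0 HG; have [oO bO dO] := gO.
have -> : K = `|N.+1%:R^-1| * (N.+1%:R * K) by rewrite ger0_norm ?mulKf // invr_ge0.
apply: hzb_scale => //; apply: hzb_sum => // i.
have i01 : 0 <= (i%:R / N.+1%:R : R) <= 1 by apply: riemann_node; exact: ltnW.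
exact: (hzb_pscale gO K0 i01 (fun x => OS i01) HG).
Qed.

(** The averages approximating the integral all satisfy the bound [K] of [G], and the bound passes
    to pointwise limits. No theorem on differentiation of parameter integrals is involved. *)
Lemma hzb_rint k K G : 0 <= K -> hzb t k O K G -> hzb t k O K (rint G).
Proof.
move=> K0 HG.
apply: (hzb_lim gO K0 (F := fun N z => riemann (fun s => G (S s z)) N)) => [N|z Oz].
  exact: hzb_riemann.
exact: rint_cvg HG Oz.
Qed.

(** The derivatives of the Riemann sums are themselves Riemann sums, of the differentiated
    integrand; by [hzb_lim_derive] they converge to the derivative of the limit. The factor
    [sfactor] is the derivative of the dilation in direction [i]. *)
Lemma derive_rint k K G z i : 0 <= K -> hzb t k.+1 O K G -> O z ->
  'D_(basis_vec i) (rint G) z =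
    intg (fun s => sfactor i s * 'D_(basis_vec i) G (S s z)).
Proof.
move=> K0 HG Oz; have [oO bO dO] := gO.
have [_ L] := hzb_lim_derive i gO K0 (fun N => hzb_riemann N K0 HG)
   (fun y => rint_cvg K0 HG) Oz.
have DE N : 'D_(basis_vec i) (fun z => riemann (fun s => G (S s z)) N) z =
    riemann (fun s => sfactor i s * 'D_(basis_vec i) G (S s z)) N.
  have D (k0 : 'I_N.+1) : is_derive z (basis_vec i) (fun z => G (S (k0%:R / N.+1%:R) z))
     (sfactor i (k0%:R / N.+1%:R) * 'D_(basis_vec i) G (S (k0%:R / N.+1%:R) z)).
    apply: derive_pscale HG _ => //; apply: OS => //; apply: riemann_node; exact: ltnW.
  have [D1 E1] := is_derive_sum D.
  have -> : (fun z => riemann (fun s => G (S s z)) N) =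
     N.+1%:R^-1 *: (\sum_(k0 < N.+1) (fun z => G (S (k0%:R / N.+1%:R) z))).
    by apply/funext => w; rewrite /riemann /GRing.scale /= fct_sumE.
  by rewrite deriveZ // E1.
have {}L : riemann (fun s => sfactor i s * 'D_(basis_vec i) G (S s z)) N @[N --> \oo] -->
    'D_(basis_vec i) (rint G) z.
  by have := L; under eq_fun do rewrite DE.
have [_ _ F3] := HG.
have C0 : 0 <= n.+1%:R ^+ k * K + K by rewrite addr_ge0 // mulr_ge0.
have L' := riemann_cvg (tw_exp_gt0 t) C0 (hoelder01_sfactor i K0 (F3 i) Oz).
exact: (cvg_unique _ L L').
Qed.

Lemma derive_path k K G z (s : R) : 0 <= K -> hzb t k.+1 O K G -> O z -> 0 <= s <= 1 ->
  is_derive s 1 (fun s => G (S s z)) (\sum_(i | T i) z 0 i * 'D_(basis_vec i) G (S s z)).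
Proof.
move=> K0 HG Oz s01.
pose v : 'rV[R]_n := \row_i (if T i then z 0 i else 0).
have SE u : S u z = u *: v + S 0 z.
  apply/rowP => i; rewrite !mxE; case: (T i); first by rewrite mul0r addr0.
  by rewrite mulr0 add0r.
have [df dfE] := hzb_differentiable gO K0 (OS s01 Oz) HG.
have -> : (fun s => G (S s z)) = (fun u => G (u *: v + S 0 z)).
  by apply/funext => u; rewrite SE.
have D : derivable G (s *: v + S 0 z) v by rewrite -SE; exact: diff_derivable.
apply: (is_derive_eq (is_derive_line D)); rewrite -SE deriveE // dfE.
rewrite [RHS]big_mkcond; apply: eq_bigr => i _; rewrite mxE; case: ifP => // _.
by rewrite mul0r.
Qed.

(** Integrate the derivative of [s * G (S s z)] from 0 to 1: the product rule gives the radial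
    average and a radial derivative with weight [s]. *)
Lemma rint_ftc k K G z : 0 <= K -> hzb t k.+1 O K G -> O z ->
  G z = rint G z + \sum_(i | T i) z 0 i * intg (fun s => s * 'D_(basis_vec i) G (S s z)).
Proof.
move=> K0 HG Oz; have [_ _ F3] := HG.
have C0 : 0 <= n.+1%:R ^+ k * K + K by rewrite addr_ge0 // mulr_ge0.
have e0 := tw_exp_gt0 t.
pose phi (o : option 'I_n) s := if o is Some i then s * 'D_(basis_vec i) G (S s z)
   else G (S s z).
pose P s := G (S s z) + \sum_(i | T i) z 0 i * (s * 'D_(basis_vec i) G (S s z)).
have HA : antiderivative P (fun s => s * G (S s z)).
  move=> s s01; have D1 := derive_path K0 HG Oz s01.
  have -> : (fun s => s * G (S s z)) = id * (fun s => G (S s z)) by [].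
  apply: (is_derive_eq (is_deriveM (is_derive_id s (1 : R)) D1)); rewrite /P addrC.
  congr (_ + _); first by rewrite [LHS]mulr1.
  by rewrite scaler_sumr; apply: eq_bigr => i _; rewrite mulrCA.
have := intgP HA; rewrite mul1r mul0r subr0 pscale1 => <-.
(* Index 0 carries the term [G (S s z)] and the successors carry the partial derivatives, so that
   linearity of [intg] applies to one sum of [n.+1] terms. *)
pose c (i : 'I_n.+1) : R := if unlift ord0 i is Some j then (if T j then z 0 j else 0) else 1.
pose f (i : 'I_n.+1) s : R := if unlift ord0 i is Some j then s * 'D_(basis_vec j) G (S s z)
  else G (S s z).
have C1 : 0 <= n.+1%:R ^+ k.+1 * K + (n.+1%:R ^+ k * K + K).
  by rewrite addr_ge0 // mulr_ge0.
have Hf i : hoelder01 e (n.+1%:R ^+ k.+1 * K + (n.+1%:R ^+ k * K + K)) (f i).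
  rewrite /f; case: unliftP => [j _|_] s u s01 u01.
    have Hj : hoelder01 e (n.+1%:R ^+ k * K + K) (fun s => s * 'D_(basis_vec j) G (S s z)).
      apply: (hoelder01_mul K0 (hoelder01_path K0 (F3 j) Oz)) => w w01.
      exact: (hzb_bound (F3 j) (OS w01 Oz)).
    apply: (le_trans (Hj _ _ s01 u01)); apply: ler_wpM2r; first exact: powR_ge0.
    by rewrite lerDr mulr_ge0.
  apply: (le_trans (hoelder01_path K0 HG Oz s01 u01)); apply: ler_wpM2r; first exact: powR_ge0.
  by rewrite lerDl.
have fl i : f (lift ord0 i) = (fun s => s * 'D_(basis_vec i) G (S s z)) by rewrite /f liftK.
have f0 : f ord0 = (fun s => G (S s z)) by rewrite /f unlift_none.
have c0 : c ord0 = 1 by rewrite /c unlift_none.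
have cl i : c (lift ord0 i) = if T i then z 0 i else 0 by rewrite /c liftK.
have PE : P = (fun s => \sum_(i < n.+1) c i * f i s).
  apply/funext => s; rewrite /P big_ord_recl f0 c0 mul1r; congr (_ + _).
  rewrite big_mkcond; apply: eq_bigr => i _; rewrite fl cl; case: ifP => // _.
  by rewrite mul0r.
rewrite PE (intg_lin c e0 (fun=> C1) Hf) big_ord_recl c0 f0 mul1r; congr (_ + _).
rewrite [RHS]big_mkcond; apply: eq_bigr => i _; rewrite cl fl.
by case: ifP => // _; rewrite mul0r.
Qed.

End RadialIntegral.

(** * The combined flow of commuting fields *)

Section RadialFlow.
Context {R : realType} {n : nat} (t : tower R) (T : pred 'I_n) (k : nat).
Variables (s K : R) (X : 'I_n -> 'rV[R]_n -> 'rV[R]_n).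
Hypotheses (s0 : 0 < s) (s2 : s <= 2^-1) (K0 : 0 <= K).
Local Notation O2 := (ball (0 : 'rV[R]_n) s).
Local Notation O1 := (ball (0 : 'rV[R]_n) (s / 2)).
Local Notation S := (pscale T).
Hypothesis (HX : forall i l, hzb t k.+1 O2 K (fun x => X i x 0 l)).
Implicit Types (x y z w : 'rV[R]_n).

Let gO2 : good_domain O2. Proof. exact: good_ball. Qed.
Let gO1 : good_domain O1. Proof. by apply: good_ball; move: s0 s2; lra. Qed.
Let O1_le1 x : O1 x -> `|x| <= 1. Proof. by move=> /ball0P; move: s0 s2; lra. Qed.
Let O1S u x : 0 <= u <= 1 -> O1 x -> O1 (S u x). Proof. exact: pscale_ball. Qed.

Lemma hzb_sum_cond L (f : 'I_n -> 'rV[R]_n -> R) : 0 <= L ->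
  (forall i, hzb t k.+1 O1 L (f i)) ->
  hzb t k.+1 O1 (n%:R * L) (fun x => \sum_(i | T i) f i x).
Proof.
move=> L0 Hf; have [oO bO _] := gO1.
apply: (@hzb_ext _ _ _ _ _ _ (fun x => \sum_i (if T i then f i x else 0))) => //.
  by move=> x _; rewrite -big_mkcond.
by apply: hzb_sum => // i; case: (T i) => //; apply: hzb_cst => //; rewrite normr0.
Qed.

(* [Phi z] is the point reached at time 1 from [S 0 z] by the flow of
   [ep * \sum_i z_i X_i]: at time s this flow is at [Phi (S s z)]. *)
Lemma flow_exists : exists ep L (Phi : 'rV[R]_n -> 'rV[R]_n),
  [/\ 0 < ep <= 1, ep * (n%:R * (n%:R * K)) <= 2^-1,
      0 <= L /\ forall l, hzb t k.+1 O1 L (fun x => Phi x 0 l),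
      forall z, O1 z -> O2 (Phi z) &
      forall z l, O1 z -> Phi z 0 l = S 0 z 0 l +
        \sum_(i | T i) z 0 i * (ep * rint T (fun w => X i (Phi w) 0 l) z)].
Proof.
move: (s0) (s2) (K0) => s_gt0 s_le2 K_ge0.
have [oO1 bO1 dO1] := gO1; have [oO2 bO2 dO2] := gO2.
pose L := s / 4 + 1; have L0 : 0 <= L by rewrite /L; lra.
have [M M0 HM] := hzb_comp t k.+1 gO1 gO2 K0 L0.
have [M2 M20 HM2] := hzb_prod t k.+1 gO1 ler01 M0.
pose B := n%:R * M2 + n%:R * (n%:R * K).
have nM0 : 0 <= n%:R * M2 by rewrite mulr_ge0.
have nnK0 : 0 <= n%:R * (n%:R * K) by rewrite !mulr_ge0.
have B1 : 0 < B + 1 by rewrite ltr_wpDl // addr_ge0.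
(* Of the two summands of [B], the first keeps the correction within [s / 4] in the class; the
   second gives contraction by 1/2 in the sup norm, and later the halving of the defects. *)
pose ep := Num.min (s / 4 / (B + 1)) 1.
have ep0 : 0 < ep by rewrite lt_min !divr_gt0 //=.
have epB : ep * (B + 1) <= s / 4.
  have : ep <= s / 4 / (B + 1) by rewrite /ep ge_min lexx.
  by rewrite ler_pdivlMr.
have epM : ep * (n%:R * M2) <= s / 4.
  apply: le_trans epB; rewrite ler_wpM2l ?(ltW ep0) // /B; lra.
have epK : ep * (n%:R * (n%:R * K)) <= 2^-1.
  apply: (@le_trans _ _ (s / 4)); last lra.
  apply: le_trans epB; rewrite ler_wpM2l ?(ltW ep0) // /B; lra.
(* The unknown is the correction [psi] to the projection [S 0], which is small and for which the
   zero start of the iteration is admissible. *)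
pose Q (psi : 'rV[R]_n -> 'rV[R]_n) z : 'rV[R]_n :=
  \row_l (ep * \sum_(i | T i) z 0 i * rint T (fun w => X i (S 0 w + psi w) 0 l) z).
pose A (psi : 'rV[R]_n -> 'rV[R]_n) := forall j, hzb t k.+1 O1 (s / 4) (fun x => psi x 0 j).
have Hc i : hzb t k.+1 O1 1 (fun x => x 0 i) by exact: hzb_coord.
have i0 : 0 <= (0 : R) <= 1 by rewrite lexx ler01.
have Aid psi : A psi -> forall j, hzb t k.+1 O1 L (fun x => (S 0 x + psi x) 0 j).
  move=> Ap j; rewrite /L addrC.
  apply: (@hzb_ext _ _ _ _ _ _ ((fun x => S 0 x 0 j) \+ (fun x => psi x 0 j))) => //.
    by move=> x _; rewrite /= !mxE.
  apply: hzb_add => //; exact: (hzb_pscale gO1 ler01 i0 (fun x => O1S i0) (Hc j)).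
have psi_le psi x : A psi -> O1 x -> `|psi x| <= s / 4.
  by move=> Ap Ox; apply: normr_rV_le => [|j]; [lra|exact: (hzb_bound (Ap j) Ox)].
have psiO psi x : A psi -> O1 x -> O2 (S 0 x + psi x).
  move=> Ap Ox; apply/ball0P; move/ball0P : (O1S i0 Ox) => xs.
  have := ler_normD (S 0 x) (psi x); have := psi_le _ _ Ap Ox; lra.
have s4 : 0 <= s / 4 by lra.
have HG psi i l : A psi -> hzb t k.+1 O1 M (fun w => X i (S 0 w + psi w) 0 l).
  move=> Ap; apply: (HM (fun x => X i x 0 l) (fun w => S 0 w + psi w) (HX i l)).
    by move=> j; rewrite (maxn_idPl (ltn0Sn k)); exact: Aid.
  by move=> x; exact: psiO.
have AQ psi : A psi -> A (Q psi).
  move=> Ap l.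
  apply: (@hzb_ext _ _ _ _ _ _ (fun z => ep * \sum_(i | T i) z 0 i * rint T (fun w => X i (S 0 w + psi w) 0 l) z)) => //.
    by move=> x _; rewrite mxE.
  apply: (@hzb_le _ _ _ _ _ (`|ep| * (n%:R * M2))); first by rewrite (ger0_norm (ltW ep0)).
  apply: hzb_scale => //; apply: hzb_sum_cond => // i.
  exact: (HM2 _ _ (Hc i) (hzb_rint gO1 O1_le1 O1S M0 (HG psi i l Ap))).
have e0 := tw_exp_gt0 t.
have CQ psi1 psi2 c : A psi1 -> A psi2 -> 0 <= c ->
     (forall x, O1 x -> `|psi1 x - psi2 x| <= c) ->
     forall x, O1 x -> `|Q psi1 x - Q psi2 x| <= c / 2.
  move=> A1 A2 c0 H x Ox; apply: normr_rV_le => [|l]; first by rewrite divr_ge0.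
  rewrite !mxE -mulrBr -sumrB.
  have C0 : 0 <= n.+1%:R ^+ k.+1 * M by rewrite mulr_ge0.
  have P i : `|(if T i then x 0 i * rint T (fun w => X i (S 0 w + psi1 w) 0 l) x -
     x 0 i * rint T (fun w => X i (S 0 w + psi2 w) 0 l) x else 0)| <= n%:R * K * c.
    have nKc : 0 <= n%:R * K * c by rewrite !mulr_ge0.
    case: (T i); last by rewrite normr0.
    rewrite -mulrBr normrM -[leRHS]mul1r; apply: ler_pM => //.
      exact: le_trans (normr_coord _ _) (O1_le1 Ox).
    have H1 := hoelder01_path gO1 O1_le1 O1S M0 (HG psi1 i l A1) Ox.
    have H2 := hoelder01_path gO1 O1_le1 O1S M0 (HG psi2 i l A2) Ox.
    rewrite /rint -(intg_sub e0 C0 H1 H2).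
    apply: (intg_le e0 (addr_ge0 C0 C0) (hoelder01_sub H1 H2)) => u u01.
    have Ou := O1S u01 Ox.
    apply: (le_trans (hzb_lipschitz gO2 (HX i l) (psiO _ _ A1 Ou) (psiO _ _ A2 Ou))).
    apply: ler_wpM2l; first by rewrite mulr_ge0.
    by rewrite opprD addrACA subrr add0r; exact: H.
  rewrite normrM big_mkcond (ger0_norm (ltW ep0)).
  apply: (@le_trans _ _ (ep * (n%:R * (n%:R * K * c)))).
    by rewrite ler_wpM2l ?(ltW ep0) //; exact: sum_norm_le.
  have : ep * (n%:R * (n%:R * K)) * c <= 2^-1 * c by rewrite ler_wpM2r.
  rewrite !mulrA; lra.
have [psi Ap Qp] := hzb_fixpoint (T := Q) gO1 s4 AQ CQ.
exists ep, L, (fun z => S 0 z + psi z); split => //.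
- by rewrite ep0 /ep ge_min lexx orbT.
- by split => //; exact: Aid.
- by move=> z; exact: psiO.
- move=> z l Oz; rewrite [LHS]mxE; congr (_ + _).
  have -> : psi z 0 l = Q psi z 0 l by rewrite Qp.
  rewrite mxE mulr_sumr; apply: eq_bigr => i _.
  by rewrite mulrCA.
Qed.

Hypothesis X_commute : forall i j l x, O2 x ->
  \sum_a X i x 0 a * 'D_(basis_vec a) (fun x => X j x 0 l) x =
  \sum_a X j x 0 a * 'D_(basis_vec a) (fun x => X i x 0 l) x.

(* By commutation the defects [d_j Phi - ep * X_j (Phi)] are radial integrals of
   linear expressions in the defects themselves, so that a bound for them can be
   halved indefinitely. *)
Lemma flow_partials ep L (Phi : 'rV[R]_n -> 'rV[R]_n) :
  0 < ep <= 1 -> ep * (n%:R * (n%:R * K)) <= 2^-1 -> 0 <= L ->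
  (forall l, hzb t k.+1 O1 L (fun x => Phi x 0 l)) ->
  (forall z, O1 z -> O2 (Phi z)) ->
  (forall z l, O1 z -> Phi z 0 l = S 0 z 0 l +
     \sum_(i | T i) z 0 i * (ep * rint T (fun w => X i (Phi w) 0 l) z)) ->
  (forall j l z, T j -> O1 z ->
     'D_(basis_vec j) (fun z => Phi z 0 l) z = ep * X j (Phi z) 0 l) /\
  (forall j l, ~~ T j -> 'D_(basis_vec j) (fun z => Phi z 0 l) 0 = (j == l)%:R).
Proof.
move=> ep01 epK L0 HPhi PhiO PhiE.
have [oO1 bO1 dO1] := gO1; have [oO2 bO2 dO2] := gO2.
have e0 := tw_exp_gt0 t.
have ep0 : 0 < ep by case/andP: ep01.
have [M M0 HM] := hzb_comp t k.+1 gO1 gO2 K0 L0.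
pose G i l w := X i (Phi w) 0 l.
have HG i l : hzb t k.+1 O1 M (G i l).
  exact: (HM (fun x => X i x 0 l) Phi (HX i l) HPhi PhiO).
have HDG i l j : hzb t k O1 M ('D_(basis_vec j) (G i l)) by case: (HG i l) => _ _; exact.
pose a j i l z := intg (fun s => s * 'D_(basis_vec j) (G i l) (S s z)).
have Hrint i l := hzb_rint gO1 O1_le1 O1S M0 (HG i l).
have dPhi z j l : O1 z -> is_derive z (basis_vec j) (fun z => Phi z 0 l)
   ((if T j then 0 else 1) * (j == l)%:R + \sum_(i | T i)
     ((j == i)%:R * (ep * rint T (G i l) z) + z 0 i * (ep * 'D_(basis_vec j) (rint T (G i l)) z))).
  move=> Oz.
  pose h i z : R := if T i then z 0 i * (ep * rint T (G i l) z) else 0.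
  have Dh i : is_derive z (basis_vec j) (h i) (if T i then
     ((j == i)%:R * (ep * rint T (G i l) z) + z 0 i * (ep * 'D_(basis_vec j) (rint T (G i l)) z)) else 0).
    rewrite /h; case: (T i); last exact: is_derive_cst.
    have Dr : is_derive z (basis_vec j) (rint T (G i l)) ('D_(basis_vec j) (rint T (G i l)) z).
      by apply: derivableP; have [_ H _] := Hrint i l; exact: H.
    apply: (is_derive_eq (is_deriveM (derive_coord j i z) (is_deriveZ ep Dr))).
    by rewrite addrC [X in X + _]mulrC.
  rewrite big_mkcond.
  apply: (@near_eq_is_derive _ _ _ ((fun z => S 0 z 0 l) + \sum_i h i)); last first.
    exact: (is_deriveD (derivable_pscale_coord T 0 z j l) (is_derive_sum Dh)).
  have : nbhs z O1 by exact: open_nbhs_nbhs.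
  apply: filterS => w Ow; rewrite PhiE // [in RHS]big_mkcond.
  by congr (_ + _); rewrite fct_sumE.
have dPhiT z j l : O1 z -> T j -> 'D_(basis_vec j) (fun z => Phi z 0 l) z =
    ep * rint T (G j l) z + \sum_(i | T i) z 0 i * (ep * a j i l z).
  move=> Oz Tj; have [_ ->] := dPhi z j l Oz.
  rewrite Tj mul0r add0r big_split /=; congr (_ + _).
    rewrite (bigD1 j) //= eqxx mul1r big1 ?addr0 // => i /andP[_ ij].
    by rewrite eq_sym (negbTE ij) mul0r.
  apply: eq_bigr => i _; congr (_ * (_ * _)).
  rewrite (derive_rint gO1 O1_le1 O1S _ M0 (HG i l) Oz) /a /sfactor Tj //.
split; last first.
  move=> j l Tj; have O0 : O1 0 by apply/ball0P; rewrite normr0; move: s0; lra.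
  have [_ ->] := dPhi 0 j l O0.
  rewrite (negbTE Tj) mul1r big1 ?addr0 // => i Ti.
  rewrite mxE mul0r addr0 (_ : (j == i) = false) ?mul0r //.
  by apply/eqP => ji; move: Tj; rewrite ji Ti.
pose D j l z := 'D_(basis_vec j) (fun z => Phi z 0 l) z - ep * G j l z.
(* [rint_ftc] replaces [G j l z] by its radial average, which cancels the average in [dPhiT]. What
   remains is a sum of terms antisymmetric in [i] and [j]. *)
have DE j l z : T j -> O1 z ->
    D j l z = ep * \sum_(i | T i) z 0 i * (a j i l z - a i j l z).
  move=> Tj Oz; rewrite /D (dPhiT _ _ _ Oz Tj).
  have -> : G j l z = rint T (G j l) z + \sum_(i | T i) z 0 i * a i j l z.
    by have F := rint_ftc gO1 O1_le1 O1S M0 (HG j l) Oz; refine F.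
  have alg (u v w : R) : ep * u + v - ep * (u + w) = v - ep * w by ring.
  rewrite alg.
  rewrite !mulr_sumr -sumrB; apply: eq_bigr => i _.
  by move: (a j i l z) (a i j l z) (z 0 i) => u v w; ring.
(* By antisymmetry the defects have no component along the ray: there [Phi] follows the flow
   exactly. *)
have Euler l z : O1 z -> \sum_(j | T j) z 0 j * D j l z = 0.
  move=> Oz.
  rewrite (eq_bigr (fun j => \sum_(i | T i) ep * z 0 j * z 0 i * a j i l z -
      \sum_(i | T i) ep * z 0 j * z 0 i * a i j l z)); last first.
    move=> j Tj; rewrite DE // mulr_sumr mulr_sumr -sumrB; apply: eq_bigr => i _.
    by move: (a j i l z) (a i j l z) (z 0 i) (z 0 j) => u v w w'; ring.
  rewrite sumrB [X in _ - X]exchange_big /=; apply/eqP; rewrite subr_eq0; apply/eqP.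
  apply: eq_bigr => j _; apply: eq_bigr => i _.
  by rewrite [_ * z 0 i * z 0 j]mulrAC.
pose C := n.+1%:R ^+ k * M + M.
have C0 : 0 <= C by rewrite addr_ge0 // mulr_ge0.
(* The difference of integrals is rewritten as a single integral because the cancellations take
   place pointwise under it. *)
pose I j l z u := \sum_(i | T i) S u z 0 i *
  ('D_(basis_vec j) (G i l) (S u z) - 'D_(basis_vec i) (G j l) (S u z)).
have Hs i j0 l z : O1 z ->
    hoelder01 (tw_exp t) C (fun s => s * 'D_(basis_vec j0) (G i l) (S s z)).
  move=> Oz; apply: (hoelder01_mul M0 (hoelder01_path gO1 O1_le1 O1S M0 (HDG i l j0) Oz)) => u u01.
  exact: (hzb_bound (HDG i l j0) (O1S u01 Oz)).
have IE j l z : I j l z = (fun u => \sum_i (if T i then z 0 i else 0) *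
     (u * 'D_(basis_vec j) (G i l) (S u z) - u * 'D_(basis_vec i) (G j l) (S u z))).
  apply/funext => u; rewrite /I big_mkcond; apply: eq_bigr => i _.
  case: ifP => Ti; last by rewrite mul0r.
  by rewrite mxE Ti; ring.
have IH j l z : O1 z -> exists2 C', 0 <= C' & hoelder01 (tw_exp t) C' (I j l z).
  move=> Oz; rewrite IE.
  have H := hoelder01_lin (fun i => if T i then z 0 i else 0)
     (fun i => hoelder01_sub (Hs i j l z Oz) (Hs j i l z Oz)).
  by eexists; last exact: H; apply: sumr_ge0 => i _; rewrite mulr_ge0 // addr_ge0.
have Dint j l z : T j -> O1 z -> D j l z = ep * intg (I j l z).
  move=> Tj Oz; rewrite DE //; congr (_ * _).
  rewrite IE (intg_lin (fun i => if T i then z 0 i else 0) e0 (fun=> addr_ge0 C0 C0)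
     (fun i => hoelder01_sub (Hs i j l z Oz) (Hs j i l z Oz))).
  rewrite big_mkcond /=; apply: eq_bigr => i _; case: (T i); last by rewrite mul0r.
  by rewrite (intg_sub e0 C0 (Hs i j l z Oz) (Hs j i l z Oz)).
(* The chain rule brings in the derivatives of [Phi], each equal to a defect plus [ep * G]. The
   defects in the radial derivative vanish by [Euler], and the [ep * G] parts cancel because the
   fields commute; only terms linear in the defects of index [j] survive. *)
have integrand j l w : T j -> O1 w -> \sum_(i | T i)
    w 0 i * ('D_(basis_vec j) (G i l) w - 'D_(basis_vec i) (G j l) w) =
  \sum_(i | T i) w 0 i * \sum_b 'D_(basis_vec b) (fun x => X i x 0 l) (Phi w) * D j b w.
  move=> Tj Ow.
  have dG i j0 : 'D_(basis_vec j0) (G i l) w = \sum_b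
      'D_(basis_vec b) (fun x => X i x 0 l) (Phi w) * 'D_(basis_vec j0) (fun z => Phi z 0 b) w.
    have [df dfE] := hzb_differentiable gO2 K0 (PhiO _ Ow) (HX i l).
    have dP b : derivable (fun z => Phi z 0 b) w (basis_vec j0) by have [_ H _] := HPhi b; exact: H.
    by have [_ ->] := is_derive_comp_rV df dfE dP.
  have dPE j0 b : 'D_(basis_vec j0) (fun z => Phi z 0 b) w = D j0 b w + ep * G j0 b w.
    by rewrite /D subrK.
  have Eul : \sum_(i | T i) w 0 i * 'D_(basis_vec i) (G j l) w =
      \sum_(i | T i) w 0 i * \sum_b 'D_(basis_vec b) (fun x => X j x 0 l) (Phi w) * (ep * G i b w).
    transitivity (\sum_b 'D_(basis_vec b) (fun x => X j x 0 l) (Phi w) *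
       \sum_(i | T i) w 0 i * (D i b w + ep * G i b w)).
      under eq_bigr do rewrite dG mulr_sumr.
      rewrite exchange_big /=; apply: eq_bigr => b _; rewrite mulr_sumr; apply: eq_bigr => i _.
      by rewrite dPE mulrCA.
    under [RHS]eq_bigr do rewrite mulr_sumr.
    rewrite [RHS]exchange_big /=; apply: eq_bigr => b _.
    under eq_bigr do rewrite mulrDr; rewrite big_split /= Euler // add0r mulr_sumr.
    by apply: eq_bigr => i _; rewrite mulrCA.
  under eq_bigr do rewrite mulrBr; rewrite sumrB Eul -sumrB; apply: eq_bigr => i _.
  rewrite -mulrBr; congr (_ * _); rewrite dG -sumrB.
  have XC := X_commute j i l (PhiO _ Ow).
  under eq_bigr do rewrite dPE mulrDr -addrA.
  rewrite big_split /= -[RHS]addr0; congr (_ + _).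
  rewrite sumrB; apply/eqP; rewrite subr_eq0; apply/eqP.
  have flip i0 j0 : \sum_b 'D_(basis_vec b) (fun x => X i0 x 0 l) (Phi w) * (ep * G j0 b w) =
     ep * \sum_b X j0 (Phi w) 0 b * 'D_(basis_vec b) (fun x => X i0 x 0 l) (Phi w).
    by rewrite mulr_sumr; apply: eq_bigr => b _; rewrite /G; ring.
  by rewrite !flip XC.
(* The integral is at most [n * (n * K * B)], and [epK] makes this times [ep] at most [B / 2]. *)
have half B : 0 <= B -> (forall j l z, T j -> O1 z -> `|D j l z| <= B) ->
    forall j l z, T j -> O1 z -> `|D j l z| <= B / 2.
  move=> B0 HB j l z Tj Oz; rewrite Dint // normrM (ger0_norm (ltW ep0)).
  have [C' C'0 HC'] := IH j l z Oz.
  have B1 : `|intg (I j l z)| <= n%:R * (n%:R * K * B).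
    apply: (intg_le e0 C'0 HC') => u u01; have Ou := O1S u01 Oz.
    rewrite /I integrand // big_mkcond; apply: sum_norm_le => i.
    have nKB : 0 <= n%:R * K * B by rewrite !mulr_ge0.
    case: (T i); last by rewrite normr0.
    rewrite normrM -[leRHS]mul1r; apply: ler_pM => //.
      exact: le_trans (normr_coord _ _) (O1_le1 Ou).
    rewrite -mulrA; apply: sum_norm_le => b; rewrite normrM; apply: ler_pM => //.
      by have [_ _ H] := HX i l; exact: (hzb_bound (H b) (PhiO _ Ou)).
    exact: HB.
  apply: (@le_trans _ _ (ep * (n%:R * (n%:R * K * B)))); first by rewrite ler_wpM2l ?(ltW ep0).
  have : ep * (n%:R * (n%:R * K)) * B <= 2^-1 * B by rewrite ler_wpM2r.
  rewrite !mulrA; lra.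
pose B := L + ep * M.
have B0 : 0 <= B by rewrite addr_ge0 // mulr_ge0 // ltW.
have Dsmall N : forall j l z, T j -> O1 z -> `|D j l z| <= B * 2^-1 ^+ N.
  elim: N => [|N IHN] j l z Tj Oz.
    rewrite mulr1 /D; apply: (le_trans (ler_normB _ _)); apply: lerD.
      by have [_ _ H] := HPhi l; exact: (hzb_bound (H j) Oz).
    rewrite normrM (ger0_norm (ltW ep0)) ler_wpM2l ?(ltW ep0) //.
    exact: (hzb_bound (HG j l) Oz).
  rewrite exprSr mulrA; apply: (half _ _ IHN) => //.
  by rewrite mulr_ge0 // exprn_ge0.
move=> j l z Tj Oz; apply/eqP; rewrite -subr_eq0 -normr_le0 -/(D j l z).
have Lim : (B * 2^-1 ^+ N @[N --> \oo] --> B * 0)%classic.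
  by apply: cvgMr; apply: cvg_expr; rewrite ger0_norm; lra.
rewrite mulr0 in Lim.
by apply: (ler_cvg_to (cvg_cst `|D j l z|) Lim); near=> N; exact: Dsmall.
Unshelve. all: by end_near. Qed.

End RadialFlow.

Lemma differentiable_rVP {R : realType} {U : normedModType R} n (g : U -> 'rV[R]_n) x :
  (forall j, differentiable (fun z => g z 0 j) x) -> differentiable g x.
Proof.
move=> H; have -> : g = \sum_j (fun z => g z 0 j *: (basis_vec j : 'rV[R]_n)).
  apply/funext => z; rewrite fct_sumE; exact: row_sum_delta.
by apply: differentiable_sum => j; apply: differentiableZl; exact: H.
Qed.

(** * Straightening a commuting family *)

Section FrobeniusLocal.
Context {R : realType} {n : nat} (t : tower R) (T : pred 'I_n) (k : nat).
Implicit Types (x y z w : 'rV[R]_n).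

Lemma chain_rV k' (O1 O2 : set 'rV[R]_n) (K L : R) (f : 'rV[R]_n -> R) (g : 'rV[R]_n -> 'rV[R]_n) x i :
  good_domain O2 -> 0 <= K -> hzb t k.+1 O2 K f -> (forall j, hzb t k'.+1 O1 L (fun x => g x 0 j)) ->
  O1 x -> O2 (g x) -> is_derive x (basis_vec i) (fun z => f (g z))
    (\sum_j 'D_(basis_vec j) f (g x) * 'D_(basis_vec i) (fun z => g z 0 j) x).
Proof.
move=> gO2 K0 Hf Hg Ox Ogx; have [df dfE] := hzb_differentiable gO2 K0 Ogx Hf.
by apply: (is_derive_comp_rV df dfE) => j; have [_ H _] := Hg j; exact: H.
Qed.

(** The partial derivatives of [Phi] in the directions of [T] carry the factor [ep]. Dilating these
    directions by [ep^-1] gives a map [P] whose partial derivatives are [X j] along [P] and whose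
    Jacobian matrix at 0 is the identity. [H] is its local inverse, and differentiating
    [H (P z) = z] gives the last claim. *)
Theorem frobenius_local (s K : R) (X : 'I_n -> 'rV[R]_n -> 'rV[R]_n) :
  0 < s -> s <= 2^-1 -> 0 <= K ->
  (forall i l, hzb t k.+1 (ball 0 s) K (fun x => X i x 0 l)) ->
  (forall i j l x, ball 0 s x ->
     \sum_a X i x 0 a * 'D_(basis_vec a) (fun x => X j x 0 l) x =
     \sum_a X j x 0 a * 'D_(basis_vec a) (fun x => X i x 0 l) x) ->
  (forall i, T i -> X i 0 = basis_vec i) ->
  exists rho L (H : 'rV[R]_n -> 'rV[R]_n),
  [/\ 0 < rho <= 2^-1, 0 <= L /\ forall l, hzb t k.+1 (ball 0 rho) L (fun x => H x 0 l),
      H 0 = 0, forall i l, 'D_(basis_vec i) (fun x => H x 0 l) 0 = (i == l)%:R &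
      forall w j l, ball 0 rho w -> T j ->
        \sum_a X j w 0 a * 'D_(basis_vec a) (fun x => H x 0 l) w = (j == l)%:R].
Proof.
move=> s0 s2 K0 HX Xc X0.
have [ep [L [Phi [ep01 epK [L0 HPhi] PhiO PhiE]]]] := flow_exists T s0 s2 K0 HX.
have [DT DN] := flow_partials s0 s2 K0 HX Xc ep01 epK L0 HPhi PhiO PhiE.
have /andP[ep0 ep1] := ep01; have epn0 : ep != 0 by rewrite lt0r_neq0.
pose r := ep * (s / 2); have r0 : 0 < r by rewrite mulr_gt0 // divr_gt0.
have r2 : r <= 2^-1 by apply: (@le_trans _ _ (s / 2)); [rewrite ler_piMl //; lra|lra].
have gO1 : good_domain (ball (0 : 'rV[R]_n) (s / 2)) by apply: good_ball; lra.
have gO : good_domain (ball (0 : 'rV[R]_n) r) by exact: good_ball.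
have [oO bO _] := gO.
pose E := pscale T ep^-1 : 'rV[R]_n -> 'rV[R]_n.
have EO z : ball 0 r z -> ball 0 (s / 2) (E z).
  move=> /ball0P zr; apply/ball0P; apply: (@le_lt_trans _ _ (ep^-1 * `|z|)); last first.
    by rewrite ltr_pdivrMl.
  apply: normr_rV_le => [|i]; first by rewrite mulr_ge0 // invr_ge0 ltW.
  rewrite mxE; case: ifP => _.
    by rewrite normrM ger0_norm ?invr_ge0 ?(ltW ep0) // ler_wpM2l ?invr_ge0 ?(ltW ep0) // normr_coord.
  apply: (le_trans (normr_coord _ _)); rewrite ler_peMl // invf_ge1 //.
have HE i : hzb t k.+1 (ball 0 r) ep^-1 (fun z => E z 0 i).
  have r_le1 x : ball 0 r x -> `|x| <= 1 by move=> /ball0P; lra.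
  pose c := if T i then ep^-1 else 1 : R.
  apply: (@hzb_ext _ _ _ _ _ _ (fun x => c * x 0 i)) => //.
    by move=> x _; rewrite mxE /c; case: ifP; rewrite ?mul1r.
  have := hzb_linear_coord t k.+1 c i gO r_le1; apply: hzb_le.
  rewrite /c; case: (T i); first by rewrite ger0_norm // invr_ge0 ltW.
  by rewrite normr1 invf_ge1.
have i0 : 0 <= ep^-1 by rewrite invr_ge0 ltW.
pose P z := Phi (E z).
have [L1 L10 HL1] := hzb_comp t k.+1 gO gO1 L0 i0.
have HP l : hzb t k.+1 (ball 0 r) L1 (fun z => P z 0 l).
  exact: (HL1 (fun z => Phi z 0 l) E (HPhi l) HE EO).
have DP z j l : ball 0 r z -> 'D_(basis_vec j) (fun z => P z 0 l) z =
    (if T j then ep^-1 else 1) * 'D_(basis_vec j) (fun z => Phi z 0 l) (E z).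
  by move=> /EO Oz; have [_ ->] := derive_pscale j gO1 L0 (HPhi l) Oz.
have DPT z j l : ball 0 r z -> T j -> 'D_(basis_vec j) (fun z => P z 0 l) z = X j (P z) 0 l.
  by move=> Oz Tj; rewrite DP // Tj DT ?mulKf //; exact: EO.
have b0 (c : R) : 0 < c -> ball (0 : 'rV[R]_n) c 0 by move=> c0; apply/ball0P; rewrite normr0.
have E0 : E 0 = 0 by exact: pscale_0.
have Phi0 : Phi 0 = 0.
  apply/rowP => l; rewrite PhiE; last by apply: b0; lra.
  rewrite pscale_0 big1; first by rewrite addr0.
  by move=> i _; rewrite mxE mul0r.
have P0 : P 0 = 0 by rewrite /P E0.
have DP0 j l : 'D_(basis_vec j) (fun z => P z 0 l) 0 = (j == l)%:R.
  have [Tj|Tj] := boolP (T j).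
    by rewrite DPT ?P0 ?X0 ?mxE ?eqxx 1?eq_sym //; exact: b0.
  by rewrite DP ?(negbTE Tj) ?mul1r ?E0 ?DN //; exact: b0.
have [r1 [rho [L' [H [r1r rho2 inj HH HP']]]]] := local_inverse r0 r2 L10 HP P0 DP0.
have [/andP[r10 r1_le] /andP[rho0 rho_le]] := (r1r, rho2).
have gOr : good_domain (ball (0 : 'rV[R]_n) rho) by exact: good_ball.
have [oOr _ _] := gOr.
have H0 : H 0 = 0.
  have [h1 h2] := HP' 0 (b0 _ rho0); apply: (inj _ _ h1 (b0 _ r10)).
  by rewrite h2 P0.
have L'0 (l : 'I_n) : 0 <= L' by have := hzb_ge0 (HH l) (b0 _ rho0).
have sub1 : ball (0 : 'rV[R]_n) r1 `<=` ball 0 r by exact: subset_ball0.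
(* The inverse theorem gives [P (H w) = w]; the other composite [H (P w) = w], needed near [z],
   follows from injectivity of [P] on the ball of radius [r1]. *)
have chain z j l : ball 0 r1 z -> ball 0 rho (P z) ->
    \sum_a 'D_(basis_vec a) (fun x => H x 0 l) (P z) *
       'D_(basis_vec j) (fun z => P z 0 a) z = (j == l)%:R.
  move=> Oz OPz.
  have [_ <-] := chain_rV (k' := k) j gOr (L'0 l) (HH l) HP (sub1 _ Oz) OPz.
  have [_ <-] := derive_coord j l z.
  apply: near_eq_derive.
  have n1 : nbhs z (ball 0 r1) by apply: open_nbhs_nbhs; split => //; exact: ball_open.
  have cP : {for z, continuous P}.
    apply: differentiable_continuous; apply: differentiable_rVP => a.
    by have [] := hzb_differentiable gO L10 (sub1 _ Oz) (HP a).
  have n2 : nbhs z (P @^-1` (ball 0 rho)).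
    by apply: cP; exact: open_nbhs_nbhs.
  near=> w.
  have w1 : ball 0 r1 w by near: w.
  have w2 : ball 0 rho (P w) by near: w.
  have [h1 h2] := HP' _ w2.
  by rewrite (inj _ _ h1 w1 h2).
exists rho, (Num.max 0 L'), H; split => //.
- split; first by rewrite le_max lexx.
  by move=> l; apply: hzb_le (HH l); rewrite le_max lexx orbT.
- move=> i l; have := chain 0 i l (b0 _ r10); rewrite P0 => /(_ (b0 _ rho0)) <-.
  rewrite (bigD1 i) //= DP0 eqxx mulr1 big1 ?addr0 // => a ai.
  by rewrite DP0 eq_sym (negbTE ai) mulr0.
- move=> w j l Ow Tj; have [h1 h2] := HP' _ Ow.
  have := chain (H w) j l h1; rewrite h2 => /(_ Ow) <-.
  apply: eq_bigr => a _; rewrite DPT ?h2 1?mulrC //; exact: sub1.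
Unshelve. all: by end_near. Qed.

End FrobeniusLocal.

(** * Hoelder-Zygmund germs *)

Section Levels.
Context {R : realType}.
Implicit Types (alpha : R) (t : tower R).

(** An integer [alpha] uses [alpha - 1] derivatives and the Zygmund condition, and then leaves
    [tw_exp t] free; otherwise [tw_exp t] is the fractional part. *)
Definition level alpha t (k : nat) : Prop :=
  alpha = k%:R + (if tw_zyg t then 1 else tw_exp t).

(** [theta] asks for a large auxiliary exponent in the Zygmund case, which is needed when an integer
    class is compared with a slightly lower Hoelder class. *)
Lemma level_exists alpha (theta : R) : 0 < alpha -> theta < 1 ->
  exists t k, level alpha t k /\ (tw_zyg t -> theta <= tw_exp t).
Proof.
move=> a0 th1.
have [k [ka ak]] : exists k : nat, k%:R < alpha /\ alpha <= k.+1%:R.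
  have [N] : exists N : nat, alpha <= N.+1%:R.
    by exists (Num.trunc alpha); have /andP[_ /ltW] := truncn_itv (ltW a0).
  elim: N => [|N IH] aN; first by exists 0%N.
  have [/IH//|h] := leP alpha N.+1%:R; by exists N.+1.
have [aE|an] := eqVneq alpha k.+1%:R.
  pose ex := Num.max (2 / 3) (Num.max theta (2 / 3)) : R.
  have e01 : 0 < ex < 1.
    by rewrite /ex !lt_max !gt_max th1; apply/andP; split; [apply/orP; left; lra|apply/and3P; split=> //; lra].
  have ez : true -> 2 / 3 <= ex by rewrite /ex le_max lexx.
  exists (Tower e01 ez), k; split; first by rewrite /level /= aE natr1.
  by move=> _ /=; rewrite /ex !le_max lexx /= orbT.
have e01 : 0 < alpha - k%:R < 1.
  have : alpha < k.+1%:R by rewrite lt_neqAle an.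
  rewrite -natr1; lra.
have ez : false -> 2 / 3 <= alpha - k%:R by [].
by exists (Tower e01 ez), k; split => //; rewrite /level /= addrC subrK.
Qed.

(** The increment along [v] is half the increment along [2 *: v], up to half a second difference.
    Each doubling thus gains the factor [2 ^ e / 2 < 1], and after finitely many doublings the
    length reaches [rho], where the sup bound applies. The radius [4 * rho] leaves room for the
    doubled points. *)
Lemma zygmund_hoelder n e (x0 : 'rV[R]_n) (rho B C : R) : 0 < e < 1 -> 0 < rho ->
  4 * rho <= 1 -> 0 <= B -> 0 <= C ->
  exists2 A, 0 <= A & forall f : 'rV[R]_n -> R,
    (forall x, ball x0 (4 * rho) x -> `|f x| <= B) ->
    (forall x y, ball x0 (4 * rho) x -> ball x0 (4 * rho) y ->
      `|f x + f y - 2 * f (2^-1 *: (x + y))| <= C * `|x - y|) ->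
    forall x y, ball x0 rho x -> ball x0 rho y -> `|f x - f y| <= A * `|x - y| `^ e.
Proof.
move=> /andP[e0 e1] r0 r1 B0 C0.
have two_e : 2 `^ e < 2 :> R.
  rewrite -ltr_ln ?posrE ?powR_gt0 // ln_powR gtr_pMl //.
  by apply: ln_gt0; lra.
have re0 : 0 < rho `^ e by exact: powR_gt0.
(* [g] is the gain per doubling. In the constant below, [2 * B / rho ^ e] settles lengths at least
   [rho], and [C / g] absorbs the second difference at each halving. *)
pose g := 1 - 2 `^ e / 2 : R; have g0 : 0 < g by rewrite /g; lra.
exists (2 * B / rho `^ e + C / g).
  by rewrite addr_ge0 ?divr_ge0 ?mulr_ge0 // ltW.
set A := _ + _ => f fB fC x y /ball_rVP xr /ball_rVP yr.
have A1 : 2 * B <= A * rho `^ e.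
  have -> : A * rho `^ e = 2 * B + C / g * rho `^ e.
    by rewrite /A [LHS]mulrDl; congr (_ + _); rewrite divfK // lt0r_neq0.
  by rewrite lerDl mulr_ge0 // ?divr_ge0 // ltW.
have A2 : C <= A * g.
  have -> : A * g = 2 * B / rho `^ e * g + C.
    by rewrite /A [LHS]mulrDl; congr (_ + _); rewrite divfK // lt0r_neq0.
  by rewrite lerDr mulr_ge0 // ?divr_ge0 ?mulr_ge0 // ltW.
have A0 : 0 <= A by rewrite addr_ge0 ?divr_ge0 ?mulr_ge0 // ltW.
have xh v : `|v| < 3 * rho -> ball x0 (4 * rho) (x + v).
  move=> vr; apply/ball_rVP; rewrite opprD addrA.
  have := ler_normB (x0 - x) v; lra.
have claim j : forall v : 'rV[R]_n, `|v| < 2 * rho -> rho / 2 ^+ j <= `|v| ->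
    `|f (x + v) - f x| <= A * `|v| `^ e.
  elim: j => [|j IH] v v2 vj.
    rewrite expr0 divr1 in vj.
    apply: (@le_trans _ _ (2 * B)).
      apply: (le_trans (ler_normB _ _)).
      have b1 : `|f (x + v)| <= B by apply: fB; apply: xh; lra.
      have b2 : `|f x| <= B by apply: fB; apply/ball_rVP; lra.
      lra.
    apply: (le_trans A1); rewrite ler_wpM2l //; apply: ler_powR_base => //; exact: ltW.
  have [h|h] := leP rho `|v|; first by apply: IH => //; apply: le_trans h; rewrite ler_piMr ?(ltW r0) // invf_le1 ?exprn_gt0 // exprn_ege1 // ler1n.
  have n2 : `|2 *: v| = 2 * `|v| by rewrite normrZ ger0_norm.
  have v2' : `|2 *: v| < 2 * rho by rewrite n2; lra.
  have vj' : rho / 2 ^+ j <= `|2 *: v|.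
    rewrite n2; move: vj; rewrite exprS invfM; lra.
  have := IH _ v2' vj'; rewrite n2 powRM //.
  have O1 : ball x0 (4 * rho) x by apply/ball_rVP; lra.
  have O2 : ball x0 (4 * rho) (x + 2 *: v) by apply: xh; lra.
  have := fC _ _ O1 O2.
  have -> : 2^-1 *: (x + (x + 2 *: v)) = x + v by apply/rowP => i; rewrite !mxE; lra.
  rewrite opprD addrA subrr sub0r normrN n2.
  have ve : `|v| <= `|v| `^ e.
    have [->|vn0] := eqVneq `|v| 0; first exact: powR_ge0.
    apply: ger1_powR; last exact: ltW.
    by rewrite lt_neqAle eq_sym vn0 normr_ge0; lra.
  have p0 : 0 <= `|v| `^ e by exact: powR_ge0.
  have Cv : C * `|v| <= A * g * `|v| `^ e by apply: ler_pM.
  move=> h1 h2.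
  have -> : f (x + v) - f x = 2^-1 * ((f (x + 2 *: v) - f x) - (f x + f (x + 2 *: v) - 2 * f (x + v))) by lra.
  rewrite normrM ger0_norm //.
  have := ler_normB (f (x + 2 *: v) - f x) (f x + f (x + 2 *: v) - 2 * f (x + v)).
  have e1' : A * (2 `^ e * `|v| `^ e) = A * `|v| `^ e * 2 `^ e by rewrite [2 `^ e * _]mulrC mulrA.
  have e2' : A * g * `|v| `^ e = A * `|v| `^ e - 2^-1 * (A * `|v| `^ e * 2 `^ e) by rewrite /g; field.
  rewrite e1' in h2; rewrite e2' in Cv.
  move: h1 h2 Cv; move: (A * `|v| `^ e) => u; move: (u * 2 `^ e) => w; lra.
have [->|xyn0] := eqVneq x y; first by rewrite !subrr !normr0 mulr_ge0 // powR_ge0.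
have n0 : 0 < `|y - x| by rewrite normr_gt0 subr_eq0 eq_sym.
have v2 : `|y - x| < 2 * rho.
  have -> : y - x = (x0 - x) - (x0 - y) by apply/rowP => i; rewrite !mxE; ring.
  have := ler_normB (x0 - x) (x0 - y); lra.
have [j] : exists j, rho / 2 ^+ j <= `|y - x|.
  have : (rho * 2^-1 ^+ N @[N --> \oo] --> rho * 0)%classic.
    by apply: cvgMr; apply: cvg_expr; rewrite ger0_norm; lra.
  rewrite mulr0 => /cvgn_dist /(_ n0)[N HN]; exists N.
  have := HN N (leqnn _); rewrite sub0r normrN ger0_norm ?exprVn //.
  by rewrite mulr_ge0 ?exprn_ge0 // ltW.
by move=> /(claim j _ v2); rewrite [x + (y - x)]addrC subrK (distrC (f y)) (distrC y).
Qed.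

End Levels.

(** * Comparison of the classes with explicit bounds *)

Section HZClasses.
Context {R : realType} {n : nat}.
Implicit Types (x y : 'rV[R]_n) (O : set 'rV[R]_n) (f g : 'rV[R]_n -> R) (alpha : R).

Lemma bounded_fun_bound O f : [bounded f x | x in O] ->
  exists2 B, 0 <= B & forall x, O x -> `|f x| <= B.
Proof.
move=> /pinfty_ex_gt0[B B0 HB]; exists B; first exact: ltW.
by move=> x Ox; exact: HB.
Qed.

Lemma HZ_bounded alpha O f : HZ alpha O f ->
  exists2 B, 0 <= B & forall x, O x -> `|f x| <= B.
Proof.
elim => {alpha f} [alpha f _ [[bf _] _]|f [[bf _] _]|//]; exact: bounded_fun_bound bf.
Qed.

Lemma ball_sub_ball x y (a b : R) : `|x - y| + b <= a -> ball y b `<=` ball x a.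
Proof.
move=> h z /ball_rVP yz; apply/ball_rVP.
have -> : x - z = (x - y) + (y - z) by rewrite addrA subrK.
by have := ler_normD (x - y) (y - z); lra.
Qed.

(** The loss from radius [4 * rho] to [rho] pays for extracting the auxiliary Hoelder modulus from
    the Zygmund condition. The radius does not depend on [alpha]. *)
Lemma HZ_hzb alpha t k O f x (rho : R) : level alpha t k -> 0 < rho -> 4 * rho <= 1 ->
  ball x (4 * rho) `<=` O -> HZ alpha O f ->
  exists2 K, 0 <= K & hzb t k (ball x rho) K f.
Proof.
move=> lv r0 r4 BO H; have B1 : ball x rho `<=` O.
  by apply: subset_trans BO; apply: ball_sub_ball; rewrite subrr normr0; lra.
have [oB bB dB] : good_domain (ball x rho) by apply: good_ball; lra.
have e0 := tw_exp_gt0 t; have e1 := tw_exp_lt1 t.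
have lt1 : tw_zyg t = false \/ tw_zyg t = true by case: (tw_zyg t); [right|left].
elim: H k lv => {alpha f} [alpha f a01 [[bf cf] [C HC]]|f [[bf cf] [C HC]]|alpha f a1 Hf IHf df Hdf IHdf] k.
- rewrite /level; case: lt1 => tz; rewrite tz => aE; last first.
    by exfalso; have : (0 : R) <= k%:R by []; lra.
  have k0 : k = 0%N.
    by case: k aE => // k aE; exfalso; have : (0 : R) <= k%:R by []; move: aE; rewrite -natr1; lra.
  move: aE; rewrite k0 add0r => aE.
  have [B B0 HB] := bounded_fun_bound bf.
  exists (Num.max B C); first by rewrite le_max B0.
  split; last by rewrite tz.
  - by move=> y /B1/HB h; rewrite le_max h.
  - move=> y z /B1 Oy /B1 Oz.
    have [->|yz] := eqVneq y z.
      by rewrite !subrr !normr0 mulr_ge0 ?powR_ge0 // le_max B0.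
    have := HC _ _ Oy Oz yz; rewrite aE powRN => h.
    have p0 : 0 < `|y - z| `^ tw_exp t by rewrite powR_gt0 // normr_gt0 subr_eq0.
    move: h; rewrite mulrC ler_pdivrMr // => h; apply: (le_trans h).
    by apply: ler_wpM2r; rewrite ?(ltW p0) // le_max lexx orbT.
- rewrite /level; case: lt1 => tz; rewrite tz => aE; first last.
    have k0 : k = 0%N by apply/eqP; rewrite -(eqr_nat R); apply/eqP; lra.
    rewrite k0.
    have [B B0 HB] := bounded_fun_bound bf.
    have C20 : 0 <= 2 * Num.max 0 C by rewrite mulr_ge0 // le_max lexx.
    have Z y z : ball x (4 * rho) y -> ball x (4 * rho) z ->
      `|f y + f z - 2 * f (2^-1 *: (y + z))| <= 2 * Num.max 0 C * `|y - z|.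
      move=> /BO Oy /BO Oz; have [->|yz] := eqVneq y z.
        have -> : 2^-1 *: (z + z) = z by apply/rowP => i; rewrite !mxE; lra.
        by rewrite subrr normr0 mulr0 (_ : f z + f z - 2 * f z = 0) ?normr0 //; lra.
      have := HC _ _ Oy Oz yz.
      have p0 : 0 < `|y - z| by rewrite normr_gt0 subr_eq0.
      rewrite ler_pdivrMl // => h.
      have -> : f y + f z - 2 * f (2^-1 *: (y + z)) =
        2 * ((f y + f z) / 2 - f (2^-1 *: (y + z))) by lra.
      rewrite normrM (ger0_norm (_ : 0 <= 2)) // -mulrA ler_wpM2l //.
      by apply: (le_trans h); rewrite mulrC ler_wpM2r // le_max lexx orbT.
    have [A A0 HA] := @zygmund_hoelder R n (tw_exp t) x rho B (2 * Num.max 0 C)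
       (tw_exp01 t) r0 r4 B0 C20.
    exists (B + A + 2 * Num.max 0 C); first by rewrite !addr_ge0.
    split.
    - by move=> y /B1/HB h; apply: (le_trans h); rewrite -addrA lerDl addr_ge0.
    - move=> y z Oy Oz; apply: le_trans (HA _ _ Z _ _ Oy Oz) _ => [w /BO/HB//|].
      by apply: ler_wpM2r; rewrite ?powR_ge0 // addrAC lerDr addr_ge0.
    - move=> _ y z Oy Oz; apply: (@le_trans _ _ (2 * Num.max 0 C * `|y - z|)).
        apply: Z; [move: Oy|move: Oz]; apply: ball_sub_ball; rewrite subrr normr0; lra.
      by apply: ler_wpM2r => //; rewrite lerDr addr_ge0.
  case: k aE => [|k]; first by lra.
  by rewrite -natr1; have : (0 : R) <= k%:R by []; lra.
- move=> aE; have [B B0 HB] := HZ_bounded Hf.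
  case: k aE => [|k] aE.
    by exfalso; move: aE; rewrite /level add0r; case: ifP => _; lra.
  have aE' : level (alpha - 1) t k by rewrite /level aE -natr1; lra.
  have HK i : {K | 0 <= K /\ hzb t k (ball x rho) K ('D_(basis_vec i) f)}.
    by apply: cid; have [K h1 h2] := IHdf i _ aE'; exists K.
  have S0 : 0 <= \sum_i sval (HK i) by apply: sumr_ge0 => i _; have [] := svalP (HK i).
  exists (B + \sum_i sval (HK i)); first by rewrite addr_ge0.
  split.
  - by move=> y /B1/HB h; apply: (le_trans h); rewrite lerDl.
  - by move=> i y /B1; exact: df.
  - move=> i; have [_] := svalP (HK i); apply: hzb_le.
    rewrite (bigD1 i) //= addrCA lerDl addr_ge0 // sumr_ge0 // => j _.
    by have [] := svalP (HK j).
Qed.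

Lemma hzb_HZ alpha t k O f (K : R) : level alpha t k -> good_domain O -> 0 <= K ->
  hzb t k O K f -> HZ alpha O f.
Proof.
move=> lv gO; have e0 := tw_exp_gt0 t; have e1 := tw_exp_lt1 t.
elim: k alpha f K lv => [|k IH] alpha f K lv K0 Hf; last first.
  have k1 : 1 < alpha.
    rewrite lv -natr1; have : (0 : R) <= k%:R by [].
    by case: ifP => _; lra.
  have lv' : level (alpha - 1) t k by rewrite /level lv -natr1; lra.
  apply: HZ_step => //.
  - apply: (IH _ _ (n.+1%:R * K) lv'); first by rewrite mulr_ge0.
    exact: hzb_down.
  - by case: Hf => _ H _; exact: H.
  - by move=> i; case: Hf => _ _ H; exact: (IH _ _ K lv' K0 (H i)).
have bc : bounded_continuous O f.
  split.
    exists K; split; first exact: num_real.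
    move=> M KM x Ox; apply: (le_trans (hzb_bound Hf Ox)); exact: ltW.
  apply/continuous_in_subspaceT => x; rewrite inE => Ox; exact: hzb_continuous Hf.
move: lv; rewrite /level; case: ifP => tz; rewrite add0r => aE; rewrite aE; case: Hf => F1 F2 F3.
  apply: HZ_zygmund; split => //; exists (2^-1 * K) => x y Ox Oy xy.
  have p0 : 0 < `|x - y| by rewrite normr_gt0 subr_eq0.
  rewrite ler_pdivrMl //.
  have -> : (f x + f y) / 2 - f (2^-1 *: (x + y)) =
     2^-1 * (f x + f y - 2 * f (2^-1 *: (x + y))) by lra.
  rewrite normrM ger0_norm // [leRHS]mulrCA ler_wpM2l // [leRHS]mulrC; exact: F3.
apply: HZ_hoelder; first by rewrite e0 e1.
split => //; exists K => x y Ox Oy xy.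
have p0 : 0 < `|x - y| `^ tw_exp t by rewrite powR_gt0 // normr_gt0 subr_eq0.
by rewrite powRN mulrC ler_pdivrMr //; exact: F2.
Qed.

End HZClasses.

(** * Germs of Hoelder-Zygmund functions *)

Section LocalHZ.
Context {R : realType} {n : nat}.
Implicit Types (x y : 'rV[R]_n) (O : set 'rV[R]_n) (f g : 'rV[R]_n -> R) (alpha : R) (t : tower R).

Definition locHZ alpha f x := exists2 rho : R, 0 < rho & HZ alpha (ball x rho) f.

(** The quantitative form of [locHZ]. Closure properties of germs are proved by choosing a tower for
    [alpha], working with the bounds, and returning. *)
Definition locb t k f x := exists rho K : R,
  [/\ 0 < rho, rho <= 2^-1, 0 <= K & hzb t k (ball x rho) K f].

Lemma locHZ_locb alpha t k f x : level alpha t k -> locHZ alpha f x -> locb t k f x.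
Proof.
move=> lv [rho r0 H]; pose d := Num.min (rho / 4) (4^-1).
have d0 : 0 < d by rewrite lt_min !divr_gt0 //= invr_gt0.
have d1 : d <= rho / 4 by rewrite /d ge_min lexx.
have d2 : d <= 4^-1 by rewrite /d ge_min lexx orbT.
have [K K0 HK] : exists2 K, 0 <= K & hzb t k (ball x d) K f.
  apply: (HZ_hzb lv d0 _ _ H); first by lra.
  by apply: ball_sub_ball; rewrite subrr normr0; lra.
by exists d, K; split => //; lra.
Qed.

Lemma locb_locHZ alpha t k f x : level alpha t k -> locb t k f x -> locHZ alpha f x.
Proof.
move=> lv [rho [K [r0 r2 K0 H]]]; exists rho => //.
exact: hzb_HZ lv (good_ball _ r2) K0 H.
Qed.

Lemma locHZ_of_ball alpha O f x : open O -> O x -> HZ alpha O f -> 0 < alpha -> locHZ alpha f x.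
Proof.
move=> oO Ox H a0; have [t [k [lv _]]] := level_exists a0 ltr01.
have /nbhs_ballP[r /= r0 Hr] : nbhs x O by exact: open_nbhs_nbhs.
pose d := Num.min (r / 4) (4^-1).
have d0 : 0 < d by rewrite lt_min !divr_gt0 //= invr_gt0.
have d1 : d <= r / 4 by rewrite /d ge_min lexx.
have d2 : d <= 4^-1 by rewrite /d ge_min lexx orbT.
have [K K0 HK] : exists2 K, 0 <= K & hzb t k (ball x d) K f.
  apply: (HZ_hzb lv d0 _ _ H); first by lra.
  by apply: subset_trans Hr; apply: ball_sub_ball; rewrite subrr normr0; lra.
by apply: (locb_locHZ lv); exists d, K; split => //; lra.
Qed.

Lemma HZ_gt0 alpha O f : HZ alpha O f -> 0 < alpha.
Proof. by elim => {alpha f} [alpha f /andP[]//|//|alpha f a1 *]; exact: lt_trans a1. Qed.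

Lemma locHZ_gt0 alpha f x : locHZ alpha f x -> 0 < alpha.
Proof. by case=> rho _ /HZ_gt0. Qed.

Lemma locb_sub t k f x (r : R) : 0 < r -> locb t k f x -> exists rho K : R,
  [/\ 0 < rho, rho <= 2^-1, rho <= r, 0 <= K & hzb t k (ball x rho) K f].
Proof.
move=> r0 [rho [K [rho0 rho2 K0 H]]]; exists (Num.min rho r), K; split => //.
- by rewrite lt_min rho0.
- by rewrite ge_min rho2.
- by rewrite ge_min lexx orbT.
- by apply: hzb_sub H; apply: ball_sub_ball; rewrite subrr normr0 add0r ge_min lexx.
Qed.

Lemma locb_common t k m (f : 'I_m -> 'rV[R]_n -> R) x (r : R) : 0 < r ->
  (forall i, locb t k (f i) x) -> exists rho K : R,
  [/\ 0 < rho, rho <= 2^-1, rho <= r, 0 <= K & forall i, hzb t k (ball x rho) K (f i)].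
Proof.
move=> r0; elim: m f => [|m IH] f H.
  exists (Num.min r 2^-1), 0; rewrite lt_min r0 !ge_min !lexx orbT invr_gt0 ltr0n.
  by split => //; case.
have [rho [K [rho0 rho2 rhor K0 HK]]] := IH (fun i => f (lift ord0 i)) (fun i => H _).
have [d [L [d0 d2 dr L0 HL]]] := locb_sub rho0 (H ord0).
exists d, (K + L); split => //; first exact: le_trans rhor.
  by rewrite addr_ge0.
move=> i; case: (unliftP ord0 i) => [j|] ->; last by apply: hzb_le HL; rewrite lerDr.
have := HK j => /(hzb_sub (O' := ball x d)) h.
apply: hzb_le (h _); first by rewrite lerDl.
by apply: ball_sub_ball; rewrite subrr normr0 add0r.
Qed.

Lemma locb2 t k f g x : locb t k f x -> locb t k g x -> exists rho K : R,
  [/\ 0 < rho, rho <= 2^-1, 0 <= K, hzb t k (ball x rho) K f & hzb t k (ball x rho) K g].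
Proof.
move=> Hf Hg; pose h (i : 'I_2) := if i == ord0 then f else g.
have Hh i : locb t k (h i) x by rewrite /h; case: ifP.
have [rho [K [r0 r2 _ K0 HK]]] := locb_common ltr01 Hh.
exists rho, K; split => //; first by have := HK ord0.
by have := HK ord_max.
Qed.

Lemma locb_near t k f x : locb t k f x -> \forall y \near x, locb t k f y.
Proof.
move=> [rho [K [r0 r2 K0 H]]].
have : nbhs x (ball x (rho / 2)) by apply: nbhsx_ballx; rewrite divr_gt0.
apply: filterS => y /ball_rVP xy; exists (rho / 2), K; split => //; [lra|lra|].
by apply: hzb_sub H; apply: ball_sub_ball; lra.
Qed.

Lemma locHZ_near alpha f x : locHZ alpha f x -> \forall y \near x, locHZ alpha f y.
Proof.
move=> H; have [t [k [lv _]]] := level_exists (locHZ_gt0 H) ltr01.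
by apply: filterS (locb_near (locHZ_locb lv H)) => y; exact: locb_locHZ.
Qed.

Lemma locb_ext t k f g x : (\forall y \near x, f y = g y) -> locb t k f x -> locb t k g x.
Proof.
move=> /nbhs_ballP[r /= r0 fg] Hf.
have [rho [K [rho0 rho2 rhor K0 H]]] := locb_sub r0 Hf.
have [oB bB _] : good_domain (ball x rho) by exact: good_ball.
exists rho, K; split => //; apply: hzb_ext H => // y; rewrite inE => By.
by apply: fg; apply: (ball_sub_ball _ By); rewrite subrr normr0 add0r.
Qed.

Lemma locHZ_ext alpha f g x : (\forall y \near x, f y = g y) ->
  locHZ alpha f x -> locHZ alpha g x.
Proof.
move=> fg H; have [t [k [lv _]]] := level_exists (locHZ_gt0 H) ltr01.
exact: locb_locHZ lv (locb_ext fg (locHZ_locb lv H)).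
Qed.

Lemma locHZ_add alpha f g x : locHZ alpha f x -> locHZ alpha g x ->
  locHZ alpha (fun y => f y + g y) x.
Proof.
move=> Hf Hg; have [t [k [lv _]]] := level_exists (locHZ_gt0 Hf) ltr01.
have [rho [K [r0 r2 K0 h1 h2]]] := locb2 (locHZ_locb lv Hf) (locHZ_locb lv Hg).
have [oB bB _] : good_domain (ball x rho) by exact: good_ball.
apply: (locb_locHZ lv); exists rho, (K + K); split => //; first by rewrite addr_ge0.
exact: hzb_add.
Qed.

Lemma locHZ_mul alpha f g x : locHZ alpha f x -> locHZ alpha g x ->
  locHZ alpha (fun y => f y * g y) x.
Proof.
move=> Hf Hg; have [t [k [lv _]]] := level_exists (locHZ_gt0 Hf) ltr01.
have [rho [K [r0 r2 K0 h1 h2]]] := locb2 (locHZ_locb lv Hf) (locHZ_locb lv Hg).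
have [M M0 HM] := hzb_prod t k (good_ball x r2) K0 K0.
by apply: (locb_locHZ lv); exists rho, M; split => //; exact: HM.
Qed.

Lemma locHZ_cst alpha (c : R) x : 0 < alpha -> locHZ alpha (fun=> c) x.
Proof.
move=> a0; have [t [k [lv _]]] := level_exists a0 ltr01.
apply: (locb_locHZ lv); exists 2^-1, `|c|; split => //.
by apply: hzb_cst => //; exact: ball_open.
Qed.

Lemma locHZ_scale alpha (c : R) f x : locHZ alpha f x -> locHZ alpha (fun y => c * f y) x.
Proof. by move=> H; apply: locHZ_mul => //; apply: locHZ_cst; exact: locHZ_gt0 H. Qed.

Lemma locHZ_sum alpha (I : Type) (r : seq I) (P : pred I) (F : I -> 'rV[R]_n -> R) x :
  0 < alpha -> (forall i, P i -> locHZ alpha (F i) x) ->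
  locHZ alpha (fun y => \sum_(i <- r | P i) F i y) x.
Proof.
move=> a0 H; elim: r => [|i r IH].
  apply: (@locHZ_ext _ (fun=> 0)); last exact: locHZ_cst.
  by near=> y; rewrite big_nil.
apply: (@locHZ_ext _ (fun y => (if P i then F i y else 0) + \sum_(j <- r | P j) F j y)).
  by near=> y; rewrite big_cons; case: ifP; rewrite ?add0r.
apply: locHZ_add => //; case: (boolP (P i)) => [Pi|_]; [exact: H|exact: locHZ_cst].
Unshelve. all: by end_near. Qed.

Lemma locHZ_prod alpha (I : Type) (r : seq I) (P : pred I) (F : I -> 'rV[R]_n -> R) x :
  0 < alpha -> (forall i, P i -> locHZ alpha (F i) x) ->
  locHZ alpha (fun y => \prod_(i <- r | P i) F i y) x.
Proof.
move=> a0 H; elim: r => [|i r IH].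
  apply: (@locHZ_ext _ (fun=> 1)); last exact: locHZ_cst.
  by near=> y; rewrite big_nil.
apply: (@locHZ_ext _ (fun y => (if P i then F i y else 1) * \prod_(j <- r | P j) F j y)).
  by near=> y; rewrite big_cons; case: ifP; rewrite ?mul1r.
apply: locHZ_mul => //; case: (boolP (P i)) => [Pi|_]; [exact: H|exact: locHZ_cst].
Unshelve. all: by end_near. Qed.

Lemma locHZ_continuous alpha f x : locHZ alpha f x -> {for x, continuous f}.
Proof.
move=> H; have [t [k [lv _]]] := level_exists (locHZ_gt0 H) ltr01.
have [rho [K [r0 r2 K0 h]]] := locHZ_locb lv H.
apply: (hzb_continuous (good_ball x r2) K0 _ h); exact: ballxx.
Qed.

Lemma locHZ_inv alpha f x : locHZ alpha f x -> f x != 0 ->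
  locHZ alpha (fun y => (f y)^-1) x.
Proof.
move=> H fx; have cf := locHZ_continuous H.
have [t [k [lv _]]] := level_exists (locHZ_gt0 H) ltr01.
pose c := `|f x| / 2; have c0 : 0 < c by rewrite divr_gt0 // normr_gt0.
have /nbhs_ballP[r /= r0 Hr] : nbhs x [set y | c <= `|f y|].
  move/(@cvgrPdist_le _ _ _ (nbhs x)) : cf => /(_ _ c0); apply: filterS => y h.
  have : `|f x| <= `|f x - f y| + `|f y|.
    by rewrite -[X in `|X| <= _](subrK (f y)); exact: ler_normD.
  by move: h; rewrite /c /=; lra.
have [rho [K [rho0 rho2 rhor K0 HK]]] := locb_sub r0 (locHZ_locb lv H).
have [M M0 HM] := hzb_inv t k (good_ball x rho2) K0 c0.
apply: (locb_locHZ lv); exists rho, M; split => //; apply: HM => // y By.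
by apply: Hr; apply: (ball_sub_ball _ By); rewrite subrr normr0 add0r.
Qed.

Lemma locHZ_coord alpha i x : 0 < alpha -> locHZ alpha (fun y : 'rV[R]_n => y 0 i) x.
Proof.
move=> a0; have [t [k [lv _]]] := level_exists a0 ltr01.
have h2 : (2^-1 : R) <= 2^-1 by [].
apply: (locb_locHZ lv); exists 2^-1, (`|x| + 1); split; [by []|by []|by rewrite addr_ge0|].
apply: hzb_coord; [exact: good_ball|by rewrite lerDr|].
move=> y /ball_rVP xy; have -> : y = x - (x - y) by rewrite subKr.
have := ler_normB x (x - y); lra.
Qed.

Lemma level1 alpha t k : 1 < alpha -> level alpha t k -> (0 < k)%N.
Proof.
move=> a1; rewrite /level; case: k => // aE; exfalso; move: a1.
have := tw_exp_lt1 t; rewrite aE add0r; case: ifP => _; lra.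
Qed.

Lemma level_pred alpha t k : level alpha t k.+1 -> level (alpha - 1) t k.
Proof. by rewrite /level -natr1 => ->; lra. Qed.

Lemma level_succ alpha t k : level alpha t k -> level (alpha + 1) t k.+1.
Proof. by rewrite /level -natr1 => ->; lra. Qed.

Lemma locHZ_derive alpha f x i : 1 < alpha -> locHZ alpha f x ->
  locHZ (alpha - 1) ('D_(basis_vec i) f) x.
Proof.
move=> a1 H; have [t [k [lv _]]] := level_exists (locHZ_gt0 H) ltr01.
case: k lv => [/(level1 a1)//|k] lv.
have [rho [K [r0 r2 K0 [_ _ h]]]] := locHZ_locb lv H.
by apply: (locb_locHZ (level_pred lv)); exists rho, K; split=> //; exact: h.
Qed.

Lemma locHZ_differentiable alpha f x : 1 < alpha -> locHZ alpha f x ->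
  differentiable f x /\ forall v, 'd f x v = \sum_i v 0 i * 'D_(basis_vec i) f x.
Proof.
move=> a1 H; have [t [k [lv _]]] := level_exists (locHZ_gt0 H) ltr01.
case: k lv => [/(level1 a1)//|k] lv.
have [rho [K [r0 r2 K0 h]]] := locHZ_locb lv H.
apply: (hzb_differentiable (good_ball x r2) K0 _ h); exact: ballxx.
Qed.

Lemma locHZ_derivable alpha f x v : 1 < alpha -> locHZ alpha f x -> derivable f x v.
Proof. by move=> a1 /(locHZ_differentiable a1)[df _]; exact: diff_derivable. Qed.

Lemma hzb_lower t t' k k' O (K : R) f : good_domain O -> 0 <= K ->
  ((k' < k)%N \/ [/\ k' = k, tw_exp t' <= tw_exp t & tw_zyg t' -> tw_zyg t]) ->
  hzb t k O K f -> exists2 K', 0 <= K' & hzb t' k' O K' f.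
Proof.
move=> gO K0 [kk|[-> ee zz]].
  rewrite -(subnK kk); move: (k - k'.+1)%N => l h.
  have := hzb_down_ge gO K0 h; set K1 := _ * K => h'.
  have K10 : 0 <= K1 by rewrite mulr_ge0.
  by exists (n.+1%:R * K1); [rewrite mulr_ge0|exact: hzb_down_tower h'].
have [oO bO dO] := gO => Hf; exists K => //.
elim: k f Hf => [|k IH] f [F1 F2 F3]; split => //.
- move=> x y Ox Oy; apply: (le_trans (F2 _ _ Ox Oy)); apply: ler_wpM2l => //.
  have [->|xy] := eqVneq x y; first by rewrite subrr normr0 !powR0 // gt_eqF // tw_exp_gt0.
  apply: ger_powR => //; rewrite normr_gt0 subr_eq0 xy /=; exact: dO.
- by move=> /zz/F3.
- by move=> i; exact: IH (F3 i).
Qed.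

Lemma locHZ_le alpha alpha' f x : 0 < alpha' -> alpha' <= alpha ->
  locHZ alpha f x -> locHZ alpha' f x.
Proof.
move=> a0 aa H; have [t' [k' [lv' _]]] := level_exists a0 ltr01.
(* If [alpha] is an integer and [alpha'] lies less than 1 below it, both use the same [k]; the
   auxiliary exponent of [alpha] must then dominate the exponent of [alpha']. *)
have [t [k [lv te]]] := level_exists (locHZ_gt0 H) (tw_exp_lt1 t').
have [rho [K [r0 r2 K0 h]]] := locHZ_locb lv H.
have cmp : (k' < k)%N \/ [/\ k' = k, tw_exp t' <= tw_exp t & tw_zyg t' -> tw_zyg t].
  have e0 := tw_exp_gt0 t; have e1 := tw_exp_lt1 t.
  have e0' := tw_exp_gt0 t'; have e1' := tw_exp_lt1 t'.
  move: lv lv' aa te; rewrite /level => -> ->.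
  have [kk|kk|->] := ltngtP k' k; first by left.
    have : k.+1%:R <= k'%:R :> R by rewrite ler_nat.
    by rewrite -natr1; case: (tw_zyg t); case: (tw_zyg t') => *; exfalso; lra.
  by case: (tw_zyg t); case: (tw_zyg t') => h1 h2; right; split => //; try (exact: h2); lra.
have [K' K'0 h'] := hzb_lower (good_ball x r2) K0 cmp h.
by apply: (locb_locHZ lv'); exists rho, K'.
Qed.

End LocalHZ.

(** * Composition of germs, determinants and inverse matrices *)

Section LocalComposition.
Context {R : realType}.

Lemma near_ball_rV n p (g : 'rV[R]_p -> 'rV[R]_n) x (rho : R) : 0 < rho ->
  (forall j, {for x, continuous (fun y => g y 0 j)}) ->
  \forall y \near x, ball (g x) rho (g y).
Proof.
move=> r0 cg; have r2 : 0 < rho / 2 by rewrite divr_gt0.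
have : nbhs x [set y | forall j, `|g x 0 j - g y 0 j| <= rho / 2].
  apply: (@filter_forall _ _ _ (nbhs x) (nbhs_filter x)) => j.
  by move/(@cvgrPdist_le _ _ _ (nbhs x)) : (cg j) => /(_ _ r2).
apply: filterS => y h; apply/ball_rVP; apply: (@le_lt_trans _ _ (rho / 2)); last lra.
by apply: normr_rV_le => [|j]; [exact: ltW|rewrite !mxE; exact: h].
Qed.

Lemma locb_continuous n t k (f : 'rV[R]_n -> R) x : locb t k f x -> {for x, continuous f}.
Proof.
move=> [rho [K [r0 r2 K0 h]]].
apply: (hzb_continuous (good_ball x r2) K0 _ h); exact: ballxx.
Qed.

Lemma locb_comp n p (t : tower R) k (f : 'rV[R]_n -> R) (g : 'rV[R]_p -> 'rV[R]_n) x :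
  locb t k f (g x) -> (forall j, locb t (maxn k 1) (fun y => g y 0 j) x) ->
  locb t k (fun y => f (g y)) x.
Proof.
move=> [rho [K [r0 r2 K0 Hf]]] Hg.
have /nbhs_ballP[r /= rr Hr] := near_ball_rV r0 (fun j => locb_continuous (Hg j)).
have [rho1 [L [rho10 rho12 rho1r L0 HL]]] := locb_common rr Hg.
have [M M0 HM] := hzb_comp t k (good_ball x rho12) (good_ball (g x) r2) K0 L0.
exists rho1, M; split => //; apply: HM => // y By.
by apply: Hr; apply: (ball_sub_ball _ By); rewrite subrr normr0 add0r.
Qed.

Lemma locb_down n (t : tower R) k (f : 'rV[R]_n -> R) x : locb t k.+1 f x -> locb t k f x.
Proof.
move=> [rho [K [r0 r2 K0 Hf]]]; exists rho, (n.+1%:R * K); split => //.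
  by rewrite mulr_ge0.
exact: (hzb_down (good_ball x r2) K0 Hf).
Qed.

Lemma locHZ_comp n p (alpha : R) (f : 'rV[R]_n -> R) (g : 'rV[R]_p -> 'rV[R]_n) x :
  1 < alpha -> locHZ alpha f (g x) -> (forall j, locHZ alpha (fun y => g y 0 j) x) ->
  locHZ alpha (fun y => f (g y)) x.
Proof.
move=> a1 Hf Hg; have [t [k [lv _]]] := level_exists (locHZ_gt0 Hf) ltr01.
apply: (locb_locHZ lv); apply: locb_comp; first exact: locHZ_locb Hf.
by move=> j; rewrite (maxn_idPl (level1 a1 lv)); exact: locHZ_locb (Hg j).
Qed.

(** Components of vector fields may have regularity at most 1, such as [alpha - 1] in the final
    statement. Composition then needs an inner map with one more degree of regularity, which smooth
    changes of chart have. *)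
Lemma locHZ_comp_succ n p (alpha : R) (f : 'rV[R]_n -> R) (g : 'rV[R]_p -> 'rV[R]_n) x :
  locHZ alpha f (g x) -> (forall j, locHZ (alpha + 1) (fun y => g y 0 j) x) ->
  locHZ alpha (fun y => f (g y)) x.
Proof.
move=> Hf Hg; have [t [k [lv _]]] := level_exists (locHZ_gt0 Hf) ltr01.
apply: (locb_locHZ lv); apply: locb_comp; first exact: locHZ_locb Hf.
move=> j; have := locHZ_locb (level_succ lv) (Hg j); case: k {lv} => [//|k].
by rewrite (maxn_idPl (ltn0Sn k)); exact: locb_down.
Qed.

Lemma locHZ_det n m (alpha : R) (A : 'rV[R]_n -> 'M[R]_m) x : 0 < alpha ->
  (forall i j, locHZ alpha (fun y => A y i j) x) -> locHZ alpha (fun y => \det (A y)) x.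
Proof.
move=> a0 H; apply: locHZ_sum => // s _; apply: locHZ_scale.
by apply: locHZ_prod => // i _; exact: H.
Qed.

Lemma unitmx_near n m (alpha : R) (A : 'rV[R]_n -> 'M[R]_m) x : 0 < alpha ->
  (forall i j, locHZ alpha (fun y => A y i j) x) -> A x \in unitmx ->
  \forall y \near x, A y \in unitmx.
Proof.
move=> a0 H; rewrite unitmxE unitfE => d0.
have c := locHZ_continuous (locHZ_det a0 H).
have p0 : 0 < `|\det (A x)| / 2 by rewrite divr_gt0 // normr_gt0.
move/(@cvgrPdist_le _ _ _ (nbhs x)) : c => /(_ _ p0); apply: filterS => y h.
rewrite unitmxE unitfE; apply: contraTneq h => ->; rewrite subr0 -ltNge.
by rewrite ltr_pdivrMr // ltr_pMr ?normr_gt0 // ltr1n.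
Qed.

Lemma locHZ_invmx n m (alpha : R) (A : 'rV[R]_n -> 'M[R]_m) x : 0 < alpha ->
  (forall i j, locHZ alpha (fun y => A y i j) x) -> A x \in unitmx ->
  forall i j, locHZ alpha (fun y => invmx (A y) i j) x.
Proof.
move=> a0 H u i j; have un := unitmx_near a0 H u.
apply: (@locHZ_ext _ _ _ (fun y => (\det (A y))^-1 * ((-1) ^+ (j + i) * \det (row' j (col' i (A y)))))).
  by apply: filterS un => y uy; rewrite /invmx uy !mxE.
apply: locHZ_mul; first by apply: locHZ_inv; [exact: locHZ_det|rewrite -unitfE -unitmxE].
apply: locHZ_scale; apply: locHZ_det => // a b.
by apply: (locHZ_ext _ (H (lift j a) (lift i b))); near=> y; rewrite !mxE.
Unshelve. all: by end_near. Qed.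

Lemma locHZ_mulmx n m p q (alpha : R) (A : 'rV[R]_n -> 'M[R]_(m, p)) (B : 'rV[R]_n -> 'M[R]_(p, q)) x :
  0 < alpha -> (forall i j, locHZ alpha (fun y => A y i j) x) ->
  (forall i j, locHZ alpha (fun y => B y i j) x) ->
  forall i j, locHZ alpha (fun y => (A y *m B y) i j) x.
Proof.
move=> a0 HA HB i j.
apply: (@locHZ_ext _ _ _ (fun y => \sum_k A y i k * B y k j)).
  by near=> y; rewrite mxE.
by apply: locHZ_sum => // k _; exact: locHZ_mul.
Unshelve. all: by end_near. Qed.

End LocalComposition.

(** * Symmetry of second derivatives *)

Section Schwarz.
Context {R : realType} {n : nat} (t : tower R).
Implicit Types (x : 'rV[R]_n) (f : 'rV[R]_n -> R).

Let shifted (i j : 'I_n) (a b : R) x := a *: (basis_vec i : 'rV[R]_n) + (b *: basis_vec j + x).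

Let shiftedC i j a b x : shifted i j a b x = shifted j i b a x.
Proof. by rewrite /shifted addrCA. Qed.

(** Two mean values, first in direction [i] and then in [j], give [h ^ 2] times a mixed derivative
    at a point within [2 * h] of [x]; its Hoelder modulus moves that point to [x]. *)
Lemma second_difference O K f x i j (h : R) : good_domain O -> 0 <= K ->
  hzb t 2 O K f -> O x -> 0 <= h ->
  (forall a b, 0 <= a <= h -> 0 <= b <= h -> O (shifted i j a b x)) ->
  `|f (shifted i j h h x) - f (shifted i j h 0 x) - f (shifted i j 0 h x) + f (shifted i j 0 0 x)
     - h * (h * 'D_(basis_vec j) ('D_(basis_vec i) f) x)| <= h * (h * (K * (2 * h) `^ tw_exp t)).
Proof.
move=> gO K0 [F1 F2 F3] Ox h0 HO.
have hh : 0 <= h <= h by rewrite h0 lexx.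
have h00 : 0 <= (0 : R) <= h by rewrite lexx h0.
have bet c : between 0 h c -> 0 <= c <= h by rewrite /between; lra.
have [c cb|c cb E1] := @mvt_line R
   (fun a => f (shifted i j a h x) - f (shifted i j a 0 x))
   (fun a => 'D_(basis_vec i) f (shifted i j a h x) - 'D_(basis_vec i) f (shifted i j a 0 x)) h.
  have c01 := bet _ cb.
  by apply: is_deriveB; apply: is_derive_line; apply: F2; exact: HO.
have c01 := bet _ cb.
have [G1 G2 G3] := F3 i.
have [d db|d db E2] := @mvt_line R
   (fun b => 'D_(basis_vec i) f (shifted i j c b x))
   (fun b => 'D_(basis_vec j) ('D_(basis_vec i) f) (shifted i j c b x)) h.
  have d01 := bet _ db.
  have E b : shifted i j c b x = b *: basis_vec j + (c *: basis_vec i + x) by rewrite /shifted addrCA.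
  under eq_fun do rewrite E; rewrite E.
  by apply: is_derive_line; rewrite -E; apply: G2; exact: HO.
have d01 := bet _ db.
have -> : f (shifted i j h h x) - f (shifted i j h 0 x) - f (shifted i j 0 h x) + f (shifted i j 0 0 x) =
  (f (shifted i j h h x) - f (shifted i j h 0 x)) - (f (shifted i j 0 h x) - f (shifted i j 0 0 x)) by ring.
rewrite E1 E2 -mulrA [h * (h * _)]mulrA [_ * (h * h)]mulrC -mulrBr normrM [leRHS]mulrA.
rewrite (ger0_norm (mulr_ge0 h0 h0)); apply: ler_wpM2l; first exact: mulr_ge0.
have [_ Hd _] := G3 j.
apply: (le_trans (Hd _ _ (HO _ _ c01 d01) Ox)); apply: ler_wpM2l => //.
apply: ler_powR_base => //; first exact: ltW (tw_exp_gt0 t).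
rewrite /shifted addrA addrK; apply: (le_trans (ler_normD _ _)).
have b1 (l : 'I_n) : `|basis_vec l : 'rV[R]_n| <= 1.
  by apply: normr_rV_le => // m; rewrite mxE; case: (_ && _); rewrite ?normr1 ?normr0.
have bb (l : 'I_n) (u : R) : 0 <= u <= h -> `|u *: (basis_vec l : 'rV[R]_n)| <= h.
  move=> /andP[u0 uh]; rewrite normrZ ger0_norm // -[leRHS]mulr1; exact: ler_pM.
by have := bb i c c01; have := bb j d d01; lra.
Qed.

(** The difference over the four corners of a square is symmetric in [i] and [j], so both mixed
    derivatives are its limit after division by [h ^ 2]. *)
Lemma locb_schwarz f x i j : locb t 2 f x ->
  'D_(basis_vec j) ('D_(basis_vec i) f) x = 'D_(basis_vec i) ('D_(basis_vec j) f) x.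
Proof.
move=> [rho [K [r0 r2 K0 Hf]]]; have gO := good_ball x r2.
have Ox : ball x rho x by exact: ballxx.
set A := LHS; set B := RHS.
have H (h : R) : 0 < h -> 4 * h <= rho -> `|A - B| <= 2 * K * (2 * h) `^ tw_exp t.
  move=> h0 hr; have b1 (l : 'I_n) : `|basis_vec l : 'rV[R]_n| <= 1.
    by apply: normr_rV_le => // m; rewrite mxE; case: (_ && _); rewrite ?normr1 ?normr0.
  have HO i' j' a b : 0 <= a <= h -> 0 <= b <= h -> ball x rho (shifted i' j' a b x).
    have bb (l : 'I_n) (u : R) : 0 <= u <= h -> `|u *: (basis_vec l : 'rV[R]_n)| <= h.
      move=> /andP[u0 uh]; rewrite normrZ ger0_norm // -[leRHS]mulr1; exact: ler_pM.
    move=> ah bh; apply/ball_rVP; rewrite distrC /shifted addrA addrK.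
    have := ler_normD (a *: (basis_vec i' : 'rV[R]_n)) (b *: basis_vec j').
    by have := bb i' a ah; have := bb j' b bh; lra.
  have := second_difference gO K0 Hf Ox (ltW h0) (HO i j).
  have := second_difference gO K0 Hf Ox (ltW h0) (HO j i).
  rewrite -/A -/B ![shifted j i _ _ _]shiftedC.
  set a := f _; set b := f _; set c := f _; set d := f _; set E := _ `^ _ => h1 h2.
  have h20 : 0 < h * h by rewrite mulr_gt0.
  rewrite -(ler_pM2l h20) -[X in X * `|_|]ger0_norm ?(ltW h20) // -normrM.
  have -> : h * h * (A - B) = (a - b - c + d - h * (h * B)) - (a - c - b + d - h * (h * A)) by ring.
  apply: (le_trans (ler_normB _ _)); apply: (le_trans (lerD h1 h2)).
  have -> : h * h * (2 * K * E) = h * (h * (K * E)) + h * (h * (K * E)) by ring.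
  by [].
apply/eqP; rewrite -subr_eq0 -normr_le0; apply/ler_addgt0Pr => eps eps0; rewrite add0r.
have K20 : 0 <= 2 * K by rewrite mulr_ge0.
have [d d0 Hd] := powR_small (tw_exp_gt0 t) K20 eps0.
pose h := Num.min (d / 2) (rho / 4).
have h0 : 0 < h by rewrite lt_min !divr_gt0.
have hd : h <= d / 2 by rewrite /h ge_min lexx.
have hr : h <= rho / 4 by rewrite /h ge_min lexx orbT.
by apply: (le_trans (H h h0 _)); [lra|apply: Hd; lra].
Qed.

End Schwarz.

Lemma locHZ_schwarz {R : realType} {n : nat} (alpha : R) (f : 'rV[R]_n -> R) x i j :
  2 < alpha -> locHZ alpha f x ->
  'D_(basis_vec j) ('D_(basis_vec i) f) x = 'D_(basis_vec i) ('D_(basis_vec j) f) x.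
Proof.
move=> a2 H; have [t [k [lv _]]] := level_exists (locHZ_gt0 H) ltr01.
have := locHZ_locb lv H.
case: k lv => [|[|k]] lv.
- by exfalso; move: lv a2; rewrite /level add0r => ->; have := tw_exp_lt1 t; case: ifP => _; lra.
- by exfalso; move: lv a2; rewrite /level => ->; have := tw_exp_lt1 t; case: ifP => _; lra.
move=> h; apply: (@locb_schwarz _ _ t).
by elim: k h {lv} => // k IH /locb_down.
Qed.

Section LocalTheorems.
Context {R : realType} {n : nat} (alpha : R).
Hypothesis a1 : 1 < alpha.

Lemma locHZ_local_inverse (f : 'rV[R]_n -> 'rV[R]_n) :
  (forall j, locHZ alpha (fun x => f x 0 j) 0) -> f 0 = 0 ->
  (forall i j, 'D_(basis_vec i) (fun x => f x 0 j) 0 = (i == j)%:R) ->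
  forall r : R, 0 < r -> exists r1 r2 (G : 'rV[R]_n -> 'rV[R]_n),
  [/\ 0 < r1 <= r, 0 < r2,
      forall x y, ball 0 r1 x -> ball 0 r1 y -> f x = f y -> x = y,
      forall j z, ball 0 r2 z -> locHZ alpha (fun x => G x 0 j) z &
      forall z, ball 0 r2 z -> ball 0 r1 (G z) /\ f (G z) = z].
Proof.
move=> Hf f0 Df r r0; have [t [k [lv _]]] := level_exists (lt_trans ltr01 a1) ltr01.
case: k lv => [/(level1 a1)//|k] lv.
have [rho [K [rho0 rho2 rhor K0 HK]]] := locb_common r0 (fun j => locHZ_locb lv (Hf j)).
have [r1 [r2 [L [G [/andP[r10 r1r] /andP[r20 r22] inj HG GP]]]]] := local_inverse rho0 rho2 K0 HK f0 Df.
exists r1, r2, G; split => //; first by rewrite r10 (le_trans r1r).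
move=> j z Bz; have L0 : 0 <= L by exact: (hzb_ge0 (HG j) Bz).
have [oB _ _] := good_ball (0 : 'rV[R]_n) r22.
apply: (locHZ_of_ball oB Bz _ (lt_trans ltr01 a1)).
exact: hzb_HZ lv (good_ball _ r22) L0 (HG j).
Qed.

Lemma locHZ_frobenius (T : pred 'I_n) (X : 'I_n -> 'rV[R]_n -> 'rV[R]_n) :
  (forall i l, locHZ alpha (fun x => X i x 0 l) 0) ->
  (\forall x \near (0 : 'rV[R]_n), forall i j l,
     \sum_a X i x 0 a * 'D_(basis_vec a) (fun x => X j x 0 l) x =
     \sum_a X j x 0 a * 'D_(basis_vec a) (fun x => X i x 0 l) x) ->
  (forall i, T i -> X i 0 = basis_vec i) ->
  exists H : 'rV[R]_n -> 'rV[R]_n,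
  [/\ forall l, locHZ alpha (fun x => H x 0 l) 0,
      H 0 = 0, forall i l, 'D_(basis_vec i) (fun x => H x 0 l) 0 = (i == l)%:R &
      \forall w \near (0 : 'rV[R]_n), forall j l, T j ->
        \sum_a X j w 0 a * 'D_(basis_vec a) (fun x => H x 0 l) w = (j == l)%:R].
Proof.
move=> HX /nbhs_ballP[r /= r0 Xc] X0.
have [t [k [lv _]]] := level_exists (lt_trans ltr01 a1) ltr01.
case: k lv => [/(level1 a1)//|k] lv.
(* Numbering the pairs (field, component) makes one finite family of functions, which gets a common
   ball and a common bound. *)
pose Y (p : 'I_#|{: 'I_n * 'I_n}|) x := X (enum_val p).1 x 0 (enum_val p).2.
have HY p : locb t k.+1 (Y p) 0 by apply: locHZ_locb lv _; exact: HX.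
have [rho [K [rho0 rho2 rhor K0 HK]]] := locb_common r0 HY.
have HK' i l : hzb t k.+1 (ball 0 rho) K (fun x => X i x 0 l).
  by have := HK (enum_rank (i, l)); rewrite /Y enum_rankK.
have Xc' i j l x : ball 0 rho x ->
     \sum_a X i x 0 a * 'D_(basis_vec a) (fun x => X j x 0 l) x =
     \sum_a X j x 0 a * 'D_(basis_vec a) (fun x => X i x 0 l) x.
  by move=> Bx; apply: Xc; apply: subset_ball0 Bx.
have [d [L [H [/andP[d0 d2] [L0 HL] H0 DH HP]]]] := frobenius_local rho0 rho2 K0 HK' Xc' X0.
exists H; split => //.
  move=> l; apply: (locb_locHZ lv); by exists d, L.
have : nbhs (0 : 'rV[R]_n) (ball 0 d) by exact: nbhsx_ballx.
by apply: filterS => w Bw j l Tj; exact: HP.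
Qed.

End LocalTheorems.

(** * Charts and vector fields *)

Section LinearSpans.
Context {R : realType} {n : nat}.
Implicit Types (v : 'rV[R]_n).

Lemma rV_sum_basis v : v = \sum_i v 0 i *: basis_vec i.
Proof. exact: row_sum_delta. Qed.

Lemma mulmx_rowsE k (c : 'rV[R]_k) (X : 'I_k -> 'rV[R]_n) :
  c *m (\matrix_i X i) = \sum_i c 0 i *: X i.
Proof. by rewrite mulmx_sum_row; apply: eq_bigr => i _; rewrite rowK. Qed.

Lemma sub_rowsP k (X : 'I_k -> 'rV[R]_n) v :
  reflect (exists c : 'rV[R]_k, v = \sum_i c 0 i *: X i) (v <= \matrix_i X i)%MS.
Proof.
apply: (iffP submxP) => -[c ->]; exists c; first exact: mulmx_rowsE.
by rewrite mulmx_rowsE.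
Qed.

Lemma mem_span_rows k (X : 'I_k -> 'rV[R]_n) v :
  (v \in <<[seq X i | i : 'I_k]>>%VS) = (v <= \matrix_i X i)%MS.
Proof.
apply/idP/sub_rowsP => [|[c ->]]; last first.
  apply: memv_suml => i _; apply/memvZ/memv_span.
  by apply: map_f; rewrite mem_enum.
rewrite span_def big_image /= => /memv_sumP[u Hu ->].
have H i : {c | u i = c *: X i} by apply: cid; apply/vlineP; exact: Hu.
exists (\row_i sval (H i)); apply: eq_bigr => i _; rewrite mxE; exact: svalP (H i).
Qed.

Lemma basis_rows (k : nat) (U : {vspace 'rV[R]_n}) (X : 'I_k -> 'rV[R]_n) :
  basis_of U [seq X i | i : 'I_k] ->
  row_free (\matrix_i X i) /\ forall v, (v \in U) = (v <= \matrix_i X i)%MS.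
Proof.
move=> bX; have E v : (v \in U) = (v <= \matrix_i X i)%MS.
  by rewrite -mem_span_rows (span_basis bX).
split => //; apply: inj_row_free => c; rewrite mulmx_rowsE => c0.
have /freeP F : free [tuple X i | i < k] by exact: basis_free bX.
apply/rowP => i; rewrite [RHS]mxE; apply: (F (fun i => c 0 i)).
by rewrite -[RHS]c0; apply: eq_bigr => j _; rewrite -tnth_nth tnth_mktuple.
Qed.

End LinearSpans.

Lemma boxy_convex {R : realType} {n : nat} (O : set 'rV[R]_n) : boxy O -> convex_set O.
Proof.
move=> bO; apply/convex_setW => x y; rewrite !inE => Ox Oy k k0 k1.
set w := (X in X \in _); have -> : w = k%:num *: (x : 'rV[R]_n) + (1 - k%:num) *: (y : 'rV[R]_n) by [].
rewrite inE {w}.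
apply: (bO x y) => // i; rewrite /between !mxE.
have [h|h] := leP (x 0 i) (y 0 i); apply/orP; [left|right]; apply/andP; split; nra.
Qed.

(** * Charts and their restriction *)

Section Charts.
Context {R : realType} {n : nat} {M : topologicalType}.
Implicit Types (c d : chart R n M) (p : M) (W : set M).

Lemma chart_mapE c p : chart_dom c p -> chart_inv c (c p) = p.
Proof. by move=> cp; rewrite chart_mapK // inE. Qed.

Lemma chart_continuous_at c p : chart_dom c p -> {for p, continuous c}.
Proof.
move=> cp; have := @chart_map_continuous _ _ _ c.
rewrite continuous_open_subspace; last exact: chart_dom_open.
by move=> /(_ p); apply; rewrite inE.
Qed.

Lemma chart_inv_continuous_at c p : chart_dom c p -> {for c p, continuous (chart_inv c)}.
Proof.
move=> cp; have := @chart_inv_continuous _ _ _ c.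
rewrite continuous_open_subspace; last exact: chart_range_open.
by move=> /(_ (c p)); apply; rewrite inE; exists p.
Qed.

Lemma chart_near c p W : chart_dom c p -> nbhs p W ->
  \forall y \near c p, [/\ chart_dom c (chart_inv c y), W (chart_inv c y) & c (chart_inv c y) = y].
Proof.
move=> cp Wp; have r : nbhs (c p) (c @` chart_dom c).
  by apply: open_nbhs_nbhs; split; [exact: chart_range_open|exists p].
have w : nbhs (c p) (chart_inv c @^-1` W).
  by apply: (chart_inv_continuous_at cp); rewrite chart_mapE.
apply: filterS (filterI r w) => y [[p' cp' <-]] /=.
by rewrite /= chart_mapE.
Qed.

Lemma chart_image_nbhs c p W : chart_dom c p -> open W -> W p ->
  nbhs (c p) (c @` (chart_dom c `&` W)).
Proof.
move=> cp oW Wp; have := chart_near cp (open_nbhs_nbhs (conj oW Wp)).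
by apply: filterS => y [h1 h2 h3]; exists (chart_inv c y).
Qed.

Section MakeChart.
Variables (c : chart R n M) (B : set 'rV[R]_n) (f G : 'rV[R]_n -> 'rV[R]_n).
Hypotheses (oB : open B) (Bc : B `<=` c @` chart_dom c) (ofB : open (f @` B))
  (GK : forall y, B y -> G (f y) = y) (cf : forall y, B y -> {for y, continuous f})
  (cG : forall y, B y -> {for f y, continuous G}).

Let dom := chart_dom c `&` [set p | B (c p)].

Let dom_open : open dom.
Proof.
rewrite openE => p [cp Bp]; apply: filterI.
  by apply: open_nbhs_nbhs; split => //; exact: chart_dom_open.
by apply: (chart_continuous_at cp); exact: open_nbhs_nbhs.
Qed.

Let rangeE : (fun p => f (c p)) @` dom = f @` B.
Proof.
apply/seteqP; split => y; first by move=> [p [cp Bp] <-]; exists (c p).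
by move=> [z Bz <-]; have [p cp pz] := Bc Bz; exists p; rewrite /= ?pz //; split; rewrite /= ?pz.
Qed.

Let range_open : open ((fun p => f (c p)) @` dom).
Proof. by rewrite rangeE. Qed.

Let mapK : {in dom, cancel (fun p => f (c p)) (fun y => chart_inv c (G y))}.
Proof. by move=> p; rewrite inE => -[cp Bp]; rewrite GK // chart_mapE. Qed.

Let map_cont : {within dom, continuous (fun p => f (c p))}.
Proof.
rewrite continuous_open_subspace // => p; rewrite inE => -[cp Bp].
apply: (@continuous_comp _ _ _ c f); [exact: chart_continuous_at|exact: cf].
Qed.

Let inv_cont : {within (fun p => f (c p)) @` dom, continuous (fun y => chart_inv c (G y))}.
Proof.
rewrite continuous_open_subspace // => y; rewrite inE => -[p [cp Bp] <-].
apply: (@continuous_comp _ _ _ G (chart_inv c)); first exact: cG.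
by rewrite GK //; exact: chart_inv_continuous_at.
Qed.

Definition make_chart : chart R n M :=
  Chart dom_open range_open mapK map_cont inv_cont.

End MakeChart.

End Charts.

(** * Smooth changes of chart and their differentials *)

Section SmoothCharts.
Context {R : realType} {n : nat} {M : smoothManifold R n}.
Implicit Types (c d : chart R n M) (p : M) (U : set M) (X Y : vector_field M) (gamma : R).

Definition transition_locHZ gamma c d p :=
  forall l, locHZ gamma (fun y => d (chart_inv c y) 0 l) (c p).

(** The atlas is not assumed maximal, so the linearly adapted chart need not belong to it;
    compatibility with the atlas is all that is used of it. *)
Definition smooth_chart c := forall d p gamma, atlas d -> chart_dom c p -> chart_dom d p ->
  0 < gamma -> transition_locHZ gamma c d p /\ transition_locHZ gamma d c p.

Lemma locally_locHZ gamma (A : set 'rV[R]_n) k (g : 'rV[R]_n -> 'rV[R]_k) y j : 0 < gamma ->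
  locally_class (HZ gamma) A g -> A y -> locHZ gamma (fun z => g z 0 j) y.
Proof. by move=> g0 H /H [D [oD _ Dy _ HD]]; exact: locHZ_of_ball oD Dy (HD j) g0. Qed.

Lemma locally_of_locHZ gamma (A : set 'rV[R]_n) k (g : 'rV[R]_n -> 'rV[R]_k) : 0 < gamma ->
  (forall y, A y -> nbhs y A /\ forall j, locHZ gamma (fun z => g z 0 j) y) ->
  locally_class (HZ gamma) A g.
Proof.
move=> g0 H y /H[/nbhs_ballP[r /= r0 rA] Hg].
have [t [k0 [lv _]]] := level_exists g0 ltr01.
have [rho [K [rho0 rho2 rhor K0 HK]]] := locb_common r0 (fun j => locHZ_locb lv (Hg j)).
exists (ball y rho); split.
- exact: ball_open.
- by apply: boxy_convex; case: (good_ball y rho2).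
- exact: ballxx.
- by apply: subset_trans rA; apply: ball_sub_ball; rewrite subrr normr0 add0r.
- by move=> j; exact: hzb_HZ lv (good_ball y rho2) K0 (HK j).
Qed.

Lemma atlas_smooth_chart c : atlas c -> smooth_chart c.
Proof.
move=> ac d p gamma ad cp dp g0; split => l.
  have [D [oO _ Op _ HO]] := atlas_smooth ac ad (ex_intro2 _ _ p (conj cp dp) erefl).
  exact: locHZ_of_ball oO Op (HO l _ g0) g0.
have [D [oO _ Op _ HO]] := atlas_smooth ad ac (ex_intro2 _ _ p (conj dp cp) erefl).
exact: locHZ_of_ball oO Op (HO l _ g0) g0.
Qed.

Lemma chart_at_atlas p : atlas (chart_at p).
Proof. by rewrite /chart_at; case: cid2. Qed.

Lemma chart_at_dom p : chart_dom (chart_at p) p.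
Proof. by rewrite /chart_at; case: cid2. Qed.

Definition jac c d p (v : 'rV[R]_n) : 'rV[R]_n := 'd (d \o chart_inv c) (c p) v.

Definition diff_trans c d p := differentiable (d \o chart_inv c) (c p).

Lemma transition_diff gamma c d p : 1 < gamma -> transition_locHZ gamma c d p -> diff_trans c d p.
Proof.
move=> g1 H; apply: differentiable_rVP => l.
by have [] := locHZ_differentiable g1 (H l).
Qed.

Lemma jacE gamma c d p v l : 1 < gamma -> transition_locHZ gamma c d p ->
  jac c d p v 0 l = \sum_a v 0 a * 'D_(basis_vec a) (fun y => d (chart_inv c y) 0 l) (c p).
Proof.
move=> g1 H; have df := transition_diff g1 H.
have [_ <-] := locHZ_differentiable g1 (H l).
have [dl _] := locHZ_differentiable g1 (H l).
rewrite /jac -deriveE // -[RHS]deriveE // derive_mx ?mxE //; exact: diff_derivable.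
Qed.

Lemma jac_id c p v : chart_dom c p -> jac c c p v = v.
Proof.
move=> cp; have N : \forall y \near c p, c (chart_inv c y) = y.
  by apply: filterS (chart_near cp (filterT : nbhs p setT)) => y [].
have D : is_derive (c p) v (c \o chart_inv c) v.
  apply: (near_eq_is_derive _ (is_derive_id (c p) v)).
  by apply: filterS N => y /= ->.
have df : differentiable (c \o chart_inv c) (c p).
  apply: differentiable_rVP => l.
  have C1 : (1 : R) < 2 by rewrite ltr1n.
  have H : locHZ 2 (fun y => c (chart_inv c y) 0 l) (c p).
    apply: (@locHZ_ext _ _ _ (fun y : 'rV[R]_n => y 0 l)); last by apply: locHZ_coord.
    by apply: filterS N => y ->.
  by have [] := locHZ_differentiable C1 H.
by rewrite /jac -deriveE //; case: D.
Qed.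

Lemma jac_comp c d e p v : chart_dom c p -> chart_dom d p ->
  diff_trans c d p -> diff_trans d e p -> diff_trans c e p -> jac c e p v = jac d e p (jac c d p v).
Proof.
move=> cp dp df dg df2.
have E0 : (d \o chart_inv c) (c p) = d p by rewrite /= chart_mapE.
have dg' : differentiable (e \o chart_inv d) ((d \o chart_inv c) (c p)) by rewrite E0.
have N : \forall y \near c p, (e \o chart_inv d) ((d \o chart_inv c) y) = (e \o chart_inv c) y.
  have := chart_near cp (open_nbhs_nbhs (conj (@chart_dom_open _ _ _ d) dp)).
  by apply: filterS => y [_ h2 _] /=; rewrite chart_mapE.
have D := is_derive_comp_diff dg' (diff_derivable (v := v) df).
have [_ E] := near_eq_is_derive N D.
have E1 : 'D_v (d \o chart_inv c) (c p) = jac c d p v by exact: deriveE.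
have E2 : 'D_v (e \o chart_inv c) (c p) = jac c e p v by exact: deriveE.
by rewrite -E2 E E1 /jac E0.
Qed.

End SmoothCharts.

Lemma HZ_class_C1 {R : realType} {n : nat} (alpha : R) (D : set 'rV[R]_n) f :
  1 < alpha -> open D -> HZ alpha D f -> class_C1 D f.
Proof.
move=> a1 oD H; have a0 : 0 < alpha by exact: lt_trans a1.
have L x (Dx : D x) := locHZ_of_ball oD Dx H a0.
split.
- rewrite /class_C0 continuous_open_subspace // => x; rewrite inE => Dx.
  exact: locHZ_continuous (L x Dx).
- by move=> i x Dx; exact: locHZ_derivable (L x Dx).
- move=> i; rewrite /class_C0 continuous_open_subspace // => x; rewrite inE => Dx.
  exact: locHZ_continuous (locHZ_derive i a1 (L x Dx)).
Qed.

(** * Vector fields and Lie brackets in charts *)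

Section FieldsInCharts.
Context {R : realType} {n : nat} {M : smoothManifold R n}.
Implicit Types (c d : chart R n M) (p : M) (U : set M) (X Y : vector_field M) (gamma : R).

Definition smooth_pair c d := forall p gamma, chart_dom c p -> chart_dom d p ->
  0 < gamma -> transition_locHZ gamma c d p /\ transition_locHZ gamma d c p.

Lemma smooth_pair_atlas c d : smooth_chart c -> atlas d -> smooth_pair c d.
Proof. by move=> sc ad p gamma cp dp g0; exact: sc. Qed.

Lemma smooth_pairC c d : smooth_pair c d -> smooth_pair d c.
Proof. by move=> H p gamma dp cp g0; have [] := H p gamma cp dp g0. Qed.

Lemma smooth_pair_diff c d p : smooth_pair c d -> chart_dom c p -> chart_dom d p ->
  diff_trans c d p.
Proof.
move=> H cp dp; have g1 : (1 : R) < 2 by rewrite ltr1n.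
by have [T _] := H p 2 cp dp ltac:(lra); exact: transition_diff g1 T.
Qed.

Lemma tangent_coordE c p v : tangent_coord c p v = jac (chart_at p) c p v.
Proof. by []. Qed.

Lemma smooth_chart_at c p : smooth_chart c -> smooth_pair (chart_at p) c.
Proof. by move=> sc; apply: smooth_pairC; apply: smooth_pair_atlas sc (chart_at_atlas p). Qed.

Lemma field_in_chartE X c p : chart_dom c p ->
  field_in_chart X c (c p) = tangent_coord c p (X p).
Proof. by move=> cp; rewrite /field_in_chart chart_mapE. Qed.

Lemma field_in_chart_at X p : field_in_chart X (chart_at p) (chart_at p p) = X p.
Proof.
have cp := chart_at_dom p.
by rewrite field_in_chartE // tangent_coordE jac_id.
Qed.

Lemma tangent_coord_change c d p v : smooth_chart c -> smooth_chart d -> smooth_pair c d ->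
  chart_dom c p -> chart_dom d p -> tangent_coord d p v = jac c d p (tangent_coord c p v).
Proof.
move=> sc sd scd cp dp; have ap := chart_at_dom p.
have h1 := smooth_pair_diff (@smooth_chart_at c p sc) ap cp.
have h2 := smooth_pair_diff scd cp dp.
have h3 := smooth_pair_diff (@smooth_chart_at d p sd) ap dp.
by rewrite !tangent_coordE (@jac_comp _ _ _ (chart_at p) c d).
Qed.

Lemma jacK c d p v : smooth_pair c d -> chart_dom c p -> chart_dom d p ->
  jac d c p (jac c d p v) = v.
Proof.
move=> scd cp dp.
have h1 := smooth_pair_diff scd cp dp.
have h2 := smooth_pair_diff (smooth_pairC scd) dp cp.
have h3 : diff_trans c c p.
  apply: (@transition_diff _ _ _ 2); first by rewrite ltr1n.
  move=> l; apply: (@locHZ_ext _ _ _ (fun y : 'rV[R]_n => y 0 l)); last exact: locHZ_coord.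
  by apply: filterS (chart_near cp (filterT : nbhs p setT)) => y [_ _ ->].
by rewrite -(@jac_comp _ _ _ c d c) // jac_id.
Qed.

Lemma pair_near c d p : chart_dom c p -> chart_dom d p -> \forall y \near c p,
  exists2 p', chart_dom c p' /\ chart_dom d p' & y = c p'.
Proof.
move=> cp dp; have := chart_near cp (open_nbhs_nbhs (conj (@chart_dom_open _ _ _ d) dp)).
by apply: filterS => y [h1 h2 h3]; exists (chart_inv c y).
Qed.

(** The new components are the old ones, composed with the transition and multiplied by its
    derivatives. Taking the transition in class [gamma + 1] covers both operations for every
    positive [gamma]. *)
Lemma field_locHZ_change gamma X c d p : 0 < gamma ->
  smooth_chart c -> smooth_chart d -> smooth_pair c d ->
  chart_dom c p -> chart_dom d p ->
  (forall l, locHZ gamma (fun y => field_in_chart X c y 0 l) (c p)) ->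
  forall l, locHZ gamma (fun y => field_in_chart X d y 0 l) (d p).
Proof.
move=> g0 sc sd scd cp dp H l.
have g10 : 0 < gamma + 1 by rewrite addr_gt0.
have g11 : 1 < gamma + 1 by rewrite ltrDr.
have E0 : c (chart_inv d (d p)) = c p by rewrite chart_mapE.
have [Tcd Tdc] := scd p (gamma + 1) cp dp g10.
pose h a y := field_in_chart X c (c (chart_inv d y)) 0 a *
   'D_(basis_vec a) (fun z => d (chart_inv c z) 0 l) (c (chart_inv d y)).
apply: (@locHZ_ext _ _ _ (fun y => \sum_a h a y)).
  have := pair_near dp cp; apply: filterS => y [p' [dp' cp'] ->].
  have [Tcd' _] := scd p' 2 cp' dp' ltac:(lra).
  rewrite /h chart_mapE // !field_in_chartE // (tangent_coord_change _ sc sd scd) //.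
  by rewrite (jacE _ _ _ Tcd') // ltr1n.
apply: locHZ_sum => // a _; apply: locHZ_mul.
  by apply: (locHZ_comp_succ (f := fun z => field_in_chart X c z 0 a) (g := fun y => c (chart_inv d y))); [rewrite E0|].
apply: (locHZ_comp_succ (f := 'D_(basis_vec a) (fun z => d (chart_inv c z) 0 l))
  (g := fun y => c (chart_inv d y))); last exact: Tdc.
by rewrite E0; have := locHZ_derive a g11 (Tcd l); rewrite addrK.
Qed.

Lemma field_class_of_locHZ gamma X c U : 0 < gamma -> smooth_chart c -> open U ->
  U `<=` chart_dom c ->
  (forall p l, U p -> locHZ gamma (fun y => field_in_chart X c y 0 l) (c p)) ->
  field_class (HZ gamma) U X.
Proof.
move=> g0 sc oU Uc H d ad; apply: locally_of_locHZ => // y [p [dp Up] <-]; split.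
  exact: chart_image_nbhs.
have scd := smooth_pair_atlas sc ad.
by apply: (field_locHZ_change g0 sc (atlas_smooth_chart ad) scd (Uc _ Up) dp) => l; exact: H.
Qed.

Lemma locHZ_of_field_class gamma X c U p l : 0 < gamma -> smooth_chart c -> U p ->
  chart_dom c p -> field_class (HZ gamma) U X ->
  locHZ gamma (fun y => field_in_chart X c y 0 l) (c p).
Proof.
move=> g0 sc Up cp H; have ap := chart_at_dom p; have aa := chart_at_atlas p.
apply: (field_locHZ_change g0 (atlas_smooth_chart aa) sc (@smooth_chart_at c p sc) ap cp) => l'.
by apply: (locally_locHZ l' g0 (H _ aa)); exists p.
Qed.

Lemma field_class_C1 gamma X U : 1 < gamma -> field_class (HZ gamma) U X ->
  field_class class_C1 U X.
Proof.
move=> g1 H c ac y /(H c ac)[D [oD cD Dy DA HD]]; exists D; split => // j.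
exact: HZ_class_C1 (HD j).
Qed.

(** The bracket is defined in the preferred chart of each single point, which changes with the
    point. This is its invariance, through which brackets are computed in one fixed chart. *)
Lemma lie_bracket_chart gamma X Y c p : 1 < gamma -> smooth_chart c -> chart_dom c p ->
  (forall l, locHZ gamma (fun y => field_in_chart X c y 0 l) (c p)) ->
  (forall l, locHZ gamma (fun y => field_in_chart Y c y 0 l) (c p)) ->
  forall l, tangent_coord c p (lie_bracket X Y p) 0 l =
   \sum_a (field_in_chart X c (c p) 0 a *
             'D_(basis_vec a) (fun y => field_in_chart Y c y 0 l) (c p) -
           field_in_chart Y c (c p) 0 a *
             'D_(basis_vec a) (fun y => field_in_chart X c y 0 l) (c p)).
Proof.
move=> g1 sc cp HX HY l0.
have g0 : 0 < gamma by exact: lt_trans g1.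
set d := chart_at p; have dp : chart_dom d p := chart_at_dom p.
have sd : smooth_chart d := atlas_smooth_chart (chart_at_atlas p).
have scd : smooth_pair c d := smooth_pair_atlas sc (chart_at_atlas p).
pose psi l y := d (chart_inv c y) 0 l.
have i3 : (0 : R) < 3 by rewrite ltr0n.
have i31 : (1 : R) < 3 by rewrite ltr1n.
have i32 : (2 : R) < 3 by rewrite ltr_nat.
have [psi3 _] := scd p 3 cp dp i3.
have HXd := field_locHZ_change g0 sc sd scd cp dp HX.
have HYd := field_locHZ_change g0 sc sd scd cp dp HY.
pose fX := field_in_chart X c; pose fY := field_in_chart Y c.
pose gX := field_in_chart X d; pose gY := field_in_chart Y d.
have gE (Z : vector_field M) l y : (exists2 p', chart_dom c p' /\ chart_dom d p' & y = c p') ->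
    field_in_chart Z d (d (chart_inv c y)) 0 l =
    \sum_b field_in_chart Z c y 0 b * 'D_(basis_vec b) (psi l) y.
  move=> [p' [cp' dp'] ->]; rewrite chart_mapE // !field_in_chartE //.
  rewrite (tangent_coord_change _ sc sd scd) //.
  by have [T _] := scd p' 3 cp' dp' i3; rewrite (jacE _ _ i31 T).
have E0 : d (chart_inv c (c p)) = d p by rewrite chart_mapE.
have cp_pair : exists2 p', chart_dom c p' /\ chart_dom d p' & c p = c p' by exists p.
(* The identity [gE] between components in [c] and [d] is differentiated: the chain rule on the
   left, the product rule on the right. *)
have half (Z : vector_field M) l a : (forall l, locHZ gamma (fun y => field_in_chart Z c y 0 l) (c p)) ->
   \sum_i 'D_(basis_vec i) (fun y => field_in_chart Z d y 0 l) (d p) * 'D_(basis_vec a) (psi i) (c p) =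
   \sum_b ('D_(basis_vec a) (fun y => field_in_chart Z c y 0 b) (c p) * 'D_(basis_vec b) (psi l) (c p) +
     field_in_chart Z c (c p) 0 b * 'D_(basis_vec a) ('D_(basis_vec b) (psi l)) (c p)).
  move=> HZc; have HZd := field_locHZ_change g0 sc sd scd cp dp HZc.
  have [df dfE] := locHZ_differentiable g1 (HZd l).
  have D1 : is_derive (c p) (basis_vec a) (fun y => field_in_chart Z d (d (chart_inv c y)) 0 l)
     (\sum_i 'D_(basis_vec i) (fun y => field_in_chart Z d y 0 l) (d p) * 'D_(basis_vec a) (psi i) (c p)).
    have := @is_derive_comp_rV _ _ _ (fun y => field_in_chart Z d y 0 l)
       (fun y => d (chart_inv c y)) (c p) (basis_vec a).
    rewrite E0; apply => // j; exact: (locHZ_derivable i31 (psi3 j)).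
  have D2 b : is_derive (c p) (basis_vec a) (fun y => field_in_chart Z c y 0 b * 'D_(basis_vec b) (psi l) y)
     (field_in_chart Z c (c p) 0 b * 'D_(basis_vec a) ('D_(basis_vec b) (psi l)) (c p) +
      'D_(basis_vec b) (psi l) (c p) * 'D_(basis_vec a) (fun y => field_in_chart Z c y 0 b) (c p)).
    apply: is_deriveM; apply: derivableP; first exact: (locHZ_derivable g1 (HZc b)).
    have H2 := locHZ_derive b i31 (psi3 l).
    by apply: (locHZ_derivable _ H2); lra.
  have D3 := is_derive_sum D2.
  case: D1 => _ <-; have N := pair_near cp dp.
  rewrite (near_eq_derive (g := \sum_b (fun y => field_in_chart Z c y 0 b * 'D_(basis_vec b) (psi l) y))).
    case: D3 => _ ->; apply: eq_bigr => b _.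
    by rewrite addrC [X in X + _ = _]mulrC.
  by apply: filterS N => y /gE ->; rewrite fct_sumE.
have lb l : lie_bracket X Y p 0 l = \sum_b (\sum_a (fX (c p) 0 a *
    'D_(basis_vec a) (fun y => fY y 0 b) (c p) - fY (c p) 0 a *
    'D_(basis_vec a) (fun y => fX y 0 b) (c p))) * 'D_(basis_vec b) (psi l) (c p).
  have DD (Z : vector_field M) : (forall l, locHZ gamma (fun y => field_in_chart Z d y 0 l) (d p)) -> forall i,
      'D_(basis_vec i) (field_in_chart Z d) (d p) 0 l = 'D_(basis_vec i) (fun y => field_in_chart Z d y 0 l) (d p).
    move=> H i; rewrite derive_mx ?mxE //; apply/derivable_mxP => i' j; rewrite ord1.
    exact: (locHZ_derivable g1 (H j)).
  have gp (Z : vector_field M) i : Z p 0 i = \sum_a field_in_chart Z c (c p) 0 a * 'D_(basis_vec a) (psi i) (c p).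
    by rewrite -(gE Z i _ cp_pair) E0 field_in_chart_at.
  rewrite /lie_bracket summxE.
  transitivity (\sum_a (fX (c p) 0 a * (\sum_i 'D_(basis_vec i) (fun y => gY y 0 l) (d p) * 'D_(basis_vec a) (psi i) (c p))
     - fY (c p) 0 a * (\sum_i 'D_(basis_vec i) (fun y => gX y 0 l) (d p) * 'D_(basis_vec a) (psi i) (c p)))).
    rewrite sumrB.
    rewrite (eq_bigr (fun i => X p 0 i * 'D_(basis_vec i) (fun y => gY y 0 l) (d p) -
        Y p 0 i * 'D_(basis_vec i) (fun y => gX y 0 l) (d p))); last first.
      by move=> i _; rewrite !mxE -!DD.
    rewrite sumrB; congr (_ - _).
      under eq_bigr do rewrite gp mulr_suml.
      rewrite exchange_big; apply: eq_bigr => a _; rewrite mulr_sumr; apply: eq_bigr => i _.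
      by rewrite -mulrA; congr (_ * _); rewrite mulrC.
    under eq_bigr do rewrite gp mulr_suml.
    rewrite exchange_big; apply: eq_bigr => a _; rewrite mulr_sumr; apply: eq_bigr => i _.
    by rewrite -mulrA; congr (_ * _); rewrite mulrC.
  under eq_bigr do rewrite !half // !big_split /= !mulrDr opprD addrACA.
  rewrite big_split /=.
  (* The second derivatives of the transition form a symmetric bilinear expression in the two
     fields, so they drop out of the bracket. *)
  have sym : \sum_a (fX (c p) 0 a * (\sum_b fY (c p) 0 b * 'D_(basis_vec a) ('D_(basis_vec b) (psi l)) (c p)) -
    fY (c p) 0 a * (\sum_b fX (c p) 0 b * 'D_(basis_vec a) ('D_(basis_vec b) (psi l)) (c p))) = 0.
    rewrite sumrB; under eq_bigr do rewrite mulr_sumr.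
    under [X in _ - X]eq_bigr do rewrite mulr_sumr.
    rewrite [X in _ - X]exchange_big /=; apply/eqP; rewrite subr_eq0; apply/eqP.
    apply: eq_bigr => a _; apply: eq_bigr => b _.
    by rewrite (locHZ_schwarz b a i32 (psi3 l)) mulrCA.
  rewrite [X in _ + X]sym addr0.
  under [RHS]eq_bigr do rewrite mulr_suml.
  rewrite [RHS]exchange_big /=; apply: eq_bigr => a _.
  rewrite !mulr_sumr -sumrB; apply: eq_bigr => b _.
  by rewrite mulrBl !mulrA.
pose B : 'rV[R]_n := \row_b \sum_a (fX (c p) 0 a *
    'D_(basis_vec a) (fun y => fY y 0 b) (c p) - fY (c p) 0 a *
    'D_(basis_vec a) (fun y => fX y 0 b) (c p)).
have -> : lie_bracket X Y p = jac c d p B.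
  apply/rowP => l; rewrite (jacE _ _ i31 psi3) lb; apply: eq_bigr => b _.
  by rewrite mxE.
by rewrite tangent_coordE jacK // mxE.
Qed.

End FieldsInCharts.

(** * Normal form of an involutive subbundle *)

Section NormalForm.
Context {R : realType} {n : nat} {M : smoothManifold R n}.
Implicit Types (c d : chart R n M) (p : M).

Definition jacmx c d p : 'M[R]_n := lin1_mx ('d (d \o chart_inv c) (c p)).

Lemma mul_jacmx c d p v : v *m jacmx c d p = jac c d p v.
Proof. by rewrite /jacmx mul_rV_lin1. Qed.

Lemma jacmx_unit c d p : smooth_pair c d -> chart_dom c p -> chart_dom d p ->
  jacmx c d p \in unitmx.
Proof.
move=> scd cp dp.
have E : jacmx c d p *m jacmx d c p = 1%:M.
  apply/row_matrixP => i; rewrite [LHS]rowE mulmxA (mul_jacmx c d) (mul_jacmx d c) jacK //.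
  by rewrite rowE mulmx1.
have [h _] := mulmx1_unit E; exact: h.
Qed.

Lemma tangent_coord_rows c p k (X : 'I_k -> 'rV[R]_n) :
  \matrix_i tangent_coord c p (X i) = (\matrix_i X i) *m jacmx (chart_at p) c p.
Proof. by apply/row_matrixP => i; rewrite row_mul !rowK mul_jacmx. Qed.

Lemma tangent_coord_sub c p k (X : 'I_k -> 'rV[R]_n) v : smooth_chart c -> chart_dom c p ->
  (tangent_coord c p v <= \matrix_i tangent_coord c p (X i))%MS = (v <= \matrix_i X i)%MS.
Proof.
move=> sc cp; rewrite tangent_coord_rows tangent_coordE -mul_jacmx submxMfree //.
rewrite row_free_unit; apply: jacmx_unit => //; [exact: smooth_chart_at|exact: chart_at_dom].
Qed.

Variables (k : nat) (W : tangentSubbundle M k) (gamma : R) (c : chart R n M) (p0 : M)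
  (iota : 'I_k -> 'I_n).
Hypotheses (gamma1 : 1 < gamma) (invW : involutive_subbundle W)
  (HW : subbundle_class (HZ gamma) W) (sc : smooth_chart c) (cp0 : chart_dom c p0)
  (c0 : c p0 = 0) (iota_inj : injective iota)
  (W0 : forall v l, v \in W p0 -> l \notin codom iota -> tangent_coord c p0 v 0 l = 0).

Let gamma0 : 0 < gamma. Proof. exact: lt_trans gamma1. Qed.

(** Row reduction: the frame is multiplied by the inverse of its minor [B] on the columns [iota].
    The entries stay in the class by Cramer's rule. *)
Lemma reduced_frame : exists Z : 'I_k -> 'rV[R]_n -> 'rV[R]_n,
  \forall w \near (0 : 'rV[R]_n),
  [/\ [/\ chart_dom c (chart_inv c w) & c (chart_inv c w) = w],
      forall j l, locHZ gamma (fun w => Z j w 0 l) w,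
      forall j l, Z j w 0 (iota l) = (j == l)%:R &
      forall v, (v \in W (chart_inv c w)) =
        (tangent_coord c (chart_inv c w) v <= \matrix_j Z j w)%MS].
Proof.
have [U [X [oU Up0 HX bX]]] := HW p0.
pose Vm w := \matrix_i field_in_chart (X i) c w.
pose B w : 'M[R]_k := \matrix_(i, l) field_in_chart (X i) c w 0 (iota l).
have VmE p : chart_dom c p -> Vm (c p) = \matrix_i tangent_coord c p (X i p).
  by move=> cp; apply/row_matrixP => i; rewrite !rowK field_in_chartE.
have memW p v : U p -> chart_dom c p -> (v \in W p) = (tangent_coord c p v <= Vm (c p))%MS.
  move=> Up cp; have [_ ->] := basis_rows (bX _ Up).
  by rewrite VmE // tangent_coord_sub.
have freeV p : U p -> chart_dom c p -> row_free (Vm (c p)).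
  move=> Up cp; have [+ _] := basis_rows (bX _ Up).
  rewrite VmE // tangent_coord_rows /row_free mxrankMfree // row_free_unit.
  by apply: jacmx_unit => //; [exact: smooth_chart_at|exact: chart_at_dom].
have HV i l : locHZ gamma (fun w => field_in_chart (X i) c w 0 l) 0.
  by rewrite -c0; exact: (locHZ_of_field_class l gamma0 sc Up0 cp0 (HX i)).
have HB i l : locHZ gamma (fun w => B w i l) 0.
  by apply: (locHZ_ext _ (HV i (iota l))); near=> w; rewrite mxE.
have HVm i l : locHZ gamma (fun w => Vm w i l) 0.
  by apply: (locHZ_ext _ (HV i l)); near=> w; rewrite mxE.
(* By [W0] the columns outside [iota] vanish at the origin, so a relation between the rows of [B 0]
   is one between the rows of the whole frame. *)
have B0 : B 0 \in unitmx.
  rewrite -row_free_unit; apply: inj_row_free => u uB.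
  have : u *m Vm 0 = 0.
    apply/rowP => l; rewrite [RHS]mxE.
    have [/codomP[l' ->]|nl] := boolP (l \in codom iota).
      have := congr1 (fun m : 'rV[R]_k => m 0 l') uB; rewrite [RHS]mxE => <-.
      by rewrite !mxE; apply: eq_bigr => i _; rewrite !mxE.
    rewrite mxE big1 // => i _; rewrite -c0 VmE // mxE W0 ?mulr0 //.
    by have [_ ->] := basis_rows (bX _ Up0); rewrite -(rowK (fun i => X i p0)) row_sub.
  move/eqP; rewrite mulmx_free_eq0; first by move/eqP.
  by rewrite -c0; exact: freeV.
pose Zm w := invmx (B w) *m Vm w.
have HZm j l : locHZ gamma (fun w => Zm w j l) 0.
  by apply: locHZ_mulmx => //; exact: locHZ_invmx.
exists (fun j w => row j (Zm w)).
have n1 : \forall w \near (0 : 'rV[R]_n), [/\ chart_dom c (chart_inv c w), U (chart_inv c w) & c (chart_inv c w) = w].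
  by rewrite -c0; apply: chart_near => //; exact: open_nbhs_nbhs.
have n2 := unitmx_near gamma0 HB B0.
have n3 : \forall w \near (0 : 'rV[R]_n), forall jl : 'I_k * 'I_n, locHZ gamma (fun w => Zm w jl.1 jl.2) w.
  apply: (@filter_forall _ _ _ (nbhs (0 : 'rV[R]_n)) (nbhs_filter _)) => jl.
  exact: locHZ_near.
apply: filterS (filterI n1 (filterI n2 n3)) => w [[cw Uw cK] [uB H3]]; split => //.
- move=> j l; apply: (locHZ_ext _ (H3 (j, l))).
  by near=> y; rewrite [RHS]mxE.
- move=> j l; rewrite !mxE.
  transitivity ((invmx (B w) *m B w) j l); last by rewrite mulVmx // mxE.
  by rewrite mxE; apply: eq_bigr => i _; rewrite !mxE.
- move=> v; rewrite memW // cK.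
  have -> : \matrix_j row j (Zm w) = Zm w by apply/row_matrixP => j; rewrite rowK.
  by rewrite (eqmxMfull (Vm w)) // row_full_unit unitmx_inv.
Unshelve. all: by end_near. Qed.

Theorem subbundle_normal_form : exists (Z : 'I_k -> 'rV[R]_n -> 'rV[R]_n) (H : 'rV[R]_n -> 'rV[R]_n),
  [/\ \forall w \near (0 : 'rV[R]_n),
      [/\ [/\ chart_dom c (chart_inv c w) & c (chart_inv c w) = w],
        forall j l, locHZ gamma (fun w => Z j w 0 l) w,
        forall j l, Z j w 0 (iota l) = (j == l)%:R &
        forall v, (v \in W (chart_inv c w)) =
          (tangent_coord c (chart_inv c w) v <= \matrix_j Z j w)%MS],
    forall l, locHZ gamma (fun x => H x 0 l) 0, H 0 = 0,
    forall i l, 'D_(basis_vec i) (fun x => H x 0 l) 0 = (i == l)%:R &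
    \forall w \near (0 : 'rV[R]_n), forall j l,
      \sum_a Z j w 0 a * 'D_(basis_vec a) (fun x => H x 0 l) w = (iota j == l)%:R].
Proof.
have [Z nZ] := reduced_frame.
have /nbhs_ballP[rho /= rho0 HB] := nZ.
pose U := chart_dom c `&` [set p | ball (0 : 'rV[R]_n) rho (c p)].
have oU : open U.
  rewrite openE => p [cp Bp]; apply: filterI.
    by apply: open_nbhs_nbhs; split => //; exact: chart_dom_open.
  by apply: (chart_continuous_at cp); apply: open_nbhs_nbhs; split => //; exact: ball_open.
have Bnear w : ball (0 : 'rV[R]_n) rho w -> nbhs w (ball 0 rho).
  by move=> Bw; apply: open_nbhs_nbhs; split => //; exact: ball_open.
(* Involutivity speaks of fields on [M], so the rows [Z j] are carried back to tangent vectors, in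
   the preferred chart of each point. *)
pose Zf j : vector_field M := fun p => jac c (chart_at p) p (Z j (c p)).
have tZ j p : U p -> tangent_coord c p (Zf j p) = Z j (c p).
  move=> [cp _]; rewrite tangent_coordE jacK //; last exact: chart_at_dom.
  by apply: smooth_pairC; exact: smooth_chart_at.
have fZ j w : ball 0 rho w -> field_in_chart (Zf j) c w = Z j w.
  move=> Bw; have [[cw cK] _ _ _] := HB _ Bw.
  rewrite -[in LHS]cK field_in_chartE // tZ ?cK //; split => //=; by rewrite cK.
have nfZ j w l : ball 0 rho w -> \forall y \near w, Z j y 0 l = field_in_chart (Zf j) c y 0 l.
  by move=> /Bnear; apply: filterS => y By; rewrite fZ.
have lfZ j w l : ball 0 rho w -> locHZ gamma (fun y => field_in_chart (Zf j) c y 0 l) w.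
  by move=> Bw; have [_ H _ _] := HB _ Bw; exact: locHZ_ext (nfZ j w l Bw) (H j l).
have UB p : U p -> ball 0 rho (c p) by case.
have Zsec j : section_class class_C1 U W (Zf j).
  split.
    apply: (field_class_C1 gamma1); apply: (field_class_of_locHZ (c := c)) => //.
      by move=> p [].
    by move=> p l Up; apply: lfZ; exact: UB.
  move=> p Up; have [_ _ _] := HB _ (UB _ Up); have [cp _] := Up.
  rewrite chart_mapE // => ->; rewrite tZ // -(rowK (fun j => Z j (c p))).
  exact: row_sub.
have comm w : ball 0 rho w -> forall i j l,
    \sum_a Z i w 0 a * 'D_(basis_vec a) (fun y => Z j y 0 l) w =
    \sum_a Z j w 0 a * 'D_(basis_vec a) (fun y => Z i y 0 l) w.
  move=> Bw i j; have [[cw cK] _ Zi memW] := HB _ Bw.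
  have Uw : U (chart_inv c w) by split; rewrite /= ?cK.
  have [_ /(_ _ Uw)] := invW oU (Zsec i) (Zsec j).
  rewrite memW => /submxP[u]; set b := tangent_coord _ _ _ => bE.
  have bl l : b 0 l = \sum_a Z i w 0 a * 'D_(basis_vec a) (fun y => Z j y 0 l) w -
      \sum_a Z j w 0 a * 'D_(basis_vec a) (fun y => Z i y 0 l) w.
    have L j' l' : locHZ gamma (fun y => field_in_chart (Zf j') c y 0 l') (c (chart_inv c w)).
      by rewrite cK; exact: lfZ.
    rewrite /b (lie_bracket_chart gamma1 sc cw (L i) (L j)) cK sumrB !fZ //.
    by congr (_ - _); apply: eq_bigr => a _; congr (_ * _); apply: near_eq_derive;
       apply: filterS (Bnear _ Bw) => y By; rewrite fZ.
  have D0 j' l' a : 'D_(basis_vec a) (fun y => Z j' y 0 (iota l')) w = 0.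
    rewrite (near_eq_derive (g := fun=> ((j' == l')%:R : R))) ?derive_cst //.
    by apply: filterS (Bnear _ Bw) => y By; have [_ _ Zy _] := HB _ By; exact: Zy.
  have b0 l : b 0 (iota l) = 0.
    rewrite bl; under eq_bigr do rewrite D0 mulr0.
    by under [X in _ - X]eq_bigr do rewrite D0 mulr0; rewrite subrr.
  (* The coefficients of the bracket in the reduced frame are its components along [iota], which
     vanish because those components of the frame are constant. *)
  have u0 : u = 0.
    apply/rowP => l; rewrite [RHS]mxE -(b0 l) bE mxE (bigD1 l) //= !mxE Zi eqxx mulr1.
    by rewrite big1 ?addr0 // => l' ll'; rewrite mxE Zi (negbTE ll') mulr0.
  move=> l; apply/eqP; rewrite -subr_eq0 -bl bE u0 mul0mx mxE //.
pose T (i : 'I_n) := i \in codom iota.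
(* [locHZ_frobenius] takes one field for each coordinate direction. Zero fields fill the directions
   outside [iota]; they commute with everything and are not straightened. *)
pose X (i : 'I_n) w := if [pick j | iota j == i] is Some j then Z j w else 0.
have XZ j : X (iota j) = Z j.
  apply/funext => w; rewrite /X; case: pickP => [j' /eqP /iota_inj -> //|/(_ j)].
  by rewrite eqxx.
have XN i : ~~ T i -> X i = fun=> 0.
  move=> nT; apply/funext => w; rewrite /X; case: pickP => // j /eqP ji.
  by move: nT; rewrite -ji /T codom_f.
have B0 : ball (0 : 'rV[R]_n) rho 0 by exact: ballxx.
have HX i l : locHZ gamma (fun x => X i x 0 l) 0.
  have [/codomP[j ->]|/XN ->] := boolP (T i).
    by rewrite XZ; have [_ H _ _] := HB _ B0.
  apply: (@locHZ_ext _ _ _ (fun=> 0)); last exact: locHZ_cst.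
  by near=> y; rewrite mxE.
have Xc : \forall x \near (0 : 'rV[R]_n), forall i j l,
     \sum_a X i x 0 a * 'D_(basis_vec a) (fun x => X j x 0 l) x =
     \sum_a X j x 0 a * 'D_(basis_vec a) (fun x => X i x 0 l) x.
  apply: filterS (Bnear _ B0) => w Bw.
  have zero i j l : ~~ T i -> \sum_a X i w 0 a * 'D_(basis_vec a) (fun x => X j x 0 l) w = 0 /\
     \sum_a X j w 0 a * 'D_(basis_vec a) (fun x => X i x 0 l) w = 0.
    move=> /XN Xi; split; rewrite big1 // => a _; first by rewrite Xi mxE mul0r.
    rewrite (_ : (fun x => X i x 0 l) = fun=> 0) ?derive_cst ?mulr0 //.
    by apply/funext => x; rewrite Xi mxE.
  move=> i j l; have [/codomP[i' ->]|/zero Ti] := boolP (T i); last by have [-> ->] := Ti j l.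
  have [/codomP[j' ->]|/zero Tj] := boolP (T j); last by have [-> ->] := Tj (iota i') l.
  by rewrite !XZ; exact: comm.
have X0 i : T i -> X i 0 = basis_vec i.
  move=> /codomP[j ->]; rewrite XZ; apply/rowP => l; rewrite [RHS]mxE eqxx /=.
  have [_ _ Z0 memW] := HB _ B0.
  have [/codomP[l' ->]|nl] := boolP (l \in codom iota).
    by rewrite Z0 eq_sym (inj_eq iota_inj).
  have Zj : Zf j p0 \in W p0.
    by have [_ H] := Zsec j; apply: H; split => //=; rewrite c0.
  have := W0 Zj nl; rewrite tZ ?c0; last by split => //=; rewrite c0.
  move=> ->; case: eqP => // E; by move: nl; rewrite E codom_f.
have [H [HH H0 DH HP]] := locHZ_frobenius gamma1 HX Xc X0.
exists Z, H; split => //.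
apply: filterS HP => w Hw j l; have := Hw (iota j) l.
by rewrite XZ; apply; rewrite /T codom_f.
Unshelve. all: by end_near. Qed.

End NormalForm.

(** * The adapted coordinate system *)

Section AdaptedBasis.
Context {R : realType}.

Lemma vspace_rows n k (U : {vspace 'rV[R]_n}) : \dim U = k -> exists X : 'M[R]_(k, n),
  row_free X /\ forall v, (v \in U) = (v <= X)%MS.
Proof.
case: k /; exists (\matrix_i tnth (vbasis U) i); apply: basis_rows.
have -> : [seq tnth (vbasis U) i | i : 'I_(\dim U)] = vbasis U by rewrite -[RHS]map_tnth_enum.
exact: vbasisP.
Qed.

Lemma row_free_complete k l (D : 'M[R]_(k, k + l)) : row_free D ->
  exists2 P, P \in unitmx & usubmx P = D.
Proof.
move=> /eqP rD; exists (block_mx (col_ebase D) 0 0 1%:M *m row_ebase D).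
  by rewrite unitmx_mul row_ebase_unit andbT unitmxE det_ublock det1 mulr1 -unitmxE col_ebase_unit.
rewrite block_mxEv mul_col_mx col_mxKu -[RHS]mulmx_ebase rD pid_mx_row.
by rewrite mul_mx_row mulmx1 mulmx0.
Qed.

(** A basis of [V] is written as [D *m e] in a basis [e] of [E]. Completing [D] to a basis change
    within [E] and [e] to a basis of the whole space gives a basis adapted to both; [A] is the
    inverse of its matrix. *)
Lemma adapted_basis r m q (V E : {vspace 'rV[R]_(r + m + q)}) :
  \dim V = r -> \dim E = (r + m)%N -> (V <= E)%VS ->
  exists A : 'M[R]_(r + m + q), [/\ A \in unitmx,
    forall v, v \in V -> exists u : 'rV_r, v *m A = row_mx (row_mx u 0) 0 &
    forall v, v \in E -> exists u : 'rV_(r + m), v *m A = row_mx u 0].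
Proof.
move=> /vspace_rows[v [fv Vv]] /vspace_rows[e [fe Ee]] VE.
have /submxP[D vE] : (v <= e)%MS.
  by apply/row_subP => i; rewrite -Ee; apply: (subvP VE); rewrite Vv row_sub.
have fD : row_free D.
  by move: fv; rewrite vE /row_free mxrankMfree.
have [D' uD' DE] := row_free_complete fD.
have [e' ue' eE] := row_free_complete fe.
exists (invmx (block_mx D' 0 0 1%:M *m e')); set P := _ *m _.
have uP : P \in unitmx.
  by rewrite unitmx_mul ue' andbT unitmxE det_ublock det1 mulr1 -unitmxE.
have uPE (u : 'rV[R]_(r + m)) : row_mx u 0 *m P = u *m D' *m e.
  by rewrite /P mulmxA mul_row_block !mulmx0 !mul0mx !addr0 -{1}(vsubmxK e') mul_row_col mul0mx addr0 eE.
split; first by rewrite unitmx_inv.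
  move=> w; rewrite Vv vE => /submxP[u ->]; exists u.
  apply: (canLR (mulmxK uP)); rewrite uPE -{1}(vsubmxK D') mul_row_col mul0mx addr0 DE.
  by rewrite mulmxA.
move=> w; rewrite Ee => /submxP[u ->]; exists (u *m invmx D').
by apply: (canLR (mulmxK uP)); rewrite uPE mulmxKV.
Qed.

End AdaptedBasis.

(** * Charts obtained from a given chart *)

Section NewCharts.
Context {R : realType} {n : nat}.

Lemma locHZ_continuous_rV p gamma (f : 'rV[R]_p -> 'rV[R]_n) x :
  (forall j, locHZ gamma (fun y => f y 0 j) x) -> {for x, continuous f}.
Proof.
move=> H A /nbhs_ballP[e /= e0 eA].
have := near_ball_rV e0 (fun j => locHZ_continuous (H j)).
by apply: filterS => y /eA.
Qed.

Lemma locHZ_affine gamma (a b : 'rV[R]_n) (A : 'M[R]_n) j x : 0 < gamma ->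
  locHZ gamma (fun y => ((y + a) *m A + b) 0 j) x.
Proof.
move=> g0; apply: (@locHZ_ext _ _ _ (fun y => \sum_k (y 0 k + a 0 k) * A k j + b 0 j)).
  by near=> y; rewrite !mxE; congr (_ + _); apply: eq_bigr => k _; rewrite !mxE.
apply: locHZ_add; last exact: locHZ_cst.
apply: locHZ_sum => // k _; apply: locHZ_mul; last exact: locHZ_cst.
by apply: locHZ_add; [exact: locHZ_coord|exact: locHZ_cst].
Unshelve. all: by end_near. Qed.

Lemma derive_affine (a b : 'rV[R]_n) (A : 'M[R]_n) i j x :
  'D_(basis_vec i) (fun y : 'rV[R]_n => ((y + a) *m A + b) 0 j) x = A i j.
Proof.
have D k : is_derive x (basis_vec i) (fun y : 'rV[R]_n => A k j * (y 0 k : R)) (A k j *: (i == k)%:R).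
  by have h := derive_coord i k x; exact: is_deriveZ.
rewrite (near_eq_derive (g := (\sum_k (fun y : 'rV[R]_n => A k j * (y 0 k : R))) + cst ((a *m A + b) 0 j))).
  have [_ ->] := is_deriveD (is_derive_sum D) (is_derive_cst ((a *m A + b) 0 j) x (basis_vec i)).
  rewrite addr0 (bigD1 i) //= eqxx big1 ?addr0; first by rewrite /GRing.scale /= mulr1.
  by move=> k ki; rewrite eq_sym (negbTE ki) scaler0.
near=> y; rewrite mulmxDl -addrA [LHS]mxE; congr (_ + _).
by rewrite fct_sumE mxE; apply: eq_bigr => k _; rewrite mulrC.
Unshelve. all: by end_near. Qed.

Context {M : smoothManifold R n}.
Implicit Types (c d : chart R n M) (p : M).

Lemma make_chart_transition gamma c B f G oB Bc ofB GK cf cG d p :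
  let F := @make_chart R n M c B f G oB Bc ofB GK cf cG in
  1 < gamma -> smooth_pair c d -> chart_dom F p -> chart_dom d p ->
  (forall l, locHZ gamma (fun y => f y 0 l) (c p)) ->
  (forall l, locHZ gamma (fun y => G y 0 l) (F p)) ->
  transition_locHZ gamma F d p /\ transition_locHZ gamma d F p.
Proof.
move=> F g1 scd [cp Bp] dp Hf HG.
have [Tcd Tdc] := scd p gamma cp dp (lt_trans ltr01 g1).
split => l.
  have E : G (F p) = c p by exact: (GK _ Bp).
  apply: (locHZ_comp (f := fun y => d (chart_inv c y) 0 l) (g := G)) => //.
  by rewrite E; exact: Tcd.
apply: (locHZ_comp (f := fun y => f y 0 l) (g := fun y => c (chart_inv d y))) => //.
by rewrite chart_mapE.
Qed.

Lemma smooth_pair_le c d : (forall p gamma, chart_dom c p -> chart_dom d p -> 1 < gamma ->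
  transition_locHZ gamma c d p /\ transition_locHZ gamma d c p) -> smooth_pair c d.
Proof.
move=> H p gamma cp dp g0; have g1 : 1 < gamma + 1 by lra.
have g2 : gamma <= gamma + 1 by lra.
by have [h1 h2] := H p _ cp dp g1; split => l; [exact: locHZ_le (h1 l)|exact: locHZ_le (h2 l)].
Qed.

(** The last formula and the inclusion of domains are kept because the t-coordinates must later be
    recognized as affine functions of one atlas chart. *)
Lemma affine_chart (A : 'M[R]_n) p0 : A \in unitmx -> exists c, [/\ smooth_chart c,
  chart_dom c p0 /\ chart_dom c `<=` chart_dom (chart_at p0), c p0 = 0,
  forall v, tangent_coord c p0 v = v *m A &
  forall p, c p = (chart_at p0 p - chart_at p0 p0) *m A].
Proof.
move=> uA; pose c0 := chart_at p0; pose y0 := c0 p0.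
pose B := c0 @` chart_dom c0.
pose f (y : 'rV[R]_n) := (y + - y0) *m A + 0; pose G y := (y + 0) *m invmx A + y0.
have Hf gamma y l : 0 < gamma -> locHZ gamma (fun y => f y 0 l) y by exact: locHZ_affine.
have HG gamma y l : 0 < gamma -> locHZ gamma (fun y => G y 0 l) y by exact: locHZ_affine.
have cf y : {for y, continuous f} by apply: (@locHZ_continuous_rV _ 1) => l; exact: Hf.
have cG y : {for y, continuous G} by apply: (@locHZ_continuous_rV _ 1) => l; exact: HG.
have GK y : G (f y) = y by rewrite /G /f !addr0 mulmxK // subrK.
have fK y : f (G y) = y by rewrite /G /f !addr0 addrK mulmxKV.
have oB : open B by exact: chart_range_open.
have ofB : open (f @` B).
  have -> : f @` B = G @^-1` B.
    apply/seteqP; split => y /=; first by move=> [z Bz <-]; rewrite GK.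
    by move=> Gy; exists (G y).
  by move/continuousP : cG; apply.
pose c := make_chart oB (fun y By => By) ofB (fun y _ => GK y) (fun y _ => cf y) (fun y _ => cG (f y)).
have c0p := chart_at_dom p0.
have cp0 : chart_dom c p0 by split => //; exists p0.
have sc0 : smooth_chart c0 := atlas_smooth_chart (chart_at_atlas p0).
have sc : smooth_chart c.
  move=> d p gamma ad cp dp g0.
  suff H : smooth_pair c d by exact: H.
  apply: smooth_pair_le => {cp dp g0}p {}gamma cp dp g1; have g0 : 0 < gamma by lra.
  apply: (make_chart_transition g1 (smooth_pair_atlas sc0 ad) cp dp) => l; [exact: Hf|exact: HG].
exists c; split => //.
- by split => // p [].
- by rewrite /= /f subrr mul0mx addr0.
- move=> v; apply/rowP => l.
  have [T _] := @smooth_chart_at _ _ _ c p0 sc p0 2 c0p cp0 ltac:(lra).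
  rewrite tangent_coordE (jacE v l _ T) ?mxE ?ltr1n //; apply: eq_bigr => a _; congr (_ * _).
  rewrite (near_eq_derive (g := fun y : 'rV[R]_n => ((y + - y0) *m A + 0) 0 l)); first exact: derive_affine.
  by apply: filterS (chart_near c0p (filterT : nbhs p0 setT)) => y [_ _ /= ->].
- by move=> p; rewrite /= /f addr0.
Qed.

End NewCharts.

(** In [HZ_infty] one domain must serve every [beta], whereas the radius in [locHZ] may shrink with
    [beta]. Here [rho] is fixed beforehand, which is possible because the loss of radius in [HZ_hzb]
    is the same for all classes. *)
Lemma HZ_infty_affine {R : realType} {n : nat} (D : set 'rV[R]_n) x (rho : R) k
    (g : 'I_k -> 'rV[R]_n -> R) (a : 'I_k -> R) (b : R) :
  0 < rho -> 4 * rho <= 1 -> ball x (4 * rho) `<=` D -> (forall i, HZ_infty D (g i)) ->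
  HZ_infty (ball x rho) (fun y => \sum_i a i * g i y + b).
Proof.
move=> r0 r4 BD Hg beta b0; have [t [m [lv _]]] := level_exists b0 ltr01.
have gB : good_domain (ball x rho) by apply: good_ball; lra.
have [oB bB _] := gB.
have H i : {K | 0 <= K & hzb t m (ball x rho) K (g i)}.
  by apply: cid2; exact: HZ_hzb lv r0 r4 BD (Hg i _ b0).
pose L := \sum_i `|a i| * s2val (H i).
have L0 i : 0 <= `|a i| * s2val (H i) by rewrite mulr_ge0 // (s2valP (H i)).
have Hs : hzb t m (ball x rho) (k%:R * L) (fun y => \sum_i a i * g i y).
  apply: hzb_sum => // i.
  apply: (hzb_le _ (hzb_scale (a i) oB bB (s2valP' (H i)))).
  by rewrite /L (bigD1 i) //= lerDl sumr_ge0.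
have K0 : 0 <= k%:R * L + `|b| by rewrite addr_ge0 // mulr_ge0 // sumr_ge0.
have Hb : hzb t m (ball x rho) `|b| (fun=> b) by exact: hzb_cst.
exact: (hzb_HZ lv gB K0 (hzb_add oB bB Hs Hb)).
Qed.

(** * Coordinate fields of a chart of finite regularity *)

Section Pullback.
Context {R : realType} {n : nat} {M : smoothManifold R n}.
Implicit Types (c d F : chart R n M) (p u : M).

Lemma smooth_pair_refl c : smooth_pair c c.
Proof.
have H p gamma : chart_dom c p -> 0 < gamma -> transition_locHZ gamma c c p.
  move=> cp g0 l; apply: (@locHZ_ext _ _ _ (fun y : 'rV[R]_n => y 0 l)); last exact: locHZ_coord.
  by apply: filterS (chart_near cp (filterT : nbhs p setT)) => y [_ _ ->].
by move=> p gamma cp _ g0; split; exact: H.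
Qed.

Lemma diff_trans_refl c p : chart_dom c p -> diff_trans c c p.
Proof. by move=> cp; exact: (smooth_pair_diff (@smooth_pair_refl c) cp cp). Qed.

Lemma jacK_diff c d p v : chart_dom c p -> chart_dom d p -> diff_trans c d p -> diff_trans d c p ->
  jac d c p (jac c d p v) = v.
Proof.
move=> cp dp h1 h2; have h3 := diff_trans_refl cp.
by rewrite -(@jac_comp _ _ _ c d c) // jac_id.
Qed.

Section Transitions.
Variables (F c : chart R n M) (p : M) (mu : R).
Hypotheses (Fp : chart_dom F p) (cp : chart_dom c p) (sc : smooth_chart c) (mu1 : 1 < mu)
  (TF : forall d, d = c \/ atlas d -> chart_dom d p ->
    transition_locHZ mu F d p /\ transition_locHZ mu d F p).

Let d := chart_at p.
Let dp : chart_dom d p := chart_at_dom p.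

Let Fd : diff_trans F d p.
Proof. by have [h _] := TF (or_intror (chart_at_atlas p)) dp; exact: (transition_diff mu1 h). Qed.

Let dF : diff_trans d F p.
Proof. by have [_ h] := TF (or_intror (chart_at_atlas p)) dp; exact: (transition_diff mu1 h). Qed.

Let Fc : diff_trans F c p.
Proof. by have [h _] := TF (or_introl erefl) cp; exact: (transition_diff mu1 h). Qed.

Let cF : diff_trans c F p.
Proof. by have [_ h] := TF (or_introl erefl) cp; exact: (transition_diff mu1 h). Qed.

Lemma tangent_coord_pullback i : tangent_coord F p (pullback_partial F i p) = basis_vec i.
Proof. exact: (jacK_diff (basis_vec i) Fp dp Fd dF). Qed.

Lemma tangent_expand v : v = \sum_i tangent_coord F p v 0 i *: pullback_partial F i p.
Proof.
rewrite -[LHS](jacK_diff v dp Fp dF Fd) -/(tangent_coord F p v).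
rewrite -(mul_jacmx F d) {1}(rV_sum_basis (jac d F p v)) mulmx_suml.
by apply: eq_bigr => i _; rewrite -scalemxAl (mul_jacmx F d).
Qed.

Lemma tangent_coord_via v : tangent_coord F p v = jac c F p (tangent_coord c p v).
Proof.
have dc := smooth_pair_diff (@smooth_chart_at _ _ _ c p sc) dp cp.
exact: (jac_comp v dp cp dc cF dF).
Qed.

Lemma pullback_coordP i v : jac c F p v = basis_vec i ->
  tangent_coord c p (pullback_partial F i p) = v.
Proof.
move=> H; rewrite -[RHS](jacK_diff v cp Fp cF Fc) H.
rewrite -tangent_coord_pullback tangent_coord_via.
by rewrite (jacK_diff _ cp Fp cF Fc).
Qed.

End Transitions.

End Pullback.

Section Indices.
Context {R : realType} {r m q : nat}.

Lemma indexP (l : 'I_(r + m + q)) :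
  [\/ exists j : 'I_r, l = t_index j, exists j : 'I_m, l = x_index j |
      exists j : 'I_q, l = rshift (r + m) j].
Proof.
case: (split_ordP l) => [k ->|k ->]; last by constructor 3; exists k.
case: (split_ordP k) => [j ->|j ->]; first by constructor 1; exists j.
by constructor 2; exists j.
Qed.

Lemma t_index_inj : injective (@t_index r m q).
Proof. by move=> i j /(@lshift_inj _ _) /(@lshift_inj _ _). Qed.

Lemma t_index_eq (i j : 'I_r) : ((t_index i : 'I_(r + m + q)) == t_index j) = (i == j).
Proof. by rewrite (inj_eq t_index_inj). Qed.

Lemma x_index_eq (i j : 'I_m) : ((x_index i : 'I_(r + m + q)) == x_index j) = (i == j).
Proof. by rewrite !eq_shift. Qed.

Lemma t_x_index_eq (i : 'I_r) (j : 'I_m) : ((t_index i : 'I_(r + m + q)) == x_index j) = false.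
Proof. by rewrite !eq_shift. Qed.

Lemma x_t_index_eq (i : 'I_r) (j : 'I_m) : ((x_index j : 'I_(r + m + q)) == t_index i) = false.
Proof. by rewrite eq_sym t_x_index_eq. Qed.

Lemma shift_index_eq (i : 'I_(r + m)) (j : 'I_q) : (lshift q i == rshift (r + m) j) = false.
Proof. by rewrite eq_shift. Qed.

Definition glue (t x s : 'rV[R]_(r + m + q)) : 'rV[R]_(r + m + q) :=
  row_mx (row_mx (t_part t) (x_part x)) (s_part s).

Lemma glue_t t x s j : glue t x s 0 (t_index j) = t 0 (t_index j).
Proof. by rewrite /glue row_mxEl row_mxEl !mxE. Qed.

Lemma glue_x t x s j : glue t x s 0 (x_index j) = x 0 (x_index j).
Proof. by rewrite /glue row_mxEl row_mxEr !mxE. Qed.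

Lemma glue_s t x s j : glue t x s 0 (rshift (r + m) j) = s 0 (rshift (r + m) j).
Proof. by rewrite /glue row_mxEr !mxE. Qed.

End Indices.

(** * The coordinate fields of the adapted chart *)

Section AdaptedChart.
Context {R : realType} {r m q : nat} {M : smoothManifold R (r + m + q)}.
Local Notation n := (r + m + q)%N.
Variables (V : tangentSubbundle M r) (E : tangentSubbundle M (r + m)) (c F : chart R n M) (u : M)
  (mu : R) (Zv : 'I_r -> 'rV[R]_n -> 'rV[R]_n) (Ze : 'I_(r + m) -> 'rV[R]_n -> 'rV[R]_n)
  (Hv He : 'rV[R]_n -> 'rV[R]_n).
Hypotheses (VE : subbundle_le V E) (Fu : chart_dom F u) (cu : chart_dom c u)
  (sc : smooth_chart c) (mu1 : 1 < mu)
  (TF : forall d, d = c \/ atlas d -> chart_dom d u ->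
    transition_locHZ mu F d u /\ transition_locHZ mu d F u).
Local Notation w := (c u).
Hypotheses (FE : \forall y \near w, F (chart_inv c y) = glue y (Hv y) (He y))
  (Zv1 : forall j l, Zv j w 0 (t_index l) = (j == l)%:R)
  (Ze1 : forall j l, Ze j w 0 (lshift q l) = (j == l)%:R)
  (memV : forall v, (v \in V u) = (tangent_coord c u v <= \matrix_j Zv j w)%MS)
  (memE : forall v, (v \in E u) = (tangent_coord c u v <= \matrix_j Ze j w)%MS)
  (DHv : forall j l, \sum_a Zv j w 0 a * 'D_(basis_vec a) (fun x => Hv x 0 l) w = (t_index j == l)%:R)
  (DHe : forall j l, \sum_a Ze j w 0 a * 'D_(basis_vec a) (fun x => He x 0 l) w = (lshift q j == l)%:R).

Let jacF v l (g : 'rV[R]_n -> R) : (forall y, glue y (Hv y) (He y) 0 l = g y) ->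
  jac c F u v 0 l = \sum_a v 0 a * 'D_(basis_vec a) g w.
Proof.
move=> gE; have [_ h] := TF (or_introl erefl) cu.
rewrite (jacE v l mu1 h); apply: eq_bigr => a _; congr (_ * _); apply: near_eq_derive.
by apply: filterS FE => y /= ->.
Qed.

Let jacF_t v j : jac c F u v 0 (t_index j) = v 0 (t_index j).
Proof.
rewrite (@jacF _ _ (fun y => y 0 (t_index j))); last by move=> y; rewrite glue_t.
rewrite (bigD1 (t_index j)) //=; have [_ ->] := derive_coord (t_index j) (t_index j) w.
rewrite eqxx mulr1 big1 ?addr0 // => a aj; have [_ ->] := derive_coord a (t_index j) w.
by rewrite (negbTE aj) mulr0.
Qed.

Let jacF_x v j : jac c F u v 0 (x_index j) =
  \sum_a v 0 a * 'D_(basis_vec a) (fun y => Hv y 0 (x_index j)) w.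
Proof. by apply: jacF => y; rewrite glue_x. Qed.

Let jacF_s v j : jac c F u v 0 (rshift (r + m) j) =
  \sum_a v 0 a * 'D_(basis_vec a) (fun y => He y 0 (rshift (r + m) j)) w.
Proof. by apply: jacF => y; rewrite glue_s. Qed.

Let jacF_s0 v j : (v <= \matrix_j Ze j w)%MS -> jac c F u v 0 (rshift (r + m) j) = 0.
Proof.
move=> /sub_rowsP[a ->]; rewrite -(mul_jacmx c F) mulmx_suml summxE big1 // => i _.
by rewrite -scalemxAl mxE (mul_jacmx c F) jacF_s DHe eq_shift mulr0.
Qed.

Let Zv_E j : (Zv j w <= \matrix_j Ze j w)%MS.
Proof.
have sdc := smooth_pairC (@smooth_chart_at _ _ _ c u sc).
have du := chart_at_dom u.
have E0 : tangent_coord c u (jac c (chart_at u) u (Zv j w)) = Zv j w by exact: jacK.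
rewrite -{1}E0 -memE; apply: (subvP (VE u)); rewrite memV E0.
by rewrite -(rowK (fun j => Zv j w)) row_sub.
Qed.

(** The differential of [F] sends [Zv j] to the basis vector: its t-part by reduction, its x-part by
    [DHv], and its s-part because [Zv j] lies in [E], whose vectors have no s-component. *)
Lemma tangent_coord_Ft j : tangent_coord c u (pullback_partial F (t_index j) u) = Zv j w.
Proof.
apply: (pullback_coordP Fu cu sc mu1 TF); apply/rowP => l; rewrite mxE eqxx /=.
case: (indexP l) => -[k ->].
- by rewrite jacF_t Zv1 t_index_eq eq_sym.
- by rewrite jacF_x DHv t_x_index_eq x_t_index_eq.
- by rewrite jacF_s0 ?Zv_E // eq_sym /t_index shift_index_eq.
Qed.

Lemma span_Ft : V u = <<[seq pullback_partial F (t_index j) u | j : 'I_r]>>%VS.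
Proof.
apply/vspaceP => v; rewrite memV (mem_span_rows (fun j => pullback_partial F (t_index j) u)).
rewrite -(@tangent_coord_sub _ _ _ c u _ (fun j => pullback_partial F (t_index j) u) v sc cu).
have -> // : \matrix_j tangent_coord c u (pullback_partial F (t_index j) u) = \matrix_j Zv j w.
by apply/row_matrixP => j; rewrite !rowK tangent_coord_Ft.
Qed.

(** A vector of [E] has no s-component in the chart [F], which gives one inclusion; [E] has rank
    [r + m], the number of spanning vectors, which gives equality. *)
Lemma span_Ft_Fx : E u = <<[seq pullback_partial F (t_index j) u | j : 'I_r] ++
  [seq pullback_partial F (x_index j) u | j : 'I_m]>>%VS.
Proof.
apply/eqP; rewrite eqEdim; apply/andP; split; last first.
  rewrite fiber_rank; apply: leq_trans (dim_span _) _.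
  by rewrite size_cat !size_map -!enumT !size_enum_ord.
apply/subvP => v; rewrite memE => Hv'.
rewrite (tangent_expand Fu mu1 TF v) big_split_ord /= big_split_ord /=.
rewrite [X in _ + X]big1 ?addr0; last first.
  move=> j _; rewrite (tangent_coord_via cu sc mu1 TF) jacF_s0 ?scale0r //.
apply: rpredD; apply: rpred_sum => j _; apply: rpredZ.
- by apply: memv_span; rewrite mem_cat; apply/orP; left; apply: (map_f (fun j => pullback_partial F (t_index j) u)); rewrite mem_enum.
- by apply: memv_span; rewrite mem_cat; apply/orP; right; apply: (map_f (fun j => pullback_partial F (x_index j) u)); rewrite mem_enum.
Qed.

(** The last [m] fields of the frame of [E] have neither t- nor s-component in [F]; this matrix
    holds their x-components, and its inverse expresses the fields d/dx through them. *)
Definition x_jacobian y : 'M[R]_m := \matrix_(l, k)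
  \sum_a Ze (rshift r l) y 0 a * 'D_(basis_vec a) (fun x => Hv x 0 (x_index k)) y.

Lemma tangent_coord_Fx j : x_jacobian w \in unitmx ->
  tangent_coord c u (pullback_partial F (x_index j) u) =
  \sum_l invmx (x_jacobian w) j l *: Ze (rshift r l) w.
Proof.
move=> uN; apply: (pullback_coordP Fu cu sc mu1 TF); set v := \sum_l _.
have jv l : jac c F u v 0 l =
    \sum_i invmx (x_jacobian w) j i * jac c F u (Ze (rshift r i) w) 0 l.
  rewrite -(mul_jacmx c F) /v mulmx_suml summxE; apply: eq_bigr => i _.
  by rewrite -scalemxAl mxE (mul_jacmx c F).
apply/rowP => l; rewrite mxE eqxx /= jv; case: (indexP l) => -[k ->].
- rewrite t_x_index_eq big1 // => i _.
  by rewrite jacF_t Ze1 eq_shift mulr0.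
- transitivity ((invmx (x_jacobian w) *m x_jacobian w) j k).
    by rewrite mxE; apply: eq_bigr => i _; rewrite jacF_x mxE.
  by rewrite mulVmx // mxE x_index_eq eq_sym.
- rewrite big1 => [|i _]; first by rewrite eq_sym shift_index_eq.
  by rewrite jacF_s DHe eq_shift mulr0.
Qed.
End AdaptedChart.

Theorem theorem1p7 (R : realType) (r m q : nat)
    (M : smoothManifold R (r + m + q)) (alpha beta : R)
    (V : tangentSubbundle M r) (E : tangentSubbundle M (r + m)) :
  1 < alpha -> 1 < beta ->
  subbundle_le V E -> involutive_subbundle V -> involutive_subbundle E ->
  subbundle_class (HZ alpha) V -> subbundle_class (HZ beta) E ->
  forall p : M, exists F : chart R (r + m + q) M,
    let U := chart_dom F in
    let Ft := fun j : 'I_r => pullback_partial F (t_index j) in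
    let Fx := fun j : 'I_m => pullback_partial F (x_index j) in
    [/\ U p /\ coordinate_system (HZ (Num.min alpha beta)) F,
        forall u, U u -> V u = <<[seq Ft j u | j : 'I_r]>>%VS,
        forall u, U u ->
          E u = <<[seq Ft j u | j : 'I_r] ++ [seq Fx j u | j : 'I_m]>>%VS,
        [/\ map_class HZ_infty U (t_part \o F),
            map_class (HZ alpha) U (x_part \o F) &
            map_class (HZ beta) U (s_part \o F)] &
        (forall j, field_class (HZ alpha) U (Ft j)) /\
        (forall j, field_class (HZ (Num.min (alpha - 1) beta)) U (Fx j))].
Proof.
move=> a1 b1 VE invV invE HV HE p0.
have a0 : 0 < alpha by exact: lt_trans a1.
have b0 : 0 < beta by exact: lt_trans b1.
set mu := Num.min alpha beta; set ga := Num.min (alpha - 1) beta.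
have mu1 : 1 < mu by rewrite lt_min a1.
have mu0 : 0 < mu by exact: lt_trans mu1.
have mua : mu <= alpha by rewrite ge_min lexx.
have mub : mu <= beta by rewrite ge_min lexx orbT.
have ga0 : 0 < ga by rewrite lt_min b0 subr_gt0 a1.
have gaa : ga <= alpha - 1 by rewrite ge_min lexx.
have gab : ga <= beta by rewrite ge_min lexx orbT.
have [A [uA VA EA]] := adapted_basis (fiber_rank V p0) (fiber_rank E p0) (VE p0).
have [c [sc [cp0 cdom] c0 tcA cE]] := affine_chart p0 uA.
have V0 v l : v \in V p0 -> l \notin codom (@t_index r m q) -> tangent_coord c p0 v 0 l = 0.
  move=> /VA[u vA]; rewrite tcA vA; case: (indexP l) => -[k ->].
  - by rewrite codom_f.
  - by rewrite row_mxEl row_mxEr mxE.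
  - by rewrite row_mxEr mxE.
have E0 v l : v \in E p0 -> l \notin codom (@lshift (r + m) q) -> tangent_coord c p0 v 0 l = 0.
  move=> /EA[u vA]; rewrite tcA vA; case: (split_ordP l) => k ->.
    by rewrite codom_f.
  by rewrite row_mxEr mxE.
have [Zv [Hv [nV HHv Hv0 DHv0 PV]]] :=
  subbundle_normal_form a1 invV HV sc cp0 c0 (@t_index_inj r m q) V0.
have [Ze [He [nE HHe He0 DHe0 PE]]] :=
  subbundle_normal_form b1 invE HE sc cp0 c0 (@lshift_inj (r + m) q) E0.
pose f y := glue y (Hv y) (He y).
have fl_locHZ y : (forall l, locHZ alpha (fun x => Hv x 0 l) y) ->
    (forall l, locHZ beta (fun x => He x 0 l) y) -> forall l, locHZ mu (fun x => f x 0 l) y.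
  move=> h1 h2 l; case: (indexP l) => -[k ->].
  - apply: (@locHZ_ext _ _ _ (fun x => x 0 (t_index k))); last exact: locHZ_coord.
    by near=> x; rewrite /f glue_t.
  - apply: (@locHZ_ext _ _ _ (fun x => Hv x 0 (x_index k))); last exact: locHZ_le (h1 _).
    by near=> x; rewrite /f glue_x.
  - apply: (@locHZ_ext _ _ _ (fun x => He x 0 (rshift (r + m) k))); last exact: locHZ_le (h2 _).
    by near=> x; rewrite /f glue_s.
have f0 : f 0 = 0.
  by apply/rowP => l; rewrite /f; case: (indexP l) => -[k ->];
     rewrite ?glue_t ?glue_x ?glue_s ?Hv0 ?He0.
have Df0 i l : 'D_(basis_vec i) (fun x => f x 0 l) 0 = (i == l)%:R.
  case: (indexP l) => -[k ->].
  - rewrite (near_eq_derive (g := fun x : 'rV[R]_(r + m + q) => x 0 (t_index k) : R)).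
      by have [_ ->] := derive_coord i (t_index k : 'I_(r + m + q)) (0 : 'rV[R]_(r + m + q)).
    by near=> x; rewrite /f glue_t.
  - rewrite (near_eq_derive (g := fun x : 'rV[R]_(r + m + q) => Hv x 0 (x_index k) : R)) //.
    by near=> x; rewrite /f glue_x.
  - rewrite (near_eq_derive (g := fun x : 'rV[R]_(r + m + q) => He x 0 (rshift (r + m) k) : R)) //.
    by near=> x; rewrite /f glue_s.
(* The entries multiply components of [Ze], of class [beta], by derivatives of [Hv], of class
   [alpha - 1]; this is the origin of [ga]. *)
have Njac y : (forall j l, locHZ beta (fun x => Ze j x 0 l) y) -> (forall l, locHZ alpha (fun x => Hv x 0 l) y) ->
    forall l k, locHZ ga (fun y => x_jacobian Ze Hv y l k) y.
  move=> h1 h2 l k.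
  apply: (@locHZ_ext _ _ _ (fun y => \sum_a Ze (rshift r l) y 0 a * 'D_(basis_vec a) (fun x => Hv x 0 (x_index k)) y)).
    by near=> x; rewrite mxE.
  apply: locHZ_sum => // a _; apply: locHZ_mul; first exact: locHZ_le (h1 _ _).
  by apply: (locHZ_le ga0 gaa); exact: locHZ_derive.
have [[_ _] HZe0 Ze00 _] := nbhs_singleton nE.
(* At the origin [Hv] has identity differential and the x-block of [Ze] is the identity by
   reduction. *)
have uN : x_jacobian Ze Hv 0 \in unitmx.
  have -> : x_jacobian Ze Hv 0 = 1%:M; last exact: unitmx1.
  apply/matrixP => l k; rewrite !mxE (bigD1 (x_index k)) //= DHv0 eqxx mulr1 Ze00 eq_shift.
  by rewrite big1 ?addr0 // => a ak; rewrite DHv0 (negbTE ak) mulr0.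
have nN := unitmx_near ga0 (Njac 0 HZe0 HHv) uN.
have nHv : \forall w \near (0 : 'rV[R]_(r + m + q)), forall l, locHZ alpha (fun x => Hv x 0 l) w.
  apply: (@filter_forall _ _ _ (nbhs (0 : 'rV[R]_(r + m + q))) (nbhs_filter _)) => l.
  exact: locHZ_near.
have nHe : \forall w \near (0 : 'rV[R]_(r + m + q)), forall l, locHZ beta (fun x => He x 0 l) w.
  apply: (@filter_forall _ _ _ (nbhs (0 : 'rV[R]_(r + m + q))) (nbhs_filter _)) => l.
  exact: locHZ_near.
have nI (P Q : set 'rV[R]_(r + m + q)) : nbhs (0 : 'rV[R]_(r + m + q)) P ->
    nbhs (0 : 'rV[R]_(r + m + q)) Q -> nbhs (0 : 'rV[R]_(r + m + q)) (P `&` Q).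
  exact: filterI.
have N := nI _ _ (nI _ _ (nI _ _ nV PV) (nI _ _ nE PE)) (nI _ _ (nI _ _ nHv nHe) nN).
have [r0 /= r00 Hr0] := (@nbhs_ballP _ _ (0 : 'rV[R]_(r + m + q)) _).1 N.
have [r1 [r2 [G [/andP[r10 r1r] r20 f_inj HG GK]]]] :=
  locHZ_local_inverse mu1 (fl_locHZ 0 HHv HHe) f0 Df0 r00.
have r1r0 : ball (0 : 'rV[R]_(r + m + q)) r1 `<=` ball 0 r0.
  by apply: ball_sub_ball; rewrite subrr normr0 add0r.
have facts y (By : ball 0 r1 y) := Hr0 y (r1r0 y By).
have Hf y l : ball 0 r1 y -> locHZ mu (fun x => f x 0 l) y.
  by move=> /facts[_ [[h1 h2] _]]; exact: fl_locHZ.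
have cf y : ball 0 r1 y -> {for y, continuous f}.
  by move=> By; apply: (@locHZ_continuous_rV _ _ _ mu) => l; exact: Hf.
(* [f] is injective on the ball of radius [r1] and covers the ball of radius [r2], so it maps [B]
   bijectively onto the latter; this makes the range of [F] open. *)
pose B := ball (0 : 'rV[R]_(r + m + q)) r1 `&` f @^-1` ball 0 r2.
have oB : open B.
  rewrite openE => y [By fBy]; apply: filterI.
    by apply: open_nbhs_nbhs; split => //; exact: ball_open.
  by apply: (cf y By); apply: open_nbhs_nbhs; split => //; exact: ball_open.
have Bc : B `<=` c @` chart_dom c.
  by move=> y [/facts[[[[[h1 h2] _ _ _] _] _] _] _]; exists (chart_inv c y).
have ofB : open (f @` B).
  have -> : f @` B = ball 0 r2; last exact: ball_open.
  apply/seteqP; split => y /=; first by move=> [z [_ Bz] <-].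
  by move=> By; have [h1 h2] := GK _ By; exists (G y) => //; split; rewrite /= ?h2.
have GfK y : B y -> G (f y) = y.
  by move=> [By fBy]; have [h1 h2] := GK _ fBy; exact: f_inj.
have cfB y : B y -> {for y, continuous f} by move=> [By _]; exact: cf.
have cGB y : B y -> {for f y, continuous G}.
  by move=> [_ By]; apply: (@locHZ_continuous_rV _ _ _ mu) => l; exact: HG.
pose F := make_chart oB Bc ofB GfK cfB cGB.
have Fp0 : chart_dom F p0.
  by split => //=; rewrite c0; split; rewrite /= ?f0; exact: ballxx.
have oF : open (chart_dom F) by exact: chart_dom_open.
have Fc u : chart_dom F u -> chart_dom c u by case.
have FB u : chart_dom F u -> B (c u) by case.
have TF u : chart_dom F u -> forall d, d = c \/ atlas d -> chart_dom d u ->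
    transition_locHZ mu F d u /\ transition_locHZ mu d F u.
  move=> Fu d Hd du; have [Bu fBu] := FB _ Fu.
  have scd : smooth_pair c d.
    by case: Hd => [->|ad]; [exact: smooth_pair_refl|exact: smooth_pair_atlas].
  by apply: (make_chart_transition mu1 scd Fu du) => l; [exact: Hf|exact: HG].
have Fnear u : chart_dom F u -> \forall y \near c u,
    [/\ chart_dom F (chart_inv c y), c (chart_inv c y) = y & F (chart_inv c y) = f y].
  move=> Fu; apply: filterS (chart_near (Fc u Fu) (open_nbhs_nbhs (conj oF Fu))) => y [_ h1 h2].
  by split => //=; rewrite h2.
have FE u : chart_dom F u -> \forall y \near c u, F (chart_inv c y) = glue y (Hv y) (He y).
  by move=> /Fnear; apply: filterS => y [].
have cinv u : chart_dom F u -> chart_inv c (c u) = u by move=> /Fc; exact: chart_mapE.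
have FtE j u : chart_dom F u -> tangent_coord c u (pullback_partial F (t_index j) u) = Zv j (c u).
  move=> Fu; have [Bu _] := FB _ Fu; have [[[[_ _ h1 h2] h3] [[_ _ h4 h5] h6]] _] := facts _ Bu.
  rewrite (cinv u Fu) in h2 h5.
  exact: (tangent_coord_Ft VE Fu (Fc u Fu) sc mu1 (TF u Fu) (FE u Fu) h1 h2 h5 h3 h6).
have FxE j u : chart_dom F u -> tangent_coord c u (pullback_partial F (x_index j) u) =
    \sum_l invmx (x_jacobian Ze Hv (c u)) j l *: Ze (rshift r l) (c u).
  move=> Fu; have [Bu _] := FB _ Fu; have [[_ [[_ _ h4 _] h6]] [_ h7]] := facts _ Bu.
  exact: (tangent_coord_Fx Fu (Fc u Fu) sc mu1 (TF u Fu) (FE u Fu) h4 h6 j h7).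
exists F; split.
- split=> // d ad; split; apply: locally_of_locHZ => // y.
    move=> [u [du Fu] <-]; split; first exact: chart_image_nbhs.
    by have [_ h] := TF u Fu d (or_intror ad) du.
  move=> [u [Fu du] <-]; split; first by apply: chart_image_nbhs => //; exact: chart_dom_open.
  by have [h _] := TF u Fu d (or_intror ad) du.
- move=> u Fu; have [Bu _] := FB _ Fu; have [[[[_ _ h1 h2] h3] [[_ _ h4 h5] h6]] _] := facts _ Bu.
  rewrite (cinv u Fu) in h2 h5.
  exact: (span_Ft VE Fu (Fc u Fu) sc mu1 (TF u Fu) (FE u Fu) h1 h2 h5 h3 h6).
- move=> u Fu; have [Bu _] := FB _ Fu; have [[[[_ _ h1 h2] h3] [[_ _ h4 h5] h6]] _] := facts _ Bu.
  rewrite (cinv u Fu) in h2 h5.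
  exact: (span_Ft_Fx Fu (Fc u Fu) sc mu1 (TF u Fu) (FE u Fu) h5 h6).
- have Tc d u gamma : atlas d -> chart_dom d u -> chart_dom F u -> 0 < gamma ->
      transition_locHZ gamma d c u.
    by move=> ad du Fu g0; have [_ h] := sc d u gamma ad (Fc u Fu) du g0.
  split=> d ad.
  + move=> y [u [du Fu] <-].
    have c0u : chart_dom (chart_at p0) u by apply: cdom; exact: Fc.
    (* Passing to germs would lose the common domain, so the domain [D], valid for all classes at
       once, is taken directly from the atlas. *)
    have [D [oD _ Dy _ HD]] := atlas_smooth ad (chart_at_atlas p0)
      (ex_intro2 _ _ u (conj du c0u) erefl).
    have /nbhs_ballP[e /= e0 eDA] : nbhs (d u) (D `&` d @` (chart_dom d `&` chart_dom F)).
      by apply: filterI; [exact: open_nbhs_nbhs|exact: chart_image_nbhs].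
    pose rho := Num.min (e / 4) (4^-1).
    have rho0 : 0 < rho by rewrite lt_min !divr_gt0 //= invr_gt0.
    have rho1 : rho <= e / 4 by rewrite /rho ge_min lexx.
    have rho2 : rho <= 4^-1 by rewrite /rho ge_min lexx orbT.
    have rho3 : rho <= 2^-1 by clear - rho2; lra.
    have gB := good_ball (d u) rho3.
    have B4e : ball (d u) (4 * rho) `<=` ball (d u) e.
      by apply: ball_sub_ball; rewrite subrr normr0; clear - rho1 rho0; lra.
    have B4 : ball (d u) (4 * rho) `<=` D by move=> y' /B4e /eDA[].
    have BA : ball (d u) rho `<=` d @` (chart_dom d `&` chart_dom F).
      apply: subset_trans (_ : _ `<=` ball (d u) e) _; last by move=> y' /eDA[].
      by apply: ball_sub_ball; rewrite subrr normr0; clear - rho1 rho0; lra.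
    exists (ball (d u) rho); split => //; first exact: ball_open.
    * by apply: boxy_convex; case: gB.
    * exact: ballxx.
    * move=> j; have H := HZ_infty_affine (A ^~ (t_index j)) (- (chart_at p0 p0 *m A) 0 (t_index j)) rho0 ltac:(clear - rho2; lra) B4 HD.
      rewrite (_ : (fun y => _) = (fun y => \sum_i A i (t_index j) *
         (chart_at p0 \o chart_inv d) y 0 i + (- (chart_at p0 p0 *m A) 0 (t_index j)))) //.
      apply/funext => z; transitivity (c (chart_inv d z) 0 (t_index j)).
        by rewrite -(glue_t (c (chart_inv d z)) (Hv (c (chart_inv d z))) (He (c (chart_inv d z)))) /= !mxE.
      rewrite cE mulmxBl [LHS]mxE [X in _ + X]mxE; congr (_ + _).
      by rewrite mxE; apply: eq_bigr => i _; rewrite mulrC.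
  + apply: locally_of_locHZ => // y [u [du Fu] <-]; split; first exact: chart_image_nbhs.
    move=> j; apply: (@locHZ_ext _ _ _ (fun y => Hv (c (chart_inv d y)) 0 (x_index j))).
      by near=> z; rewrite /= -(glue_x (c (chart_inv d z)) _ (He (c (chart_inv d z)))) !mxE.
    apply: (locHZ_comp (f := fun y => Hv y 0 (x_index j)) (g := fun y => c (chart_inv d y)) a1).
      by rewrite chart_mapE //; have [Bu _] := FB _ Fu; have [_ [[h _] _]] := facts _ Bu.
    exact: Tc.
  + apply: locally_of_locHZ => // y [u [du Fu] <-]; split; first exact: chart_image_nbhs.
    move=> j; apply: (@locHZ_ext _ _ _ (fun y => He (c (chart_inv d y)) 0 (rshift (r + m) j))).
      by near=> z; rewrite /= -(glue_s (c (chart_inv d z)) (Hv (c (chart_inv d z)))) !mxE.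
    apply: (locHZ_comp (f := fun y => He y 0 (rshift (r + m) j)) (g := fun y => c (chart_inv d y)) b1).
      by rewrite chart_mapE //; have [Bu _] := FB _ Fu; have [_ [[_ h] _]] := facts _ Bu.
    exact: Tc.
- have nfield X (Y : 'rV[R]_(r + m + q) -> 'rV[R]_(r + m + q)) u l : chart_dom F u ->
      (forall v, chart_dom F v -> tangent_coord c v (X v) = Y (c v)) ->
      \forall y \near c u, Y y 0 l = field_in_chart X c y 0 l.
    move=> Fu H; apply: filterS (Fnear u Fu) => y [h1 h2 _].
    by rewrite -[in RHS]h2 field_in_chartE ?H ?h2 //; exact: Fc.
  split=> j; apply: (field_class_of_locHZ (c := c)) => // u l Fu; have [Bu _] := FB _ Fu.
    apply: (locHZ_ext (nfield _ (Zv j) u l Fu (fun v Fv => FtE j v Fv))).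
    by have [[[[_ h _ _] _] _] _] := facts _ Bu.
  apply: (locHZ_ext (nfield _ (fun y => \sum_i invmx (x_jacobian Ze Hv y) j i *: Ze (rshift r i) y) u l Fu (fun v Fv => FxE j v Fv))).
  have [[_ [[_ h1 _ _] _]] [[h2 _] h3]] := facts _ Bu.
  (* The inverse Jacobian has class [ga] and the frame of [E] has the higher class [beta], so the
     products have class [ga]. *)
  apply: (@locHZ_ext _ _ _ (fun y => \sum_i invmx (x_jacobian Ze Hv y) j i * Ze (rshift r i) y 0 l)).
    by near=> y; rewrite /= summxE; apply: eq_bigr => i _; rewrite mxE.
  apply: locHZ_sum => // i _; apply: locHZ_mul; last exact: locHZ_le (h1 _ _).
  exact: (locHZ_invmx ga0 (Njac _ h1 h2) h3).
Unshelve. all: by end_near. Qed.
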